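(* Assume $\lambda_1<\lambda_2$ and let $u_1$ be an eigenfunction for $\lambda_1$ with $\|u_1\|_b=1$. There exist $\delta_0>0$ and constants $C_5,C_6>0$, depending on $1/(\lambda_2-\lambda_1)$ and $\lambda_1$ but independent of the mesh sizes $h_k$ and $h_{k+1}$, such that the following holds. Let $V_{h_k}\subset V_{h_{k+1}}\subset V$ be finite element spaces, let $u_{1,h_k}\in V_{h_k}$ satisfy $\|u_{1,h_k}\|_b=1$, and let $\lambda_{1,h_k}=a(u_{1,h_k},u_{1,h_k})/b(u_{1,h_k},u_{1,h_k})$. Assume that $(\lambda_{1,h_k},u_{1,h_k})$ is a good enough approximation to $(\lambda_1,u_1)$, namely $\|u_{1,h_k}-u_1\|_a\le\delta_0$, such that for some $\alpha,\sigma>0$ $$a(v,v)-\lambda_{1,h_k}b(v,v)\ge\alpha\|v\|_a^2\quad\forall v\in V \text{ with } b(u_{1,h_k},v)=0,\qquad \sup_{0\ne v\in V}\frac{-\nu\, b(u_{1,h_k},v)}{\|v\|_a}\ge\sigma|\nu|\quad\forall\nu\in\mathbb{R}.$$ Let $(\lambda_{1,h_{k+1}},u_{1,h_{k+1}})\in\mathbb{R}\times V_{h_{k+1}}$ be the result of one Newton iteration step (defined in the context) applied to $(\lambda_{1,h_k},u_{1,h_k})$ in $V_{h_{k+1}}$, and let $(\bar\lambda_{1,h_{k+1}},\bar u_{1,h_{k+1}})$ be the first eigenpair of the discrete eigenvalue problem in $V_{h_{k+1}}$, with $\|\bar u_{1,h_{k+1}}\|_b=1$. Then $$\|\bar u_{1,h_{k+1}}-u_{1,h_{k+1}}\|_a\le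 C_5\|\bar u_{1,h_{k+1}}-u_{1,h_k}\|_a^2,$$ $$|\bar\lambda_{1,h_{k+1}}-\lambda_{1,h_{k+1}}|\le C_6\|\bar u_{1,h_{k+1}}-u_{1,h_k}\|_a^4.$$
   Context: $\Omega\subset\mathbb{R}^d$ ($d=2,3$) is a bounded domain, $V=H_0^1(\Omega)$ (real-valued functions), $a(u,v)=\int_\Omega\nabla u\cdot\nabla v\,d\Omega$, $b(u,v)=\int_\Omega uv\,d\Omega$, $\|v\|_a^2=a(v,v)$, $\|v\|_b^2=b(v,v)$. The eigenvalue problem is: find $(\lambda,u)\in\mathbb{R}\times V$ with $b(u,u)=1$ and $a(u,v)=\lambda b(u,v)$ for all $v\in V$; its eigenvalues, repeated according to multiplicity, are $\lambda_1\le\lambda_2\le\cdots\to\infty$. $V_h\subset V$ denotes the (finite-dimensional) linear finite element space on a shape-regular mesh of $\Omega$ with mesh size $h$. The discrete eigenvalue problem in $V_h$ is: find $(\bar\lambda_h,\bar u_h)\in\mathbb{R}\times V_h$ with $b(\bar u_h,\bar u_h)=1$ and $a(\bar u_h,v_h)=\bar\lambda_h b(\bar u_h,v_h)$ for all $v_h\in V_h$; its first (smallest) eigenvalue and a corresponding eigenfunction are $\bar\lambda_{1,h}$, $\bar u_{1,h}$. One Newton iteration step. Given $(\lambda_{1,h_k},u_{1,h_k})\in\mathbb{R}\times V_{h_k}$ with $\|u_{1,h_k}\|_b=1$ and $V_{h_k}\subset V_{h_{k+1}}$: (1) Find $(\widehat\lambda_{1,h_{k+1}},\widehat u_{1,h_{k+1}})\in\mathbb{R}\times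 V_{h_{k+1}}$ such that $$a(\widehat u_{1,h_{k+1}},v)-\lambda_{1,h_k}b(\widehat u_{1,h_{k+1}},v)-\widehat\lambda_{1,h_{k+1}}b(u_{1,h_k},v)=-\lambda_{1,h_k}b(u_{1,h_k},v)\quad\forall v\in V_{h_{k+1}},$$ $$b(\widehat u_{1,h_{k+1}},u_{1,h_k})=b(u_{1,h_k},u_{1,h_k}).$$ (2) Set $u_{1,h_{k+1}}=\widehat u_{1,h_{k+1}}/\|\widehat u_{1,h_{k+1}}\|_b$ and $\lambda_{1,h_{k+1}}=a(u_{1,h_{k+1}},u_{1,h_{k+1}})/b(u_{1,h_{k+1}},u_{1,h_{k+1}})$. *)

(* Defs.v *)
From HB Require Import structures.
From mathcomp Require Import all_boot all_order all_algebra.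
From mathcomp Require Import all_classical all_reals all_analysis.

Set Implicit Arguments.
Unset Strict Implicit.
Unset Printing Implicit Defensive.

Import Order.TTheory GRing.Theory Num.Def Num.Theory.
Import numFieldNormedType.Exports.
Local Open Scope classical_set_scope.
Local Open Scope ring_scope.

(* R^d is 'rV[R]_d; its sigma-algebra is generated by the coordinates, in the
   same way as the library does for n.-tuple. *)
Definition rv_display : measure_display -> measure_display.
Proof. exact. Qed.

Section measurable_rV.
Context {disp : measure_display} {T : measurableType disp}.
Variable n : nat.

Definition rv_coord (i : 'I_n) (x : 'rV[T]_n) : T := x ord0 i.

Let rv_set0 : g_sigma_preimage rv_coord set0.
Proof. exact: sigma_algebra0. Qed.

Let rv_setC A : g_sigma_preimage rv_coord A -> g_sigma_preimage rv_coord (~` A).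
Proof. exact: sigma_algebraC. Qed.

Let rv_bigcup (F : _^nat) : (forall i, g_sigma_preimage rv_coord (F i)) ->
  g_sigma_preimage rv_coord (\bigcup_i (F i)).
Proof. exact: sigma_algebra_bigcup. Qed.

HB.instance Definition _ := @isMeasurable.Build (rv_display disp)
  'rV[T]_n (g_sigma_preimage rv_coord) rv_set0 rv_setC rv_bigcup.

Lemma measurable_rv_coord (i : 'I_n) :
  measurable_fun [set: 'rV[T]_n] (rv_coord i).
Proof.
move=> _ Y mY; rewrite setTI; apply: sub_sigma_algebra => /=.
rewrite -bigcup_seq/=; exists i => /=; first by rewrite mem_index_enum.
by exists Y => //; rewrite setTI.
Qed.

Lemma measurable_fun_rvP d1 (T1 : measurableType d1) (f : T1 -> 'rV[T]_n) :
  (forall i, measurable_fun [set: T1] (fun x => f x ord0 i)) ->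
  measurable_fun [set: T1] f.
Proof.
move=> mf.
suff : g_sigma_preimage (fun i => rv_coord i \o f) `<=` measurable.
  by rewrite g_sigma_preimage_comp => prefS _ A mA; apply: prefS; exists A.
apply: smallest_sub; first exact: sigma_algebra_measurable.
rewrite -bigcup_seq; apply: bigcup_sub => i _.
by move=> A [B mB <-]; exact: mf.
Qed.

End measurable_rV.

Section lebesgue_rV.
Variable R : realType.

Definition rv_cons n (p : measurableTypeR R * 'rV[R]_n) : 'rV[R]_n.+1 :=
  \row_i oapp (fun j => p.2 ord0 j) p.1 (unlift ord0 i).

Definition rv_uncons n (x : 'rV[R]_n.+1) : measurableTypeR R * 'rV[R]_n :=
  (x ord0 ord0, \row_i x ord0 (lift ord0 i)).

Lemma rv_consE0 n (p : measurableTypeR R * 'rV[R]_n) :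
  rv_cons p ord0 ord0 = p.1.
Proof. by rewrite mxE unlift_none. Qed.

Lemma rv_consES n (p : measurableTypeR R * 'rV[R]_n) i :
  rv_cons p ord0 (lift ord0 i) = p.2 ord0 i.
Proof. by rewrite mxE liftK. Qed.

Lemma rv_consK n : cancel (@rv_cons n) (@rv_uncons n).
Proof.
move=> [x y]; rewrite /rv_uncons rv_consE0; congr (_, _).
by apply/rowP => i; rewrite mxE rv_consES.
Qed.

Lemma rv_unconsK n : cancel (@rv_uncons n) (@rv_cons n).
Proof.
move=> x; apply/rowP => i; case: (unliftP ord0 i) => [j ->|->].
  by rewrite rv_consES mxE.
by rewrite rv_consE0.
Qed.

Lemma measurable_rv_cons n : measurable_fun setT (@rv_cons n).
Proof.
apply: measurable_fun_rvP => i; case: (unliftP ord0 i) => [j ->|->].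
- rewrite (_ : (fun _ => _) = rv_coord j \o snd); last first.
    by apply/funext => p /=; rewrite rv_consES.
  by apply: measurableT_comp => //; exact: measurable_rv_coord.
- rewrite (_ : (fun _ => _) = fst); last first.
    by apply/funext => p /=; rewrite rv_consE0.
  exact: measurable_fst.
Qed.

Lemma measurable_rv_uncons n : measurable_fun setT (@rv_uncons n).
Proof.
apply/measurable_fun_pairP; split; first exact: measurable_rv_coord.
apply: measurable_fun_rvP => i.
rewrite (_ : (fun _ => _) = rv_coord (lift ord0 i)); last first.
  by apply/funext => x /=; rewrite mxE.
exact: measurable_rv_coord.
Qed.

Local Open Scope ereal_scope.

Section step.
Variables (n : nat) (mu : {sigma_finite_measure set 'rV[R]_n -> \bar R}).

Definition leb_step : set 'rV[R]_n.+1 -> \bar R :=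
  pushforward (@lebesgue_measure R \x mu) (@rv_cons n).

Let leb_step0 : leb_step set0 = 0.
Proof. by rewrite /leb_step /pushforward preimage_set0 measure0. Qed.

Let leb_step_ge0 A : 0 <= leb_step A.
Proof. by rewrite /leb_step /pushforward; exact: measure_ge0. Qed.

Let leb_step_sigma_additive : semi_sigma_additive leb_step.
Proof.
have mc A : measurable A -> measurable (@rv_cons n @^-1` A).
  by move=> mA; rewrite -[X in measurable X]setTI; exact: measurable_rv_cons.
move=> F mF tF mUF; rewrite /leb_step /pushforward preimage_bigcup.
apply: measure_semi_sigma_additive.
- by move=> k; exact: mc.
- apply/trivIsetP => /= i j _ _ ij; rewrite -preimage_setI.
  by move/trivIsetP : tF => /(_ _ _ _ _ ij) ->//; rewrite preimage_set0.
- by rewrite -preimage_bigcup; exact: mc.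
Qed.

HB.instance Definition _ := isMeasure.Build _ _ _ leb_step
  leb_step0 leb_step_ge0 leb_step_sigma_additive.

Let leb_step_sigma_finite : sigma_finite setT leb_step.
Proof.
have /sigma_finiteP[F [TF ndF Foo]] := sigma_finiteT (@lebesgue_measure R).
have /sigma_finiteP[G [TG ndG Goo]] := sigma_finiteT mu.
exists (fun k => @rv_uncons n @^-1` (F k `*` G k)).
  rewrite -preimage_bigcup; apply/esym/seteqP; split => // x _.
  have [[i _ Fi] [j _ Gj]] : (\bigcup_k F k) (rv_uncons x).1 /\
      (\bigcup_k G k) (rv_uncons x).2 by rewrite -TF -TG.
  exists (maxn i j) => //; split.
  - exact: (subsetPset _ _ (ndF _ _ (leq_maxl i j))).
  - exact: (subsetPset _ _ (ndG _ _ (leq_maxr i j))).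
move=> k; have [mF Fk] := Foo k; have [mG Gk] := Goo k; split.
  rewrite -[X in measurable X]setTI.
  by apply: measurable_rv_uncons => //; exact: measurableX.
rewrite /leb_step /pushforward -comp_preimage (_ : _ \o _ = id); last first.
  by apply/funext => p /=; rewrite rv_consK.
rewrite preimage_id product_measure1E//.
by rewrite lte_mul_pinfty// ge0_fin_numE.
Qed.

HB.instance Definition _ := Measure_isSigmaFinite.Build _ _ _ leb_step
  leb_step_sigma_finite.

End step.

(* Lebesgue measure on R^n, as an iterated product measure. *)
Fixpoint leb (n : nat) : {sigma_finite_measure set 'rV[R]_n -> \bar R} :=
  match n return {sigma_finite_measure set 'rV[R]_n -> \bar R} with
  | 0%N => @dirac _ 'rV[R]_0 0%R R
  | m.+1 => leb_step (leb m)
  end.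

End lebesgue_rV.

Section sobolev.
Context {R : realType} {d : nat}.
Implicit Types (Omega : set 'rV[R]_d) (u v phi : 'rV[R]_d -> R).
Implicit Types (g : 'I_d -> 'rV[R]_d -> R).

Definition bounded_domain Omega : Prop :=
  [/\ open Omega, connected Omega, Omega !=set0 & bounded_set Omega].

Definition partial (i : 'I_d) phi : 'rV[R]_d -> R :=
  fun x => 'D_(delta_mx ord0 i) phi x.

(* Every iterated partial derivative is differentiable, hence continuous. *)
Definition smooth phi : Prop :=
  forall (s : seq 'I_d) (x : 'rV[R]_d), differentiable (foldr partial phi s) x.

Definition tsupport phi : set 'rV[R]_d := closure [set x | phi x != 0].

Definition test_function Omega phi : Prop :=
  [/\ smooth phi, compact (tsupport phi) & tsupport phi `<=` Omega].

Definition L2 Omega u : Prop :=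
  measurable_fun Omega u /\
  (leb R d).-integrable Omega (fun x => (u x ^+ 2)%:E).

Definition L2_dist2 Omega u v : R :=
  \int[leb R d]_(x in Omega) ((u x - v x) ^+ 2).

Definition weak_gradient Omega u g : Prop :=
  forall i, L2 Omega (g i) /\
    forall phi, test_function Omega phi ->
      \int[leb R d]_(x in Omega) (u x * partial i phi x) =
      - \int[leb R d]_(x in Omega) (g i x * phi x).

(* u lies in the closure of the test functions for the norm of H^1(Omega),
   g being its weak gradient. *)
Definition H10_gradient Omega u g : Prop :=
  [/\ L2 Omega u, weak_gradient Omega u g &
    exists phi : nat -> 'rV[R]_d -> R,
      [/\ forall n, test_function Omega (phi n),
          L2_dist2 Omega (phi n) u @[n --> \oo] --> (0 : R) &
          forall i, L2_dist2 Omega (partial i (phi n)) (g i)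
            @[n --> \oo] --> (0 : R)]].

(* Elements of H^1_0(Omega) are represented by functions, which are to be
   considered up to equality almost everywhere on Omega. *)
Definition H10 Omega : set ('rV[R]_d -> R) :=
  [set u | exists g, H10_gradient Omega u g].

(* The weak gradient of u; meaningful only for u in H^1_0(Omega), where it is
   unique up to equality almost everywhere on Omega. *)
Definition grad Omega u : 'I_d -> 'rV[R]_d -> R :=
  get [set g | H10_gradient Omega u g].

Definition ae_eq_on Omega u v : Prop :=
  {ae leb R d, forall x, Omega x -> u x = v x}.

Definition form_a Omega u v : R :=
  \int[leb R d]_(x in Omega) \sum_(i < d) grad Omega u i x * grad Omega v i x.

Definition form_b Omega u v : R := \int[leb R d]_(x in Omega) (u x * v x).

Definition norm_a Omega v : R := sqrtr (form_a Omega v v).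
Definition norm_b Omega v : R := sqrtr (form_b Omega v v).

(* Eigenpairs of the problem posed in the space W: the continuous problem for
   W = H10 Omega, the discrete one for W a finite element space. *)
Definition eigenpair Omega (W : set ('rV[R]_d -> R)) (lambda : R) u : Prop :=
  [/\ W u, form_b Omega u u = 1 &
      forall v, W v -> form_a Omega u v = lambda * form_b Omega u v].

Definition first_eigenpair Omega (W : set ('rV[R]_d -> R)) (lambda : R) u :
    Prop :=
  eigenpair Omega W lambda u /\
  forall mu w, eigenpair Omega W mu w -> lambda <= mu.

(* lam 0 <= lam 1 <= ... lists the eigenvalues with their multiplicities: for
   every mu, the e n with lam n = mu form a basis of the eigenspace of mu.
   Indices are shifted by one: lambda_1 is lam 0 and lambda_2 is lam 1. *)
Definition eigenvalue_sequence Omega (lam : nat -> R) : Prop :=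
  [/\ {homo lam : m n / (m <= n)%N >-> m <= n},
      lam n @[n --> \oo] --> +oo &
      exists e : nat -> 'rV[R]_d -> R,
        [/\ forall n, eigenpair Omega (H10 Omega) (lam n) (e n),
            forall m n, m != n -> form_b Omega (e m) (e n) = 0 &
            forall mu w, eigenpair Omega (H10 Omega) mu w ->
              exists (N : nat) (c : nat -> R),
                ae_eq_on Omega w
                  (fun x => \sum_(0 <= n < N | lam n == mu) c n * e n x)]].

(* One Newton step from (lambda, u), performed in the space W, can return
   (lambda', u'). *)
Definition newton_step Omega (W : set ('rV[R]_d -> R))
    (lambda : R) u (lambda' : R) u' : Prop :=
  exists (hlambda : R) (hu : 'rV[R]_d -> R),
    [/\ [/\ W hu,
            forall v, W v ->
              form_a Omega hu v - lambda * form_b Omega hu v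
                - hlambda * form_b Omega u v = - (lambda * form_b Omega u v) &
            form_b Omega hu u = form_b Omega u u],
        u' = (fun x => hu x / norm_b Omega hu) &
        lambda' = form_a Omega u' u' / form_b Omega u' u'].

End sobolev.

Section finite_elements.
Context {R : realType} {d : nat}.
Implicit Types (Omega : set 'rV[R]_d) (K : d.+1.-tuple 'rV[R]_d).

(* The library norm on 'rV[R]_d is the maximum norm. *)
Definition enorm (x : 'rV[R]_d) : R := sqrtr (\sum_(i < d) x ord0 i ^+ 2).

Definition conv_hull (s : seq 'rV[R]_d) : set 'rV[R]_d :=
  [set x | exists w : 'I_(size s) -> R,
    [/\ forall i, 0 <= w i, \sum_i w i = 1 & x = \sum_i w i *: s`_i]].

Definition affinely_independent (s : seq 'rV[R]_d) : Prop :=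
  forall w : 'I_(size s) -> R,
    \sum_i w i = 0 -> \sum_i w i *: s`_i = 0 -> forall i, w i = 0.

(* A simplex is given by its d + 1 vertices. Two simplices of a conforming mesh
   meet in the face spanned by their common vertices, possibly empty. *)
Definition simplicial_mesh Omega (M : seq (d.+1.-tuple 'rV[R]_d)) : Prop :=
  [/\ forall K, K \in M -> affinely_independent K,
      forall K L, K \in M -> L \in M ->
        conv_hull K `&` conv_hull L = conv_hull [seq x <- K | x \in L] &
      closure Omega = \bigcup_(K in [set` M]) conv_hull K].

Definition diam (A : set 'rV[R]_d) : R :=
  sup [set r | exists x y, [/\ A x, A y & r = enorm (x - y)]].

Definition inball_diam (A : set 'rV[R]_d) : R :=
  sup [set r | exists c rho,
    [/\ 0 <= rho, [set x | enorm (x - c) <= rho] `<=` A & r = 2 * rho]].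

Definition shape_regular (gamma : R) (M : seq (d.+1.-tuple 'rV[R]_d)) : Prop :=
  forall K, K \in M ->
    diam (conv_hull K) <= gamma * inball_diam (conv_hull K).

Definition affine_on (A : set 'rV[R]_d) (v : 'rV[R]_d -> R) : Prop :=
  exists (p : 'rV[R]_d) (c : R),
    forall x, A x -> v x = \sum_(i < d) p ord0 i * x ord0 i + c.

(* Linear finite elements; v = 0 on the boundary is encoded by v in H10. *)
Definition P1_space Omega (M : seq (d.+1.-tuple 'rV[R]_d)) :
    set ('rV[R]_d -> R) :=
  [set v | [/\ H10 Omega v, {within closure Omega, continuous v} &
      forall K, K \in M -> affine_on (conv_hull K) v]].

End finite_elements.

(* Main.v *)
Require Import Defs.
From mathcomp Require Import all_boot all_order all_algebra.
From mathcomp Require Import all_classical all_reals all_analysis.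
From mathcomp Require Import measurable_realfun ring lra.

(* Let [s = b(bu, uk)], [uk = s bu + w], [hu = p bu + r] with [w] and [r]
   b-orthogonal to [bu]. Testing the Newton equation with [bu] and with [r]
   gives, as for Rayleigh quotient iteration, [||r||_a <= C |p| ||w||_a^2],
   provided [a >= lambda_2 b] on the orthogonal of [bu] in the discrete space,
   [lambda_k] stays away from [lambda_2] and [s] away from 0. By the min-max
   principle all this follows from [a(w, w) >= lambda_2 b(w, w)] for
   [b(w, u_1) = 0]. When [s < 0] the Newton step approximates [- bu], but then
   [||bu - uk||_a^2 >= lambda_1], which is why the constant contains
   [4 / lambda_1].

   The bound on the orthogonal of [u_1] is where compactness is needed: a
   minimiser of the Rayleigh quotient must exist, as it is then an eigenfunction
   and its eigenvalue belongs to the given list. In place of Rellich's theorem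
   we use that, for every [eps], [b(v, v) <= eps a(v, v) + C sum_j l_j(v)^2] with
   finitely many functionals [l_j], namely averages over the cells of a grid. If
   [m eps < 1], where [m] is the infimum, a minimising sequence along which all
   [l_j] converge is Cauchy by the parallelogram identity. *)

Set Implicit Arguments.
Unset Strict Implicit.
Unset Printing Implicit Defensive.

Import Order.TTheory GRing.Theory Num.Theory.
Import numFieldNormedType.Exports.
Local Open Scope classical_set_scope.
Local Open Scope ring_scope.

(** * Positive semidefinite forms and constrained minimisation *)

(** Functions are not identified when they agree almost everywhere, so [b] is only semidefinite: the
    arguments run with semidefinite forms on a subspace, and uniqueness always means that some
    [b(v, v)] vanishes. One existence lemma for constrained minimisers serves twice: on the
    orthogonal of [u_1] in [H10], and in the finite element space, where the first discrete
    eigenvalue is given as the smallest eigenvalue and not as the minimum of the Rayleigh quotient.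
    With [e = uk - u_1] one has [lambda_k - lambda_1 = a(e, e) - lambda_1 b(e, e)]. A small
    [delta_0] thus keeps [lambda_k] in the lowest quarter of the gap, which forces [s^2 >= 2/3] and
    [lambda_2 - lambda_k >= 3/4 (lambda_2 - lambda_1)]. For squared norms the constant is [4 /
    lambda_1 + 2 lambda_2 / (lambda_2 - lambda_1)^2]. The second term is the bound on [r], doubled
    because, when [s > 0], normalisation leaves an error along [bu] that is no larger than [r]
    itself. The inequality with cell averages is obtained by induction on the dimension, as the
    measure is an iterated product. *)

Lemma discriminant_le (R : realFieldType) (A B C : R) : 0 <= A -> 0 <= C ->
  (forall k, 0 <= k ^+ 2 * A + 2 * k * B + C) -> B ^+ 2 <= A * C.
Proof.
move=> A0 C0 h; have [A1|A1] := eqVneq A 0.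
  suff -> : B = 0 by rewrite A1 mul0r expr0n.
  (* For [A = 0] the polynomial is affine in [k]; if [B] were nonzero, this [k] would give it the
     value -1. *)
  apply/eqP/negPn/negP => B0; have := h (- (C + 1) / (2 * B)).
  rewrite A1 mulr0 add0r.
  suff -> : 2 * (- (C + 1) / (2 * B)) * B + C = -1 by rewrite ler0N1.
  by field.
have Ap : 0 < A by rewrite lt_def A1.
have := h (- B / A).
have -> : (- B / A) ^+ 2 * A + 2 * (- B / A) * B + C = (A * C - B ^+ 2) / A.
  by field.
by rewrite pmulr_lge0 ?invr_gt0// subr_ge0.
Qed.

Section forms.
Context {R : realType} {V : lmodType R}.
Implicit Types (X : set V) (a b : V -> V -> R).

Definition is_subspace X := X 0 /\ forall k u v, X u -> X v -> X (k *: u + v).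

(** Semidefinite because functions equal almost everywhere stay distinct, and linear only on [X]
    because integrals of sums split only for integrable terms. *)
Definition psd_form X a :=
  [/\ forall u v, X u -> X v -> a u v = a v u,
      forall k u v w, X u -> X v -> X w ->
        a (k *: u + v) w = k * a u w + a v w &
      forall u, X u -> 0 <= a u u].

Lemma subspaceD X u v : is_subspace X -> X u -> X v -> X (u + v).
Proof. by case=> _ h Xu Xv; rewrite -[u]scale1r; exact: h. Qed.

Lemma subspaceZ X k u : is_subspace X -> X u -> X (k *: u).
Proof. by case=> X0 h Xu; rewrite -[_ *: _]addr0; exact: h. Qed.

Lemma subspaceB X u v : is_subspace X -> X u -> X v -> X (u - v).
Proof.
by move=> sX Xu Xv; rewrite -scaleN1r addrC; apply: sX.2.
Qed.

Lemma subspace_sum X (I : Type) (s : seq I) (P : pred I) (f : I -> V) :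
  is_subspace X -> (forall i, P i -> X (f i)) -> X (\sum_(i <- s | P i) f i).
Proof.
move=> sX h; apply: (big_ind X) => //; first exact: sX.1.
by move=> u v; exact: subspaceD sX.
Qed.

Section one_form.
Variables (X : set V) (a : V -> V -> R).
Hypotheses (sX : is_subspace X) (fa : psd_form X a).

Let aC u v : X u -> X v -> a u v = a v u. Proof. by case: fa => + _ _; exact. Qed.

Lemma psdC u v : X u -> X v -> a u v = a v u.
Proof. exact: aC. Qed.

Lemma psd_ge0 u : X u -> 0 <= a u u. Proof. by case: fa => _ _; exact. Qed.

Lemma psdDl u v w : X u -> X v -> X w -> a (u + v) w = a u w + a v w.
Proof.
move=> Xu Xv Xw; case: fa => _ h _.
by rewrite -{1}[u]scale1r h// mul1r.
Qed.

Lemma psd0l w : X w -> a 0 w = 0.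
Proof.
move=> Xw; have := psdDl sX.1 sX.1 Xw; rewrite addr0 => /eqP.
by rewrite -{1}[a 0 w]addr0 (inj_eq (addrI _)) => /eqP <-.
Qed.

Lemma psdZl k u w : X u -> X w -> a (k *: u) w = k * a u w.
Proof.
move=> Xu Xw; case: fa => _ h _.
by rewrite -[k *: u]addr0 h// ?psd0l// ?addr0//; exact: sX.1.
Qed.

Lemma psdDr u v w : X u -> X v -> X w -> a w (u + v) = a w u + a w v.
Proof.
by move=> Xu Xv Xw; rewrite (aC Xw (subspaceD sX Xu Xv)) psdDl// (aC Xu)// (aC Xv).
Qed.

Lemma psdZr k u w : X u -> X w -> a w (k *: u) = k * a w u.
Proof. by move=> Xu Xw; rewrite (aC Xw (subspaceZ _ sX Xu)) psdZl// (aC Xu). Qed.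

Lemma psdBl u v w : X u -> X v -> X w -> a (u - v) w = a u w - a v w.
Proof.
move=> Xu Xv Xw.
by rewrite -scaleN1r psdDl ?psdZl ?mulN1r//; exact: (subspaceZ _ sX).
Qed.

Lemma psdBr u v w : X u -> X v -> X w -> a w (u - v) = a w u - a w v.
Proof. by move=> Xu Xv Xw; rewrite (aC Xw (subspaceB sX Xu Xv)) psdBl// (aC Xu)// (aC Xv). Qed.

Lemma psd_sqr k l u v : X u -> X v ->
  a (k *: u + l *: v) (k *: u + l *: v)
  = k ^+ 2 * a u u + 2 * k * l * a u v + l ^+ 2 * a v v.
Proof.
move=> Xu Xv; have Xk := subspaceZ k sX Xu; have Xl := subspaceZ l sX Xv.
rewrite psdDl ?psdDr//; last exact: (subspaceD sX).
by rewrite !psdZl// !psdZr// (aC Xv Xu); ring.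
Qed.

Lemma psd_sqrB u v : X u -> X v ->
  a (u - v) (u - v) = a u u - 2 * a u v + a v v.
Proof.
move=> Xu Xv; rewrite -[u]scale1r -scaleN1r psd_sqr// !scale1r; ring.
Qed.

Lemma psdNN u : X u -> a (- u) (- u) = a u u.
Proof.
move=> Xu; rewrite -scaleN1r psdZl// ?psdZr//; last exact: (subspaceZ _ sX).
by rewrite mulrA mulrNN mulr1 mul1r.
Qed.

Lemma psd_cauchy_schwarz u v : X u -> X v ->
  a u v ^+ 2 <= a u u * a v v.
Proof.
move=> Xu Xv; apply: discriminant_le => [||k]; try exact: psd_ge0.
have := @psd_ge0 (k *: u + 1 *: v).
rewrite psd_sqr// expr1n mul1r mulr1; apply.
by apply: (subspaceD sX) => //; exact: (subspaceZ _ sX).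
Qed.

(** The right side minus the left is [a] evaluated at [e *: v - (u - v)], divided by [e]. The free
    [e] lets values [a u u] pass to limits without square roots. *)
Lemma psd_young e u v : 0 < e -> X u -> X v ->
  a u u <= (1 + e) * a v v + (1 + e^-1) * a (u - v) (u - v).
Proof.
move=> e0 Xu Xv; have Xd := subspaceB sX Xu Xv.
have := @psd_ge0 (e *: v + (-1) *: (u - v)).
rewrite psd_sqr// => /(_ _); move=> h.
have {}h := h (subspaceD sX (subspaceZ _ sX Xv) (subspaceZ _ sX Xd)).
have -> : a u u = a v v + 2 * a v (u - v) + a (u - v) (u - v).
  rewrite -{1 2}[u](subrK v) -[u - v + v]addrC.
  have := psd_sqr 1 1 Xv Xd; rewrite !scale1r => ->; ring.
rewrite -subr_ge0.
have -> : (1 + e) * a v v + (1 + e^-1) * a (u - v) (u - v) -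
   (a v v + 2 * a v (u - v) + a (u - v) (u - v)) =
   (e ^+ 2 * a v v + 2 * e * -1 * a v (u - v) + (-1) ^+ 2 * a (u - v) (u - v)) / e.
  by field; rewrite gt_eqF.
by rewrite divr_ge0// ltW.
Qed.

End one_form.

End forms.

Lemma psd_formB (R : realType) (V : lmodType R) (X : set V) (a b : V -> V -> R) (m : R) :
  psd_form X a -> psd_form X b ->
  (forall v, X v -> m * b v v <= a v v) ->
  psd_form X (fun u v => a u v - m * b u v).
Proof.
move=> [aC aL a0] [bC bL b0] h; split.
- by move=> u v Xu Xv; rewrite aC// bC.
- by move=> k u v w Xu Xv Xw; rewrite aL// bL//; ring.
- by move=> u Xu; rewrite subr_ge0; exact: h.
Qed.

Lemma subspace_psd (R : realType) (V : lmodType R) (X Y : set V) (a : V -> V -> R) :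
  X `<=` Y -> psd_form Y a -> psd_form X a.
Proof.
move=> XY [aC aL a0]; split.
- by move=> u v Xu Xv; apply: aC; exact: XY.
- by move=> k u v w Xu Xv Xw; apply: aL; exact: XY.
- by move=> u Xu; apply: a0; exact: XY.
Qed.

Lemma le0_of_le_eps (R : realFieldType) (x K : R) : 
  (forall e, 0 < e -> x <= K * e) -> x <= 0.
Proof.
move=> h; rewrite leNgt; apply/negP => x0.
have K0 : 0 < `|K| + 1 by rewrite ltr_pwDr.
have := h (x / (`|K| + 1) / 2); rewrite !divr_gt0// => /(_ isT).
have KK : K <= `|K| + 1 by rewrite (le_trans (ler_norm _))// lerDl.
have : K * (x / (`|K| + 1) / 2) <= (`|K| + 1) * (x / (`|K| + 1) / 2).
  by rewrite ler_wpM2r// !divr_ge0// ltW.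
have -> : (`|K| + 1) * (x / (`|K| + 1) / 2) = x / 2 by field; rewrite gt_eqF.
lra.
Qed.

(** Bolzano-Weierstrass in the form needed to make finitely many functionals converge along one
    minimising sequence. *)
Lemma bounded_rV_cluster (R : realType) (J : nat) (x : nat -> 'rV[R]_J) (M : R) :
  (forall n j, `|x n ord0 j| <= M) ->
  exists c : 'rV[R]_J, forall (e : R) N, 0 < e ->
    exists2 n, (N <= n)%N & forall j, `|x n ord0 j - c ord0 j| <= e.
Proof.
move=> xM; pose A := [set y : 'rV[R]_J | forall j, `|y ord0 j| <= M].
have cA : compact A.
  have -> : A = [set y : 'rV[R]_J | forall j, `[- M, M]%classic (y ord0 j)].
    apply/seteqP; split => y /= h j; have := h j.
      by rewrite in_itv/= -ler_norml.
    by rewrite in_itv/= -ler_norml.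
  by apply: (@rV_compact _ _ (fun=> `[- M, M]%classic)) => j; exact: segment_compact.
have FA : (x @ \oo) A by exists 0%N => // n _ /= j; exact: xM.
have [c [_ cc]] := cA _ _ FA.
exists c => e N e0.
have h1 : (x @ \oo) [set x n | n in [set n | (N <= n)%N]].
  by exists N => // n /= Nn; exists n.
have h2 : nbhs c (ball c e) by exact: nbhsx_ballx.
have [y [[n /= Nn <-] [_ bx]]] := cc _ _ h1 h2.
exists n => // j; have := bx ord0 j.
by rewrite /ball /= distrC => /ltW.
Qed.

(** The form [q = a - m b], with [m] the infimum, is semidefinite, and a minimising sequence is one
    along which [q] tends to 0. This yields the eigenvalue equation without differentiating a
    Rayleigh quotient. The completeness hypothesis is handed the limits of the functionals with a
    rate, so that a finite-dimensional space can build the limit vector from them. *)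
Lemma attained_min (R : realType) (V : lmodType R) (X : set V)
    (a b : V -> V -> R) (J : finType) (l : J -> V -> R) (eps C M : R) (v0 : V) :
  is_subspace X -> psd_form X a -> psd_form X b ->
  (forall j u v, X u -> X v -> l j (u - v) = l j u - l j v) ->
  0 <= eps -> 0 <= C ->
  (forall v, X v -> b v v <= eps * a v v + C * \sum_j l j v ^+ 2) ->
  (forall j v, X v -> b v v = 1 -> `|l j v| <= M) ->
  (forall w : nat -> V, (forall n, X (w n)) ->
    (exists c : J -> R, forall n j, `|l j (w n) - c j| <= n.+1%:R^-1) ->
    (forall e, 0 < e -> exists N, forall n m, (N <= n)%N -> (N <= m)%N ->
       a (w n - w m) (w n - w m) <= e /\ b (w n - w m) (w n - w m) <= e) ->
    exists2 w', X w' & forall e, 0 < e -> exists N, forall n, (N <= n)%N ->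
       a (w n - w') (w n - w') <= e /\ b (w n - w') (w n - w') <= e) ->
  X v0 -> b v0 v0 = 1 -> eps * a v0 v0 < 1 ->
  exists (w : V) (m : R), [/\ X w, b w w = 1,
    forall v, X v -> a w v = m * b w v,
    forall v, X v -> m * b v v <= a v v & m <= a v0 v0].
Proof.
move=> sX fa fb lB e0 C0 bal lM complete Xv0 bv0 av0.
pose S := [set a v v | v in [set v | X v /\ b v v = 1]].
have S0 : S !=set0 by exists (a v0 v0); exists v0.
have lbS : lbound S 0 by move=> _ [v [Xv _] <-]; exact: (psd_ge0 fa).
have hS : has_inf S by split => //; exists 0.
pose m := inf S.
have m0 : 0 <= m by exact: lb_le_inf.
have mv0 : m <= a v0 v0 by apply: ge_inf; [exists 0|exists v0].
(* Since [m <= a v0 v0], the assumption on [v0] gives [m eps < 1], which later allows [m b] to be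
   absorbed into [a]. *)
have me : 0 < 1 - m * eps.
  rewrite subr_gt0 (le_lt_trans _ av0)// mulrC ler_wpM2l//.
have mb v : X v -> m * b v v <= a v v.
  move=> Xv; have [bv|bv] := eqVneq (b v v) 0.
    by rewrite bv mulr0; exact: (psd_ge0 fa).
  have bp : 0 < b v v by rewrite lt_def bv (psd_ge0 fb).
  rewrite -ler_pdivlMr//; apply: ge_inf; first by exists 0.
  exists ((Num.sqrt (b v v))^-1 *: v).
    split; first exact: (subspaceZ _ sX).
    rewrite (psdZl sX fb) ?(psdZr sX fb)//; last exact: (subspaceZ _ sX).
    by rewrite mulrA -invfM -expr2 sqr_sqrtr ?ltW// mulVf.
  rewrite (psdZl sX fa) ?(psdZr sX fa)//; last exact: (subspaceZ _ sX).
  by rewrite mulrA -invfM -expr2 sqr_sqrtr ?ltW// mulrC.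
pose q u v := a u v - m * b u v.
have fq : psd_form X q by exact: psd_formB.
have ex_v n : exists v, [/\ X v, b v v = 1 & q v v <= n.+1%:R^-1].
  have n0 : 0 < n.+1%:R^-1 :> R by rewrite invr_gt0.
  have [_ [v [Xv bv] <-] h] := inf_adherent n0 hS.
  by exists v; split => //; rewrite /q bv mulr1 lerBlDl; exact: ltW.
have [v vP] := choice ex_v.
have [|c0 cP] := @bounded_rV_cluster R #|J| (fun n => \row_j l (enum_val j) (v n)) M.
  by move=> n j; rewrite mxE; have [? ? _] := vP n; exact: lM.
pose c j := c0 ord0 (enum_rank j).
(* The index is taken beyond [n], so the defect [q] and the distance of the functionals to [c] are
   both at most [1 / (n + 1)]. *)
have ex_w n : exists u, [/\ X u, b u u = 1, q u u <= n.+1%:R^-1 &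
    forall j, `|l j u - c j| <= n.+1%:R^-1].
  have [|k nk kP] := cP n.+1%:R^-1 n; first by rewrite invr_gt0.
  have [? ? vq] := vP k; exists (v k); split => //.
    by apply: (le_trans vq); rewrite lef_pV2 ?posrE// ler_nat.
  by move=> j; have := kP (enum_rank j); rewrite mxE enum_rankK.
have [w wP] := choice ex_w.
have Xw n : X (w n) by case: (wP n).
have Xd n k : X (w n - w k) by exact: (subspaceB sX).
pose r (n : nat) : R := n.+1%:R^-1.
have r_ge0 n : 0 <= r n by rewrite invr_ge0.
have r_le1 n : r n <= 1 by rewrite invf_le1// ler1n.
have lest n k : \sum_j l j (w n - w k) ^+ 2 <= #|J|%:R * (2 * (r n + r k)).
  apply: (@le_trans _ _ (\sum_(j : J) (2 * (r n + r k)))).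
    apply: ler_sum => j _; rewrite lB//.
    have [_ _ _ /(_ j) h1] := wP n; have [_ _ _ /(_ j) h2] := wP k.
    have h : `|l j (w n) - l j (w k)| <= r n + r k.
      have -> : l j (w n) - l j (w k) = (l j (w n) - c j) - (l j (w k) - c j) by ring.
      by rewrite (le_trans (ler_normB _ _))// lerD.
    (* The square of [r n + r k] is at most [2 (r n + r k)] because both rates are at most 1. *)
    rewrite -real_normK ?num_real// expr2; apply: ler_pM => //.
    by have := r_le1 n; have := r_le1 k; lra.
  by rewrite sumr_const -[leLHS]mulr_natl.
(* Write [a = q + m b] on a difference, insert the bounds on [q] and [b], and solve for [a]; the
   denominator is what remains of [a] after absorption. *)
pose K := (2 + m * C * #|J|%:R * 2) / (1 - m * eps).
have K0 : 0 <= K.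
  by rewrite divr_ge0 ?(ltW me)// addr_ge0// !mulr_ge0.
have aest n k : a (w n - w k) (w n - w k) <= K * (r n + r k).
  have qd : q (w n - w k) (w n - w k) <= 2 * (r n + r k).
    have [_ _ h1 _] := wP n; have [_ _ h2 _] := wP k.
    (* Young's inequality is used with [v = - w k], so that [u - v] is [w n]; it replaces the
       parallelogram identity. *)
    have XN : X (- w k) by rewrite -scaleN1r; exact: (subspaceZ _ sX).
    have := psd_young sX fq ltr01 (Xd n k) XN.
    rewrite opprK subrK (psdNN sX fq)// invr1 => h.
    move: h h1 h2; rewrite -/(r n) -/(r k); clearbody r; clearbody q; lra.
  rewrite /K mulrAC ler_pdivlMr//.
  have h := bal _ (Xd n k).
  have {}h : m * b (w n - w k) (w n - w k) <= m * (eps * a (w n - w k) (w n - w k) + C * (#|J|%:R * (2 * (r n + r k)))).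
    by rewrite ler_wpM2l// (le_trans h)// lerD2l ler_wpM2l.
  move: qd; rewrite /q; lra.
have best n k : b (w n - w k) (w n - w k) <= (eps * K + C * #|J|%:R * 2) * (r n + r k).
  apply: (le_trans (bal _ (Xd n k))).
  rewrite mulrDl; apply: lerD; first by rewrite -mulrA ler_wpM2l.
  by rewrite -!mulrA ler_wpM2l.
pose K' := K + (eps * K + C * #|J|%:R * 2) + 1.
have K1 : 0 <= eps * K + C * #|J|%:R * 2.
  by apply: addr_ge0; [exact: mulr_ge0|rewrite !mulr_ge0].
have K'0 : 0 < K' by rewrite /K'; lra.
have small e : 0 < e -> exists N, forall n, (N <= n)%N -> r n <= e.
  move=> ep; exists (Num.truncn e^-1) => n Nn.
  rewrite /r -[leRHS]invrK lef_pV2 ?posrE ?invr_gt0//.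
  apply: ltW; apply: (lt_le_trans (truncnS_gt _)).
  by rewrite ler_nat.
have [||w' Xw' w'P] := complete w Xw.
  by exists c => n j; case: (wP n).
  move=> e ep; have [|N NP] := small (e / 2 / K'); first by rewrite !divr_gt0.
  exists N => n k Nn Nk.
  have h : K' * (r n + r k) <= e.
    have h1 := NP _ Nn; have h2 := NP _ Nk.
    have : K' * (r n + r k) <= K' * (e / 2 / K' + e / 2 / K').
      by rewrite ler_pM2l// lerD.
    have -> // : K' * (e / 2 / K' + e / 2 / K') = e by field; rewrite gt_eqF.
  have rr : 0 <= r n + r k by rewrite addr_ge0.
  split.
    apply: (le_trans (aest n k)); apply: le_trans h.
    by rewrite ler_wpM2r// /K'; lra.
  apply: (le_trans (best n k)); apply: le_trans h.
  by rewrite ler_wpM2r// /K'; lra.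
have Xdw n : X (w n - w') by exact: (subspaceB sX).
have dC f n : psd_form X f -> f (w' - w n) (w' - w n) = f (w n - w') (w n - w').
  by move=> ff; rewrite -opprB (psdNN sX ff).
have bw' : b w' w' = 1.
  apply/eqP; rewrite eq_le; apply/andP; split.
    rewrite -subr_le0; apply: (@le0_of_le_eps _ _ 2) => e ep.
    have e1 : 0 < (1 + e^-1) by rewrite addr_gt0// invr_gt0.
    have [|N /(_ _ (leqnn N))[_ h]] := w'P (e / (1 + e^-1)).
      by rewrite divr_gt0.
    have := psd_young sX fb ep Xw' (Xw N).
    rewrite dC//; case: (wP N) => _ -> _ _.
    have : (1 + e^-1) * b (w N - w') (w N - w') <= (1 + e^-1) * (e / (1 + e^-1)).
      by rewrite ler_pM2l.
    have -> : (1 + e^-1) * (e / (1 + e^-1)) = e by rewrite mulrC divfK// gt_eqF.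
    lra.
  rewrite -subr_le0; apply: (@le0_of_le_eps _ _ (b w' w' + 1)) => e ep.
  have e1 : 0 < (1 + e^-1) by rewrite addr_gt0// invr_gt0.
  have [|N /(_ _ (leqnn N))[_ h]] := w'P (e / (1 + e^-1)).
    by rewrite divr_gt0.
  have := psd_young sX fb ep (Xw N) Xw'.
  case: (wP N) => _ -> _ _.
  have : (1 + e^-1) * b (w N - w') (w N - w') <= (1 + e^-1) * (e / (1 + e^-1)).
    by rewrite ler_pM2l.
  have -> : (1 + e^-1) * (e / (1 + e^-1)) = e by rewrite mulrC divfK// gt_eqF.
  lra.
have qw' : q w' w' = 0.
  apply/eqP; rewrite eq_le (psd_ge0 fq)// andbT.
  apply: (@le0_of_le_eps _ _ 4) => e ep.
  have [N1 N1P] := small _ ep; have [N2 N2P] := w'P _ ep.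
  pose N := maxn N1 N2.
  have {}N1P := N1P N (leq_maxl _ _).
  have {N2P} [aN _] := N2P N (leq_maxr _ _).
  have := psd_young sX fq ltr01 Xw' (Xw N); rewrite dC//.
  have : q (w N - w') (w N - w') <= a (w N - w') (w N - w').
    by rewrite /q gerBl mulr_ge0// (psd_ge0 fb).
  case: (wP N) => _ _ qN _; rewrite invr1; move: qN; rewrite -/(r N); lra.
(* By Cauchy-Schwarz for [q], a [q]-null vector is [q]-orthogonal to all of [X], which is the
   eigenvalue equation. *)
exists w', m; split => // v1 Xv1; apply/eqP; rewrite -subr_eq0 -sqrf_eq0.
rewrite eq_le sqr_ge0 andbT.
by have := psd_cauchy_schwarz sX fq Xw' Xv1; rewrite qw' mul0r.
Qed.

Section psd_limits.
Context {R : realType} {V : lmodType R} (X : set V) (a : V -> V -> R).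
Hypotheses (sX : is_subspace X) (fa : psd_form X a).

(** [a u f] equals [- a u (f' - f)], which Cauchy-Schwarz makes arbitrarily small. This closes
    orthogonal complements and carries identities from test functions to gradients. *)
Lemma psd_lim0 (u f : V) : X u -> X f ->
  (forall e, 0 < e -> exists f', [/\ X f', a u f' = 0 & a (f' - f) (f' - f) <= e]) ->
  a u f = 0.
Proof.
move=> Xu Xf h; apply/eqP; rewrite -sqrf_eq0 eq_le sqr_ge0 andbT.
apply: (@le0_of_le_eps _ _ (a u u)) => e /h[f' [Xf' uf' le]].
have -> : a u f ^+ 2 = a u (f' - f) ^+ 2.
  by rewrite (psdBr sX fa)// uf' sub0r sqrrN.
apply: le_trans (psd_cauchy_schwarz sX fa Xu (subspaceB sX Xf' Xf)) _.
by rewrite ler_wpM2l// (psd_ge0 fa).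
Qed.

Lemma psd_null (u f : V) : X u -> X f -> a u u = 0 -> a u f = 0.
Proof.
move=> Xu Xf u0; apply/eqP; rewrite -sqrf_eq0 eq_le sqr_ge0 andbT.
by have := psd_cauchy_schwarz sX fa Xu Xf; rewrite u0 mul0r.
Qed.

Lemma psd_sqrD_le (u v : V) : X u -> X v ->
  a (u + v) (u + v) <= 2 * a u u + 2 * a v v.
Proof.
move=> Xu Xv; have := psd_young sX fa ltr01 (subspaceD sX Xu Xv) Xv.
rewrite invr1 addrK; lra.
Qed.

Lemma psd_sqrB_le (u v : V) : X u -> X v ->
  a (u - v) (u - v) <= 2 * a u u + 2 * a v v.
Proof.
move=> Xu Xv; rewrite -(psdNN sX fa Xv); apply: psd_sqrD_le => //.
by rewrite -scaleN1r; exact: subspaceZ.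
Qed.

Lemma psd_sqrBC (u v : V) : X u -> X v -> a (u - v) (u - v) = a (v - u) (v - u).
Proof. by move=> Xu Xv; rewrite -opprB (psdNN sX fa)//; exact: subspaceB. Qed.

Lemma psd_sqrZ k (u : V) : X u -> a (k *: u) (k *: u) = k ^+ 2 * a u u.
Proof.
move=> Xu; rewrite (psdZl sX fa)// ?(psdZr sX fa)// ?mulrA -?expr2//.
exact: subspaceZ.
Qed.

End psd_limits.

(** * Minimisation in finite dimension *)

Section finite_dimension.
Context {R : realType} {V : lmodType R} (X : set V) (a b : V -> V -> R).
Hypotheses (sX : is_subspace X) (fa : psd_form X a) (fb : psd_form X b).

Lemma psd_suml (f : V -> V -> R) (ff : psd_form X f) (I : Type) (s : seq I)
    (F : I -> V) w : (forall i, X (F i)) -> X w ->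
  f (\sum_(i <- s) F i) w = \sum_(i <- s) f (F i) w.
Proof.
move=> XF Xw; elim: s => [|i s IH]; first by rewrite !big_nil (psd0l sX ff).
rewrite !big_cons (psdDl ff) ?IH//.
exact: subspace_sum.
Qed.

(** The crude factor comes from losing a factor 2 at each addition; any constant independent of the
    [F i] would do. *)
Lemma psd_sum_le (I : Type) (s : seq I) (F : I -> V) : (forall i, X (F i)) ->
  a (\sum_(i <- s) F i) (\sum_(i <- s) F i) <= 2 ^+ size s * \sum_(i <- s) a (F i) (F i).
Proof.
move=> XF; elim: s => [|i s IH]; first by rewrite !big_nil (psd0l sX fa) ?mulr0//; exact: sX.1.
have Xs : X (\sum_(j <- s) F j) by exact: subspace_sum.
rewrite !big_cons /=; apply: le_trans (psd_sqrD_le sX fa (XF i) Xs) _.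
rewrite exprS mulrDr; apply: lerD; last by rewrite -mulrA ler_wpM2l.
rewrite ler_wpM2r ?(psd_ge0 fa)//.
by rewrite ler_peMr// exprn_ege1// ler1n.
Qed.

Definition orthonormal_family n (e : 'I_n -> V) :=
  (forall i, X (e i)) /\ forall i j, b (e i) (e j) = (i == j)%:R.

Lemma orthonormal_coord n (e : 'I_n -> V) (c : 'I_n -> R) j : orthonormal_family e ->
  b (\sum_i c i *: e i) (e j) = c j.
Proof.
move=> [Xe eo]; rewrite (psd_suml fb)//; last by move=> i; exact: (subspaceZ _ sX).
rewrite (bigD1 j)//= (psdZl sX fb)// eo eqxx mulr1 big1 ?addr0// => i ij.
by rewrite (psdZl sX fb)// eo (negbTE ij) mulr0.
Qed.

Lemma orthonormal_sqr n (e : 'I_n -> V) (c : 'I_n -> R) : orthonormal_family e ->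
  b (\sum_i c i *: e i) (\sum_i c i *: e i) = \sum_i c i ^+ 2.
Proof.
move=> oe; have [Xe _] := oe.
have XZ i : X (c i *: e i) by exact: (subspaceZ _ sX).
have Xs : X (\sum_i c i *: e i) by exact: subspace_sum.
rewrite {1}(psd_suml fb)//; apply: eq_bigr => i _.
by rewrite (psdZl sX fb)// (psdC fb)// orthonormal_coord.
Qed.

Variables (J : finType) (l : J -> V -> R).
Hypothesis ll : forall j k u v, X u -> X v -> l j (k *: u + v) = k * l j u + l j v.
Hypothesis l0 : forall v, X v -> (forall j, l j v = 0) -> b v v = 0.
Hypothesis ba : forall v, X v -> b v v = 0 -> a v v = 0.

(** A combination of the [e i] killed by every [l j] is [b]-null, so its coefficients, whose squares
    sum to 0, vanish: the matrix of values [l j (e i)] has independent rows. This is where finite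
    dimension enters; [l] will be evaluation at the mesh vertices. *)
Lemma orthonormal_size n (e : 'I_n -> V) : orthonormal_family e -> (n <= #|J|)%N.
Proof.
move=> oe; have [Xe _] := oe.
pose A := \matrix_(i < n, j < #|J|) l (enum_val j) (e i).
have lsum j (c : 'I_n -> R) : l j (\sum_i c i *: e i) = \sum_i c i * l j (e i).
  have l00 : l j 0 = 0.
    have := ll j 1 sX.1 sX.1; rewrite scale1r addr0 mul1r => /eqP.
    by rewrite -{1}[l j 0]addr0 (inj_eq (addrI _)) => /eqP.
  suff h (s : seq 'I_n) : l j (\sum_(i <- s) c i *: e i) = \sum_(i <- s) c i * l j (e i).
    exact: h.
  elim: s => [|i s IH]; first by rewrite !big_nil.
  have Xs : X (\sum_(k <- s) c k *: e k).
    by apply: (subspace_sum _ sX) => k _; exact: (subspaceZ _ sX).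
  by rewrite !big_cons ll// IH.
have : row_free A.
  rewrite -kermx_eq0; apply/rowV0P => c /sub_kermxP cA.
  have u0 : b (\sum_i c ord0 i *: e i) (\sum_i c ord0 i *: e i) = 0.
    apply: l0 => [|j].
      by apply: (subspace_sum _ sX) => i _; exact: (subspaceZ _ sX).
    rewrite lsum; have /rowP/(_ (enum_rank j)) := cA; rewrite !mxE => cA0.
    by apply: etrans cA0; apply: eq_bigr => i _; rewrite mxE enum_rankK.
  move: u0; rewrite orthonormal_sqr// => /eqP; rewrite psumr_eq0; last first.
    by move=> i _; exact: sqr_ge0.
  move=> /allP h; apply/rowP => i; rewrite mxE.
  by have /implyP/(_ isT) := h i (mem_index_enum i); rewrite sqrf_eq0 => /eqP.
by rewrite /row_free => /eqP <-; exact: rank_leq_col.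
Qed.

(** Take a family of maximal size: a residual that is not [b]-null could be normalised and adjoined.
    The residual itself need not be 0. *)
Lemma orthonormal_basis : exists n (e : 'I_n -> V), orthonormal_family e /\
  forall v, X v -> b (v - \sum_i b v (e i) *: e i) (v - \sum_i b v (e i) *: e i) = 0.
Proof.
pose P n := `[< exists e : 'I_n -> V, orthonormal_family e >].
have P0 : exists n, P n.
  exists 0%N; apply/asboolP; exists (fun=> 0); split => [_|]; first exact: sX.1.
  by case.
have Pm n : P n -> (n <= #|J|)%N by move=> /asboolP[e /orthonormal_size].
case: (ex_maxnP P0 Pm) => n /asboolP[e oe] nmax; exists n, e; split => // v Xv.
have [Xe eo] := oe.
set r := v - _.
have Xs : X (\sum_i b v (e i) *: e i).
  by apply: (subspace_sum _ sX) => i _; exact: (subspaceZ _ sX).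
have Xr : X r by exact: (subspaceB sX).
have re i : b r (e i) = 0 by rewrite (psdBl sX fb)// orthonormal_coord// subrr.
apply/eqP/negPn/negP => r0; have rp : 0 < b r r by rewrite lt_def r0 (psd_ge0 fb).
suff : P n.+1 by move=> /nmax; rewrite ltnn.
pose en := (Num.sqrt (b r r))^-1 *: r.
have Xen : X en by exact: (subspaceZ _ sX).
have bn : b en en = 1.
  by rewrite (psd_sqrZ sX fb)// exprVn sqr_sqrtr ?mulVf// ltW.
have ben i : b en (e i) = 0 by rewrite (psdZl sX fb)// re mulr0.
apply/asboolP; exists (fun i => oapp e en (unlift ord0 i)); split.
  by move=> i; case: (unliftP ord0 i) => [j|] _ /=.
move=> i j; case: (unliftP ord0 i) => [i' ->|->]; case: (unliftP ord0 j) => [j' ->|->] /=.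
- by rewrite eo (inj_eq lift_inj).
- by rewrite (psdC fb)// ben.
- by rewrite ben.
- by rewrite bn.
Qed.

(** [attained_min] with [eps = 0] and [C = 1]: by Parseval the coordinates in the orthonormal family
    give [b] exactly, and their limits are the coordinates of the limit vector. *)
Lemma finite_dim_min v0 : X v0 -> b v0 v0 = 1 ->
  exists (w : V) (m : R), [/\ X w, b w w = 1,
    forall v, X v -> a w v = m * b w v,
    forall v, X v -> m * b v v <= a v v & m <= a v0 v0].
Proof.
move=> Xv0 bv0; have [n [e [oe rest]]] := orthonormal_basis.
have [Xe eo] := oe.
have XS (c : 'I_n -> R) : X (\sum_i c i *: e i).
  by apply: (subspace_sum _ sX) => i _; exact: (subspaceZ _ sX).
pose pr v := \sum_i b v (e i) *: e i.
have XP v : X (pr v) by exact: XS.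
have Xr v : X v -> X (v - pr v) by move=> Xv; exact: (subspaceB sX Xv (XP v)).
have bpr v : X v -> b v v = \sum_i b v (e i) ^+ 2.
  move=> Xv; rewrite -(orthonormal_sqr (fun i => b v (e i)) oe) -/(pr v).
  have h u : X u -> b (v - pr v) u = 0.
    by move=> Xu; exact: (psd_null sX fb (Xr _ Xv) Xu (rest _ Xv)).

  have := h _ Xv; rewrite (psdBl sX fb)// => /subr0_eq ->.
  have := h _ (XP v); rewrite (psdBl sX fb)// => /subr0_eq <-.
  exact: (psdC fb).
apply: (@attained_min R V X a b 'I_n (fun i v => b v (e i)) 0 1 1 v0) => //.
- by move=> j u v Xu Xv; rewrite (psdBl sX fb).
- by move=> v Xv; rewrite mul0r add0r mul1r -bpr.
- move=> j v Xv bv; rewrite -[leRHS]ger0_norm// -ler_sqr ?nnegrE//.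
  rewrite real_normK ?num_real// normr1 expr1n -bv bpr// (bigD1 j)//= lerDl.
  by apply: sumr_ge0 => i _; exact: sqr_ge0.
- move=> w Xw [c cP] _; pose w' := \sum_i c i *: e i.
  exists w' => [|eps eps0]; first exact: XS.
  pose K := 2 * (2 ^+ n * \sum_i a (e i) (e i)) + n%:R + 1.
  have Sa : 0 <= \sum_i a (e i) (e i) by apply: sumr_ge0 => i _; exact: (psd_ge0 fa).
  have K1 : 0 <= 2 * (2 ^+ n * \sum_i a (e i) (e i)) by rewrite !mulr_ge0// exprn_ge0.
  have K2 : 0 <= n%:R :> R by [].
  have K0 : 0 < K by rewrite /K; lra.
  exists (Num.truncn (K / eps)) => k kN.
  have kK : K * k.+1%:R^-1 <= eps.
    rewrite ler_pdivrMr// mulrC -ler_pdivrMr//.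
    by rewrite ltW// (lt_le_trans (truncnS_gt _))// ler_nat.
  pose t : R := k.+1%:R^-1; have t0 : 0 <= t by rewrite invr_ge0.
  have t1 : t <= 1 by rewrite invf_le1// ler1n.
  pose del i := b (w k) (e i) - c i.
  have delt i : del i ^+ 2 <= t.
    rewrite -real_normK ?num_real// expr2 -[leRHS]mulr1; apply: ler_pM => //.
      exact: cP.
    exact: le_trans (cP k i) _.
  (* The first summand is [b]-null, hence [a]-null by [ba]; the second has coefficients at most
     [1 / (k + 1)]. *)
  have E : w k - w' = (w k - pr (w k)) + \sum_i del i *: e i.
    have -> : \sum_i del i *: e i = pr (w k) - w'.
      by rewrite /pr /w' -sumrB; apply: eq_bigr => i _; rewrite scalerBl.
    by rewrite addrA subrK.
  have Xrk := Xr _ (Xw k); have rk := rest _ (Xw k).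
  have bE : b (w k - w') (w k - w') <= n%:R * t.
    have -> : b (w k - w') (w k - w') = \sum_i del i ^+ 2.
      rewrite bpr; last by apply: (subspaceB sX) => //; exact: XS.
      apply: eq_bigr => i _; rewrite (psdBl sX fb)//; last exact: XS.
      by rewrite orthonormal_coord.
    have -> : n%:R * t = \sum_(i < n) t by rewrite sumr_const card_ord -[RHS]mulr_natl.
    exact: ler_sum.
  have aE : a (w k - w') (w k - w') <= 2 * (2 ^+ n * \sum_i a (e i) (e i)) * t.
    rewrite E; apply: le_trans (psd_sqrD_le sX fa Xrk (XS del)) _.
    rewrite (ba Xrk rk) mulr0 add0r -[leRHS]mulrA ler_wpM2l//.
    apply: le_trans (psd_sum_le _ _) _ => [i|]; first exact: (subspaceZ _ sX).
    have -> : size (index_enum 'I_n) = n by rewrite -sum1_size sum1_card card_ord.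
    rewrite -[leRHS]mulrA ler_wpM2l ?exprn_ge0// mulr_suml; apply: ler_sum => i _.
    by rewrite (psd_sqrZ sX fa)// mulrC ler_wpM2l// (psd_ge0 fa).
  split.
    apply: le_trans aE _; apply: le_trans kK; rewrite ler_wpM2r// /K.
    by move: K2; lra.
  apply: le_trans bE _; apply: le_trans kK; rewrite ler_wpM2r// /K.
  by move: K1; lra.
- by rewrite mul0r.
Qed.

End finite_dimension.

(** * Square-integrable functions *)

(** The sequences [u k + g k] and [u k - g k] are monotone, since [g] decreases by exactly [M 2^-k];
    they enclose the limit and give the rate at the same time. *)
Lemma geometric_cvg (R : realType) (u : nat -> R) (M : R) : 0 <= M ->
  (forall k, `|u k.+1 - u k| <= M * 2^-1 ^+ k) ->
  exists l, u @ \oo --> l /\ forall k, `|l - u k| <= 2 * M * 2^-1 ^+ k.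
Proof.
move=> M0 uM; pose g k := 2 * M * 2^-1 ^+ k.
have gS k : g k.+1 = g k - M * 2^-1 ^+ k by rewrite /g exprS; field.
have g_ge0 k : 0 <= g k by rewrite /g !mulr_ge0// exprn_ge0// invr_ge0.
pose v k := u k + g k; pose w k := u k - g k.
have dv : nonincreasing_seq v.
  apply/nonincreasing_seqP => k; have := uM k; rewrite ler_norml => /andP[_].
  by rewrite /v gS; lra.
have iw : nondecreasing_seq w.
  apply/nondecreasing_seqP => k; have := uM k; rewrite ler_norml => /andP[+ _].
  by rewrite /w gS; lra.
have wv k : w k <= v k by rewrite /w /v; have := g_ge0 k; lra.
have lv : has_lbound (range v).
  exists (w 0%N) => _ [k _ <-]; exact: le_trans (iw _ _ (leq0n k)) (wv k).
have cv : cvgn v by exact: nonincreasing_is_cvgn.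
have g0 : g @ \oo --> 0.
  have -> : 0 = 2 * M * 0 :> R by rewrite mulr0.
  by apply: cvgMr; apply: cvg_expr; rewrite ger0_norm ?invr_ge0// invf_lt1// ltr1n.
have cu : u @ \oo --> limn v.
  have -> : u = v \- g by apply/funext => k; rewrite /= /v addrK.
  rewrite -[limn v]subr0; exact: cvgB.
have cw : w @ \oo --> limn v.
  rewrite -[limn v]subr0; exact: cvgB.
exists (limn v); split => // k.
have h1 : limn v <= v k by exact: nonincreasing_cvgn_ge.
have h2 : w k <= limn v.
  rewrite -(cvg_lim _ cw)//; apply: nondecreasing_cvgn_le => //.
  by apply/cvg_ex; exists (limn v).
by rewrite ler_norml -/(g k); move: h1 h2; rewrite /v /w; lra.
Qed.

Section square_integrable.
Context d (T : measurableType d) (R : realType) (mu : {measure set T -> \bar R}).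
Variable D : set T.
Hypothesis mD : measurable D.
Implicit Types f g h : T -> R.

Definition sqint f :=
  measurable_fun D f /\ mu.-integrable D (fun x => (f x ^+ 2)%:E).

Definition ip f g : R := \int[mu]_(x in D) (f x * g x).

Lemma sqint_le f g : measurable_fun D f -> mu.-integrable D (EFin \o g) ->
  (forall x, D x -> f x ^+ 2 <= g x) -> sqint f.
Proof.
move=> mf ig fg; split => //; apply: le_integrable ig => //.
  by apply/measurable_EFinP; exact: measurable_funX.
move=> x Dx; rewrite /= lee_fin ger0_norm ?sqr_ge0//.
by rewrite (le_trans (fg _ Dx))// ler_norm.
Qed.

Lemma integrable_lin (k l : R) f g :
  mu.-integrable D (EFin \o f) -> mu.-integrable D (EFin \o g) ->
  mu.-integrable D (EFin \o (fun x => k * f x + l * g x)).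
Proof.
move=> fi gi; have := integrableD mD (integrableZl mD k fi) (integrableZl mD l gi).
by apply: eq_integrable.
Qed.

Lemma integrable_big (I : Type) (s : seq I) (F : I -> T -> R) :
  (forall i, mu.-integrable D (EFin \o F i)) ->
  mu.-integrable D (EFin \o (fun x => \sum_(i <- s) F i x)).
Proof.
move=> iF; elim: s => [|i s IH].
  by under eq_fun do rewrite /= big_nil; exact: integrable0.
have := integrable_lin 1 1 (iF i) IH.
by apply: eq_integrable => // x _; rewrite /= big_cons !mul1r.
Qed.

Lemma Rintegral_big (I : Type) (s : seq I) (F : I -> T -> R) :
  (forall i, mu.-integrable D (EFin \o F i)) ->
  \int[mu]_(x in D) (\sum_(i <- s) F i x) = \sum_(i <- s) \int[mu]_(x in D) F i x.
Proof.
move=> iF; elim: s => [|i s IH].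
  rewrite big_nil; under eq_Rintegral => x _ do rewrite big_nil.
  by rewrite /Rintegral integral0.
rewrite big_cons -IH -RintegralD//; last exact: integrable_big.
by apply: eq_Rintegral => x _; rewrite big_cons.
Qed.

Lemma sqint_mul f g : sqint f -> sqint g -> mu.-integrable D (EFin \o (f \* g)).
Proof.
move=> [mf f2] [mg g2].
have := @integrable_lin 1 1 (fun x => f x ^+ 2) (fun x => g x ^+ 2) f2 g2.
apply: le_integrable => //.
  by apply/measurable_EFinP; exact: measurable_funM.
move=> x Dx /=; rewrite lee_fin !mul1r ler_normr; apply/orP; left.
have := sqr_ge0 (f x - g x); have := sqr_ge0 (f x + g x).
have := sqr_ge0 (f x); have := sqr_ge0 (g x).
rewrite ler_norml sqrrD sqrrB; lra.
Qed.

Lemma sqint0 : sqint (cst 0).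
Proof.
split; first exact: measurable_cst.
by under eq_fun do rewrite expr0n/=; exact: integrable0.
Qed.

Lemma sqint_lin k f g : sqint f -> sqint g -> sqint (fun x => k * f x + g x).
Proof.
move=> [mf f2] [mg g2].
apply: (@sqint_le _ (fun x => (2 * k ^+ 2) * f x ^+ 2 + 2 * g x ^+ 2)).
- by apply: measurable_funD => //; exact: measurable_funM.
- exact: (@integrable_lin _ _ (fun x => f x ^+ 2) (fun x => g x ^+ 2)).
- move=> x _; have := sqr_ge0 (k * f x - g x).
  rewrite sqrrB sqrrD !exprMn; lra.
Qed.

Lemma sqint_subspace : is_subspace (sqint : set (T -> R^o)).
Proof. by split; [exact: sqint0|move=> k f g; exact: sqint_lin]. Qed.

Lemma ip_psd : psd_form (sqint : set (T -> R^o)) ip.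
Proof.
split.
- by move=> f g _ _; apply: eq_Rintegral => x _; rewrite mulrC.
- move=> k f g h sf sg sh; rewrite /ip -RintegralZl//; last exact: sqint_mul.
  rewrite -RintegralD//; last exact: sqint_mul.
    by apply: eq_Rintegral => x _; rewrite mulrA -mulrDl.
  by have := @integrableZl _ _ _ _ _ mD k _ (sqint_mul sf sh).
- by move=> f _; apply: Rintegral_ge0 => x _; rewrite -expr2 sqr_ge0.
Qed.

Lemma integral_sqr f : sqint f ->
  (\int[mu]_(x in D) (f x ^+ 2)%:E)%E = (ip f f)%:E.
Proof.
move=> sf; rewrite /ip /Rintegral fineK.
  by apply: eq_integral => x _; rewrite expr2.
exact/integrable_fin_num/sqint_mul.
Qed.

Lemma sqint_fin_integral f : measurable_fun D f ->
  (\int[mu]_(x in D) (f x ^+ 2)%:E < +oo)%E -> sqint f.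
Proof.
move=> mf foo; split => //; apply/integrableP; split.
  by apply/measurable_EFinP; exact: measurable_funX.
under eq_integral => x _ do rewrite gee0_abs ?lee_fin ?sqr_ge0//.
exact: foo.
Qed.

Lemma sqint_bounded (f : T -> R) (M : R) : (mu D < +oo)%E ->
  measurable_fun D f -> (forall x, D x -> f x ^+ 2 <= M) -> sqint f.
Proof.
move=> Doo mf fM; apply: (@sqint_le _ (cst M)) => //.
apply: measurable_bounded_integrable => //; exists `|M|; split => // K MK x _ /=.
exact: ltW.
Qed.

(* Along a subsequence with [ip (u_(k+1) - u_k) <= 8^-(k+1)], the function
   [H = sum_k 4^k (u_(k+1) - u_k)^2] is integrable and dominates the speed of
   pointwise convergence wherever it is finite. *)
Lemma sqint_complete (f_ : nat -> T -> R) : (forall n, sqint (f_ n)) ->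
  (forall e, 0 < e -> exists N, forall n m, (N <= n)%N -> (N <= m)%N ->
    ip (f_ n \- f_ m) (f_ n \- f_ m) <= e) ->
  exists2 f, sqint f & forall e, 0 < e -> exists N, forall n, (N <= n)%N ->
    ip (f_ n \- f) (f_ n \- f) <= e.
Proof.
move=> sf cauchy.
(* The factor [4^-k] cancels the weight in [h k], and [2^-(k+1)] makes the integrals of the [h k]
   sum to at most 1. *)
have /choice[N NP] : forall k, exists N, forall n m, (N <= n)%N -> (N <= m)%N ->
    ip (f_ n \- f_ m) (f_ n \- f_ m) <= 4^-1 ^+ k / (2 ^ k.+1)%:R.
  by move=> k; apply: cauchy; rewrite divr_gt0// ?exprn_gt0 ?invr_gt0// ltr0n expn_gt0.
(* The partial sums make [n_] nondecreasing and at least [N k]; the summand [k] makes it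
   unbounded. *)
pose n_ k := (k + \sum_(i < k.+1) N i)%N.
have nN k : (N k <= n_ k)%N by rewrite /n_ big_ord_recr/= addnA leq_addl.
have nS k : (n_ k <= n_ k.+1)%N by rewrite /n_ [leqRHS]/= [in leqRHS]big_ord_recr/= leq_add// leq_addr.
pose u k := f_ (n_ k).
have su k : sqint (u k) by exact: sf.
have sB f g : sqint f -> sqint g -> sqint (f \- g).
  by move=> ? ?; exact: (subspaceB sqint_subspace).
have sd k : sqint (u k.+1 \- u k) by exact: sB.
have dle k : ip (u k.+1 \- u k) (u k.+1 \- u k) <= 4^-1 ^+ k / (2 ^ k.+1)%:R.
  by apply: NP => //; exact: leq_trans (nN k) (nS k).
pose h k x : \bar R := (4 ^+ k * (u k.+1 x - u k x) ^+ 2)%:E.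
have h0 k x : (0 <= h k x)%E by rewrite lee_fin mulr_ge0 ?sqr_ge0// exprn_ge0.
have mh k : measurable_fun D (h k).
  apply/measurable_EFinP; apply: measurable_funM => //; apply: measurable_funX.
  exact: (sd k).1.
pose H x : \bar R := (\sum_(k <oo) h k x)%E.
have H0 x : (0 <= H x)%E by apply: nneseries_ge0 => *; exact: h0.
have mH : measurable_fun D H.
  have := @ge0_emeasurable_sum _ T R D h xpredT (fun k x _ _ => h0 k x) (fun k _ => mh k).
  by apply: eq_measurable_fun => x _; apply: eq_eseriesl.
have ih k : (\int[mu]_(x in D) h k x = (4 ^+ k * ip (u k.+1 \- u k) (u k.+1 \- u k))%:E)%E.
  rewrite EFinM -integral_sqr// -ge0_integralZl_EFin//.
  - by move=> x _; rewrite lee_fin sqr_ge0.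
  - by apply/measurable_EFinP; apply: measurable_funX; exact: (sd k).1.
have iH : (\int[mu]_(x in D) H x <= 1)%E.
  rewrite integral_nneseries//.
  apply: le_trans (@epsilon_trick0 R 1 xpredT ler01).
  apply: lee_nneseries => [k _ _|k _]; first by apply: integral_ge0 => x _; exact: h0.
  rewrite ih lee_fin; apply: (@le_trans _ _ (4 ^+ k * (4^-1 ^+ k / (2 ^ k.+1)%:R))).
    by rewrite ler_wpM2l ?exprn_ge0.
  by rewrite mulrA -exprMn divff// expr1n.
have hH k x : (h k x <= H x)%E.
  have := @nneseries_lim_ge R (h ^~ x) xpredT 0 k.+1 (fun k _ _ => h0 k x).
  rewrite big_mkcond/= big_nat_recr//=; apply: le_trans.
  by rewrite leeDr// sume_ge0.
have mA : measurable (D `&` [set x | H x < +oo]%E).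
  by apply: emeasurable_fun_infty_o => //; apply: mH.
pose A := [set x | H x < +oo]%E.
have Hle x : A x -> exists l, (u ^~ x @ \oo --> l) /\
    forall k, (l - u k x) ^+ 2 <= 4 * 4^-1 ^+ k * fine (H x).
  rewrite /A /= => Hx.
  have Hf : H x \is a fin_num by rewrite ge0_fin_numE.
  pose M := Num.sqrt (fine (H x)).
  have M2 : M ^+ 2 = fine (H x) by rewrite sqr_sqrtr// fine_ge0.
  have E4 k : 4^-1 ^+ k = (2^-1 ^+ k) ^+ 2 :> R.
    by rewrite -exprM mulnC exprM; congr (_ ^+ _); rewrite expr2 -invfM -natrM.
  have [l [ul lP]] : exists l, (u ^~ x @ \oo --> l) /\ forall k, `|l - u k x| <= 2 * M * 2^-1 ^+ k.
    apply: geometric_cvg; first exact: sqrtr_ge0.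
    move=> k; rewrite -[leLHS]sqrtr_sqr -[M * _](@ger0_norm _ (M * 2^-1 ^+ k)); last first.
      by rewrite mulr_ge0 ?sqrtr_ge0// exprn_ge0// invr_ge0.
    have : (h k x <= (fine (H x))%:E)%E by rewrite fineK.
    rewrite lee_fin -M2 => hk; rewrite -[leRHS]sqrtr_sqr ler_sqrt ?sqr_ge0//.
    rewrite exprMn -E4.
    rewrite -ler_pdivrMr ?exprn_gt0 ?invr_gt0// exprVn invrK mulrC//.
  exists l; split => // k; rewrite -M2 E4.
  have -> : 4 * (2^-1 ^+ k) ^+ 2 * M ^+ 2 = (2 * M * 2^-1 ^+ k) ^+ 2 by ring.
  by rewrite -real_normK ?num_real// lerXn2r ?nnegrE// !mulr_ge0// ?sqrtr_ge0// exprn_ge0// invr_ge0.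
(* Replacing the sequence by 0 outside [A] makes it converge at every point, so the limit is
   measurable as a pointwise limit. *)
pose f x := lim ((fun k => (u k \_ A) x) @ \oo).
have fA x : A x -> u ^~ x @ \oo --> f x.
  move=> Ax; have [l [ul _]] := Hle _ Ax; rewrite /f.
  have -> : (fun k => (u k \_ A) x) = u ^~ x.
    by apply/funext => k; rewrite patchE mem_set.
  by rewrite (cvg_lim _ ul).
have cf x : (fun k => (u k \_ A) x) @ \oo --> f x.
  have [Ax|nAx] := pselect (A x).
    have -> : (fun k => (u k \_ A) x) = u ^~ x.
      by apply/funext => k; rewrite patchE mem_set.
    exact: fA.
  rewrite /f; have -> : (fun k => (u k \_ A) x) = cst 0.
    by apply/funext => k; rewrite patchE memNset.
  by rewrite lim_cst//; exact: cvg_cst.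
have mf : measurable_fun D f.
  apply: (@measurable_fun_cvg _ _ _ D (fun k => u k \_ A)) => [k|x _]; last exact: cf.
  have -> : u k \_ A = (fun x => u k x * \1_A x).
    apply/funext => x; rewrite patchE indicE; case: ifP => _; by rewrite ?mulr1 ?mulr0.
  apply: measurable_funM; first exact: (su k).1.
  have mI : measurable_fun D (\1_(D `&` A) : T -> R) by exact: measurable_indic.
  by apply: eq_measurable_fun mI => x xD; rewrite !indicE in_setI xD.
have c0 k : 0 <= 4 * 4^-1 ^+ k :> R.
  by apply: mulr_ge0 => //; apply: exprn_ge0; rewrite invr_ge0.
have key k : (\int[mu]_(x in D) ((u k x - f x) ^+ 2)%:E <= (4 * 4^-1 ^+ k)%:E)%E.
  apply: (@le_trans _ _ (\int[mu]_(x in D) ((4 * 4^-1 ^+ k)%:E * H x))%E).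
    apply: ge0_le_integral => //.
    - by move=> x _; rewrite lee_fin sqr_ge0.
    - apply/measurable_EFinP; apply: measurable_funX; apply: measurable_funB => //.
      exact: (su k).1.
    - exact: measurable_funeM.
    - move=> x Dx; have [Ax|nAx] := pselect (A x).
        have [l [ul lP]] := Hle _ Ax.
        have <- : l = f x by apply: (cvg_unique _ ul (fA _ Ax)).
        rewrite -[H x]fineK ?ge0_fin_numE// -EFinM lee_fin -sqrrN opprB.
        exact: lP.
      (* Outside [A] the majorant is infinite and the inequality is trivial, so no null set has to
         be discarded. *)
      have -> : H x = +oo%E by move: nAx; rewrite /A /= => /negP; rewrite -leNgt leye_eq => /eqP.
      by rewrite gt0_muley ?leey// lte_fin mulr_gt0// exprn_gt0// invr_gt0.
  rewrite ge0_integralZl_EFin//.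
  by rewrite -[leRHS]mule1; apply: lee_wpmul2l.
have muf k : measurable_fun D (u k \- f).
  by apply: measurable_funB => //; exact: (su k).1.
have suf k : sqint (u k \- f).
  apply: sqint_fin_integral => //.
  by apply: le_lt_trans (key k) _; rewrite ltry.
have sf' : sqint f.
  have -> : f = u 0%N \- (u 0%N \- f) by apply/funext => x /=; ring.
  exact: sB.
exists f => // e e0.
have {}key k : ip (u k \- f) (u k \- f) <= 4 * 4^-1 ^+ k.
  by rewrite -lee_fin -integral_sqr//; exact: key.
have [N1 N1P] := cauchy (e / 4) ltac:(by rewrite divr_gt0).
have [N2 N2P] : exists N2, forall k, (N2 <= k)%N -> 4 * 4^-1 ^+ k <= e / 4.
  have : (fun k => 4 * 4^-1 ^+ k) @ \oo --> (0 : R).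
    rewrite -[0](mulr0 4); apply: cvgMr; apply: cvg_expr.
    by rewrite ger0_norm ?invr_ge0// invf_lt1// ltr1n.
  move=> /cvgrPdist_le /(_ (e / 4)); rewrite divr_gt0// => /(_ isT) [N2 _ hN].
  exists N2 => k Nk; have := hN k Nk; rewrite /= sub0r normrN ger0_norm//.
pose k := maxn N1 N2.
have Nk1 : (N1 <= n_ k)%N by apply: leq_trans (leq_maxl _ _) (leq_addr _ _).
have Nk2 : (N2 <= k)%N by exact: leq_maxr.
exists N1 => n Nn.
have := psd_young sqint_subspace ip_psd ltr01 (sB _ _ (sf n) sf') (suf k).
rewrite invr1.
have -> : (f_ n \- f) - (u k \- f) = f_ n \- u k.
  apply/funext => x; rewrite -[LHS]/(f_ n x - f x - (u k x - f x)) -[RHS]/(f_ n x - u k x); ring.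
have := key k; have := N2P k Nk2; have := N1P n (n_ k) Nn Nk1; rewrite -/(u k) => h1 h2 h3.
move=> /le_trans; apply.
lra.
Qed.

End square_integrable.

(** * Measurability and Fubini on row vectors *)

Section rV_measurable.
Context {R : realType} {n : nat}.

Lemma measurable_rV_forall (P : 'I_n -> set R) : (forall j, measurable (P j)) ->
  measurable [set x : 'rV[R]_n | forall j, P j (x ord0 j)].
Proof.
move=> mP.
have -> : [set x : 'rV[R]_n | forall j, P j (x ord0 j)] =
    \bigcap_(j in [set: 'I_n]) (@rv_coord _ _ n j @^-1` P j).
  by apply/seteqP; split => x /= h j => [_|]; exact: h.
apply: fin_bigcap_measurable; first exact: finite_finset.
move=> j _; rewrite -[X in measurable X]setTI.
exact: measurable_rv_coord.
Qed.

(* Every open set is the union of the boxes with rational centre and radius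
   [1/(k+1)] that it contains. *)
Lemma open_measurable_rV (U : set 'rV[R]_n) : open U -> measurable U.
Proof.
move=> oU.
pose B (q : 'rV[rat]_n * nat) := [set x : 'rV[R]_n |
  forall j, ball (ratr (q.1 ord0 j) : R) q.2.+1%:R^-1 (x ord0 j)].
have mB q : measurable (B q).
  apply: (measurable_rV_forall (P := fun j => ball (ratr (q.1 ord0 j) : R) q.2.+1%:R^-1)) => j.
  exact: measurable_ball.
have -> : U = \bigcup_(q in [set q | B q `<=` U]) B q.
  apply/seteqP; split => [x Ux|x [q /= qU Bx]]; last exact: qU.
  have /nbhs_ballP[e /= e0 eU] : nbhs x U by exact: open_nbhs_nbhs.
  have [k ke] : exists k : nat, k.+1%:R^-1 < e / 2.
    exists (Num.truncn (e / 2)^-1); rewrite invf_plt ?posrE ?divr_gt0//.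
    exact: truncnS_gt.
  have /choice[c cP] j : exists c : rat, ball (ratr c : R) k.+1%:R^-1 (x ord0 j).
    have b0 : ball (x ord0 j) (k.+1%:R^-1 : R) !=set0.
      by exists (x ord0 j); apply: ballxx; rewrite invr_gt0.
    have [z [/= h [c _ cz]]] := dense_rat b0 (ball_open _ _).
    by exists c; rewrite cz; exact: ball_sym.
  exists (\row_j c j, k) => /=; last by move=> j /=; rewrite mxE.
  move=> y By; apply: eU; split => // i j; rewrite (ord1 i).
  have := By j; have := cP j; rewrite /= mxE => h1 h2.
  apply: (@le_ball _ _ _ (k.+1%:R^-1 + k.+1%:R^-1)).
    by rewrite [leRHS]splitr lerD// ltW.
  exact: ball_triangle (ball_sym h1) h2.
rewrite bigcup_mkcond; apply: countable_bigcupT_measurable => [|q].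
  exact: countableP.
by case: ifP.
Qed.

Lemma continuous_measurable_rV (f : 'rV[R]_n -> R) :
  continuous f -> measurable_fun setT f.
Proof.
move=> /continuousP cf; apply: (measurability _ (RGenOpens.measurableE R)).
move=> _ [_ [a [b ->] <-]]; rewrite setTI; apply: open_measurable_rV.
exact/cf/interval_open.
Qed.

Definition box (L : R) : set 'rV[R]_n := [set x | forall j, `|x ord0 j| <= L].

Lemma box_itv L : box L = [set x : 'rV[R]_n | forall j, `[- L, L]%classic (x ord0 j)].
Proof.
by apply/seteqP; split => y /= h j; have := h j; rewrite in_itv/= -ler_norml.
Qed.

Lemma measurable_box L : measurable (box L).
Proof. by rewrite box_itv; apply: (measurable_rV_forall (P := fun=> `[- L, L]%classic)). Qed.

Lemma compact_box L : compact (box L).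
Proof.
rewrite box_itv; apply: (@rV_compact _ _ (fun=> `[- L, L]%classic)) => j.
exact: segment_compact.
Qed.

Lemma bounded_sub_box (A : set 'rV[R]_n) : bounded_set A ->
  exists2 L, 0 < L & A `<=` box L.
Proof.
move=> [M [_ AM]]; exists (`|M| + 1); first by rewrite ltr_pwDr.
move=> x Ax j; have h : `|x| <= `|M| + 1.
  by apply: AM => //; rewrite (le_lt_trans (ler_norm M))// ltrDl.
apply: le_trans h; rewrite [leRHS]/Num.norm/= mx_normrE.
by rewrite (le_trans _ (le_bigmax _ _ (ord0, j))).
Qed.

Lemma continuous_bounded_box (f : 'rV[R]_n -> R) L : continuous f ->
  exists2 M, 0 <= M & forall x, box L x -> `|f x| <= M.
Proof.
move=> cf; have /compact_bounded[M [_ h]] : compact (f @` box L).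
  apply: continuous_compact; last exact: compact_box.
  exact: continuous_subspaceT.
exists (`|M| + 1); first by rewrite addr_ge0.
move=> x Bx; apply: h; last by exists x.
by rewrite (le_lt_trans (ler_norm M))// ltrDl.
Qed.

End rV_measurable.

Arguments box {R} n L.

Section bounded_fubini.
Context d1 d2 (X : measurableType d1) (Y : measurableType d2) (R : realType).
Variables (m1 : {sigma_finite_measure set X -> \bar R}).
Variables (m2 : {sigma_finite_measure set Y -> \bar R}).
Variables (A : set X) (B : set Y) (g : X * Y -> R) (M : R).
Hypotheses (mA : measurable A) (mB : measurable B).
Hypotheses (Aoo : (m1 A < +oo)%E) (Boo : (m2 B < +oo)%E).
Hypothesis mg : measurable_fun setT g.
Hypothesis gM : forall x y, A x -> B y -> `|g (x, y)| <= M.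

(** Extension by 0, which reduces Fubini on a rectangle to Fubini on the whole product;
    integrability comes from boundedness on a set of finite measure. *)
Let f := ((EFin \o g) \_ (A `*` B))%E.

Lemma integrable_bounded d (T : measurableType d) (mu : {measure set T -> \bar R})
    (D : set T) (h : T -> R) (K : R) : measurable D -> (mu D < +oo)%E ->
  measurable_fun D h -> (forall x, D x -> `|h x| <= K) ->
  mu.-integrable D (EFin \o h).
Proof.
move=> mD Doo mh hK; apply: measurable_bounded_integrable => //.
exists K; split; first exact: num_real.
by move=> K' KK' x Dx /=; rewrite (le_trans (hK _ Dx))// ltW.
Qed.

Lemma integrable_prod_bounded : (m1 \x m2)%E.-integrable (A `*` B) (EFin \o g).
Proof.
apply: (@integrable_bounded _ _ _ _ _ M).
- exact: measurableX.
- have h : (m1 \x m2)%E (A `*` B) = (m1 A * m2 B)%E by exact: product_measure1E.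
  by rewrite [X in (X < _)%E]h lte_mul_pinfty// ge0_fin_numE.
- exact: measurable_funTS.
- by move=> [x y] [/= Ax By]; exact: gM.
Qed.

Let fi : (m1 \x m2)%E.-integrable setT f.
Proof.
exact: (integrable_mkcond _ (measurableX mA mB)).1 integrable_prod_bounded.
Qed.

Lemma integrable_sectionl x : A x ->
  m2.-integrable B (EFin \o (fun y => g (x, y))).
Proof.
move=> Ax; apply: (@integrable_bounded _ _ _ _ _ M) => //.
- by apply: measurable_funTS; exact: measurableT_comp.
- by move=> y; exact: gM.
Qed.

Lemma integrable_sectionr y : B y ->
  m1.-integrable A (EFin \o (fun x => g (x, y))).
Proof.
move=> By; apply: (@integrable_bounded _ _ _ _ _ M) => //.
- by apply: measurable_funTS; exact: measurableT_comp.
- by move=> x Ax; exact: gM.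
Qed.

Let FE : fubini_F m2 f = ((EFin \o (fun x => (\int[m2]_(y in B) g (x, y))%R)) \_ A)%E.
Proof.
apply/funext => x; rewrite /fubini_F patchE; case: ifPn => xA.
  rewrite /= /Rintegral fineK; last first.
    by apply: integrable_fin_num => //; apply: integrable_sectionl; exact: set_mem.
  rewrite [RHS]integral_mkcond; apply: eq_integral => y _.
  by rewrite /f !patchE in_setX xA.
by rewrite integral0_eq// => y _; rewrite /f patchE in_setX (negbTE xA).
Qed.

Let GE : fubini_G m1 f = ((EFin \o (fun y => (\int[m1]_(x in A) g (x, y))%R)) \_ B)%E.
Proof.
apply/funext => y; rewrite /fubini_G patchE; case: ifPn => yB.
  rewrite /= /Rintegral fineK; last first.
    by apply: integrable_fin_num => //; apply: integrable_sectionr; exact: set_mem.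
  rewrite [RHS]integral_mkcond; apply: eq_integral => x _.
  by rewrite /f !patchE in_setX yB andbT.
by rewrite integral0_eq// => x _; rewrite /f patchE in_setX (negbTE yB) andbF.
Qed.

Lemma bounded_fubini_integrable :
  m1.-integrable A (EFin \o (fun x => \int[m2]_(y in B) g (x, y))).
Proof.
apply/(integrable_mkcond _ mA).2; rewrite -FE; exact: integrable_fubini_F.
Qed.

Lemma bounded_fubini1 :
  \int[(m1 \x m2)%E]_(z in A `*` B) g z =
  \int[m1]_(x in A) \int[m2]_(y in B) g (x, y).
Proof.
rewrite /Rintegral; congr fine; rewrite [LHS]integral_mkcond [RHS]integral_mkcond.
by rewrite -integral12_prod_meas1// FE.
Qed.

Lemma bounded_fubini_swap :
  \int[m1]_(x in A) \int[m2]_(y in B) g (x, y) =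
  \int[m2]_(y in B) \int[m1]_(x in A) g (x, y).
Proof.
rewrite /Rintegral; congr fine; rewrite [LHS]integral_mkcond [RHS]integral_mkcond.
have := integral12_prod_meas1 fi; rewrite -integral21_prod_meas1// FE GE.
by [].
Qed.

End bounded_fubini.

(** * Finite measure of cubes and integration along the first coordinate *)

Section leb_box.
Variable R : realType.

Lemma preimage_rv_cons_box n (L : R) :
  @rv_cons R n @^-1` box n.+1 L = `[- L, L]%classic `*` box n L.
Proof.
apply/seteqP; split => [[t y] h|[t y] [/= tL yL] j].
  split => /=.
    by have := h ord0; rewrite rv_consE0 /= in_itv/= -ler_norml.
  by move=> j; have := h (lift ord0 j); rewrite rv_consES.
case: (unliftP ord0 j) => [i ->|->].
  by rewrite rv_consES; exact: yL.
by rewrite rv_consE0 /= ler_norml; move: tL; rewrite in_itv.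
Qed.

Lemma leb_box_fin n (L : R) : (leb R n (box n L) < +oo)%E.
Proof.
elim: n => [|n IH]; first by rewrite /= diracE ltry.
rewrite /= /leb_step /pushforward preimage_rv_cons_box.
rewrite product_measure1E//; last exact: measurable_box.
rewrite lte_mul_pinfty//.
  by rewrite ge0_fin_numE//= lebesgue_measure_itv/=; case: ifP; rewrite ?ltry.
Qed.

Lemma Rintegral_leb_step n (L M : R) (g : 'rV[R]_n.+1 -> R) :
  measurable_fun setT g -> (forall x, box n.+1 L x -> `|g x| <= M) ->
  \int[leb R n.+1]_(x in box n.+1 L) g x =
  \int[lebesgue_measure]_(t in `[- L, L]) \int[leb R n]_(y in box n L) g (rv_cons (t, y)).
Proof.
move=> mg gM.
have mgc : measurable_fun setT (g \o @rv_cons R n).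
  by apply: measurableT_comp => //; exact: measurable_rv_cons.
have gcM t y : `[- L, L]%classic t -> box n L y -> `|(g \o @rv_cons R n) (t, y)| <= M.
  move=> tL yL; apply: gM.
  by have : (`[- L, L]%classic `*` box n L) (t, y) by []; rewrite -preimage_rv_cons_box.
pose I : set (measurableTypeR R) := `[- L, L]%classic.
have Loo : (@lebesgue_measure R I < +oo)%E.
  by rewrite lebesgue_measure_itv/=; case: ifP; rewrite ?ltry.
have mb := @measurable_box R n L.
have := @bounded_fubini1 _ _ _ _ R lebesgue_measure (leb R n) _ _ _ M
  (measurable_itv _) mb Loo (leb_box_fin n L) mgc gcM.
rewrite -preimage_rv_cons_box => <-.
rewrite /Rintegral; congr fine.
apply: integral_pushforward; first exact: measurable_rv_cons.
- exact/measurable_EFinP.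
- rewrite preimage_rv_cons_box.
  exact: (@integrable_prod_bounded _ _ _ _ R lebesgue_measure (leb R n) _ _ _ M
    (measurable_itv _) mb Loo (leb_box_fin n L) mgc gcM).
- exact: measurable_box.
Qed.

End leb_box.

(** * Test functions *)

Section smooth_functions.
Context {R : realType} {d : nat}.
Implicit Types (f g phi : 'rV[R]_d -> R).

Lemma smooth_differentiable f x : smooth f -> differentiable f x.
Proof. by move=> /(_ [::]); exact. Qed.

Lemma smooth_derivable f x v : smooth f -> derivable f x v.
Proof. by move=> sf; apply: diff_derivable; exact: smooth_differentiable. Qed.

Lemma smooth_continuous f : smooth f -> continuous f.
Proof. by move=> sf x; apply/differentiable_continuous/smooth_differentiable. Qed.

Lemma smooth_partial i f : smooth f -> smooth (partial i f).
Proof. by move=> sf s x; have := sf (rcons s i) x; rewrite foldr_rcons. Qed.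

Lemma partial_lin i k f g x : derivable f x (delta_mx ord0 i) ->
  derivable g x (delta_mx ord0 i) ->
  partial i (fun y => k * f y + g y) x = k * partial i f x + partial i g x.
Proof.
move=> df dg; rewrite /partial.
have dkf : derivable (k \*: f) x (delta_mx ord0 i) by exact: derivableZ.
have := deriveD dkf dg; rewrite deriveZ//.
Qed.

Lemma smooth_lin k f g : smooth f -> smooth g ->
  smooth (fun x => k * f x + g x).
Proof.
move=> sf sg s.
have -> : foldr partial (fun x => k * f x + g x) s =
    fun x => k * foldr partial f s x + foldr partial g s x.
  elim: s => //= i s ->; apply/funext => x.
  by rewrite partial_lin//; apply: diff_derivable; [exact: sf|exact: sg].
move=> x; apply: differentiableD; last exact: sg.
exact: (differentiableZ k (sf s x)).
Qed.

Lemma smooth0 : smooth (cst 0 : 'rV[R]_d -> R).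
Proof.
move=> s; have -> : foldr partial (cst 0 : 'rV[R]_d -> R) s = cst 0.
  elim: s => //= i s ->; apply/funext => x; rewrite /partial.
  exact: derive_cst.
by move=> x; exact: differentiable_cst.
Qed.

Lemma derive_coord (i j : 'I_d) (x : 'rV[R]_d) :
  'D_(delta_mx ord0 j) (fun y : 'rV[R]_d => y ord0 i) x = (i == j)%:R.
Proof.
rewrite /derive; apply: cvg_lim => //.
apply: (@cvg_near_cst _ _ _ _ _ _).
near=> h; rewrite /= !mxE eqxx /= addrK.
rewrite /GRing.scale/= mulrA mulVf ?mul1r//.
by near: h; exact: nbhs_dnbhs_neq.
Unshelve. all: by end_near. Qed.

Lemma partial_coordM i j f x : differentiable f x ->
  partial j (fun y => y ord0 i * f y) x =
  x ord0 i * partial j f x + (i == j)%:R * f x.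
Proof.
move=> df; rewrite /partial.
have dc : derivable (fun y : 'rV[R]_d => y ord0 i) x (delta_mx ord0 j).
  by apply: diff_derivable; exact: differentiable_coord.
have := deriveM dc (diff_derivable (v := delta_mx ord0 j) df).
rewrite derive_coord => ->; rewrite /GRing.scale/=; congr (_ + _).
by rewrite mulrC.
Qed.

Lemma smooth_coordM i f : smooth f -> smooth (fun x => x ord0 i * f x).
Proof.
move=> sf s.
(* Leibniz rule as an invariant: each further derivative falls on [f] or on the coordinate, and what
   falls on the coordinate goes into the smooth remainder [g]. *)
have [g sg ->] : exists2 g, smooth g & foldr partial (fun x => x ord0 i * f x) s =
    fun x => x ord0 i * foldr partial f s x + g x.
  elim: s => [|j s [g sg IH]] /=.
    by exists (cst 0); [exact: smooth0|apply/funext => x; rewrite addr0].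
  exists (fun x => (i == j)%:R * foldr partial f s x + partial j g x).
    apply: smooth_lin; last exact: smooth_partial.
    by move=> s' y; have := sf (s' ++ s) y; rewrite foldr_cat.
  apply/funext => x; rewrite IH.
  have dm : differentiable (fun y : 'rV[R]_d => y ord0 i * foldr partial f s y) x.
    by apply: differentiableM; [exact: differentiable_coord|exact: sf].
  have := @partial_lin j 1 _ g x (diff_derivable (v := delta_mx ord0 j) dm) (@smooth_derivable g x (delta_mx ord0 j) sg).
  under eq_fun do rewrite mul1r; rewrite mul1r => ->.
  by rewrite partial_coordM ?addrA//; exact: sf.
move=> x; apply: differentiableD; last exact: smooth_differentiable.
by apply: differentiableM; [exact: differentiable_coord|exact: sf].
Qed.

Lemma tsupport_sub f (A : set 'rV[R]_d) : closed A ->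
  (forall x, ~ A x -> f x = 0) -> tsupport f `<=` A.
Proof.
move=> cA fA; rewrite ((closure_id A).1 cA); apply: closureS => x /=.
by move=> fx; apply: contrapT => /fA /eqP; rewrite (negbTE fx).
Qed.

Lemma out_tsupport f x : ~ tsupport f x -> f x = 0.
Proof.
by move=> nx; apply: contrapT => /eqP fx; apply: nx; exact: subset_closure.
Qed.

Lemma tsupport_partial i f : tsupport (partial i f) `<=` tsupport f.
Proof.
apply: tsupport_sub; first exact: closed_closure.
move=> x nx; rewrite /partial.
have : \forall y \near x, f y = cst 0 y.
  have : nbhs x (~` tsupport f).
    by apply: open_nbhs_nbhs; split => //; exact/closed_openC/closed_closure.
  by apply: filterS => y; exact: out_tsupport.
move=> h; rewrite (@near_eq_derive _ _ _ f (cst 0) x _ h) ?derive_cst//.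
Qed.

Variable Omega : set 'rV[R]_d.

Lemma test_sub f phi : smooth f -> test_function Omega phi ->
  (forall x, phi x = 0 -> ~ tsupport phi x -> f x = 0) -> test_function Omega f.
Proof.
move=> sf [_ cphi sphi] h.
have fs : tsupport f `<=` tsupport phi.
  apply: tsupport_sub; first exact: closed_closure.
  by move=> x nx; apply: h => //; exact: out_tsupport.
split => //; last exact: subset_trans sphi.
exact: (subclosed_compact (@closed_closure _ _) cphi).
Qed.

Lemma test_partial i phi : test_function Omega phi ->
  test_function Omega (partial i phi).
Proof.
move=> tphi; apply: (test_sub _ tphi); first by apply: smooth_partial; case: tphi.
by move=> x _ nx; apply: out_tsupport => /tsupport_partial.
Qed.

Lemma test_coordM i phi : test_function Omega phi ->
  test_function Omega (fun x => x ord0 i * phi x).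
Proof.
move=> tphi; apply: (test_sub _ tphi); first by apply: smooth_coordM; case: tphi.
by move=> x -> _; rewrite mulr0.
Qed.

Lemma test_lin k phi psi : test_function Omega phi -> test_function Omega psi ->
  test_function Omega (fun x => k * phi x + psi x).
Proof.
move=> [s1 c1 o1] [s2 c2 o2].
have fs : tsupport (fun x => k * phi x + psi x) `<=` tsupport phi `|` tsupport psi.
  apply: tsupport_sub; first by apply: closedU; exact: closed_closure.
  move=> x /not_orP[n1 n2].
  by rewrite (out_tsupport n1) (out_tsupport n2) mulr0 addr0.
split.
- exact: smooth_lin.
- exact: (subclosed_compact (@closed_closure _ _) (compactU c1 c2)).
- by move=> x /fs[/o1|/o2].
Qed.

End smooth_functions.

(** * The space H10 *)

Section sobolev_space.
Context {R : realType} {d : nat} (Omega : set 'rV[R]_d).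
Hypotheses (oO : open Omega) (bO : bounded_set Omega).

Local Notation fT := ('rV[R]_d -> R^o).
Local Notation L2O := (L2 Omega : set fT).
Local Notation B := (form_b Omega).
Implicit Types (u v : fT) (g h : 'I_d -> fT).

Let mO : measurable Omega. Proof. exact: open_measurable_rV. Qed.

Lemma L2_subspace : is_subspace L2O.
Proof. exact: (sqint_subspace (leb R d) mO). Qed.

Lemma form_b_psd : psd_form L2O B.
Proof. exact: ip_psd. Qed.

Let sL := L2_subspace.
Let fB := form_b_psd.

Lemma L2_bounded u (M : R) : measurable_fun Omega u ->
  (forall x, Omega x -> `|u x| <= M) -> L2 Omega u.
Proof.
move=> mu uM; apply: (@sqint_bounded _ _ _ _ _ mO u (M ^+ 2)) => //.
  have [L _ OL] := bounded_sub_box bO.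
  apply: le_lt_trans (leb_box_fin d L); apply: le_measure; rewrite ?inE//.
  exact: measurable_box.
move=> x Ox; rewrite -real_normK ?num_real// lerXn2r ?nnegrE ?uM//.
exact: le_trans (uM _ Ox).
Qed.

Lemma L2_continuous u : continuous u -> L2 Omega u.
Proof.
move=> cu; have [L _ OL] := bounded_sub_box bO.
have [M _ uM] := continuous_bounded_box L cu.
apply: (@L2_bounded _ M); last by move=> x /OL; exact: uM.
apply: measurable_funTS; exact: (@continuous_measurable_rV R d u cu).
Qed.

Lemma test_L2 (phi : fT) : test_function Omega phi -> L2 Omega phi.
Proof. by case=> sphi _ _; exact/L2_continuous/smooth_continuous. Qed.

Lemma L2_dist2E u v : L2_dist2 Omega u v = B (u - v) (u - v).
Proof. by apply: eq_Rintegral => x _; rewrite expr2. Qed.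

(** The sequence in [H10_gradient] traded for a single approximant per tolerance, so that linear
    combinations and limits require no handling of sequences. *)
Definition approximable u g := forall e : R, 0 < e -> exists phi : fT,
  [/\ test_function Omega phi, B (phi - u) (phi - u) <= e &
      forall i, B (partial i phi - g i : fT) (partial i phi - g i : fT) <= e].

Lemma H10_gradientP u g : H10_gradient Omega u g <->
  [/\ L2 Omega u, weak_gradient Omega u g & approximable u g].
Proof.
split=> [[uL wu [phi [tphi cphi dphi]]]|[uL wu ap]]; split => //.
  move=> e e0; have : \forall n \near \oo, L2_dist2 Omega (phi n) u <= e /\
      forall i, L2_dist2 Omega (partial i (phi n)) (g i) <= e.
    have hc (v : nat -> R) : v n @[n --> \oo] --> (0 : R) ->
        \forall n \near \oo, v n <= e.
      move=> /cvgrPdist_le /(_ _ e0); apply: filterS => n /=.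
      by rewrite sub0r normrN; exact: le_trans (ler_norm _).
    apply: filterI; first exact: hc.
    have hf : forall i, \forall n \near \oo,
      [set n | L2_dist2 Omega (partial i (phi n)) (g i) <= e] n by move=> i; exact: hc.
    exact: filter_forall hf.
  by case=> N _ /(_ N (leqnn N))[h1 h2]; exists (phi N); split.
have /choice[phi phiP] n : exists phi : fT, [/\ test_function Omega phi,
    B (phi - u) (phi - u) <= n.+1%:R^-1 &
    forall i, B (partial i phi - g i : fT) (partial i phi - g i : fT) <= n.+1%:R^-1].
  by apply: ap; rewrite invr_gt0.
have to0 (v : nat -> R) : (forall n, 0 <= v n <= n.+1%:R^-1) ->
    v n @[n --> \oo] --> (0 : R).
  move=> h; apply: (@squeeze_cvgr _ _ _ _ (cst 0) (fun n : nat => n.+1%:R^-1)).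
  - exact: nearW.
  - exact: cvg_cst.
  - exact: cvg_harmonic.
have [_ _ B0] := fB.
have tL n := test_L2 (let: And3 t _ _ := phiP n in t).
have pL n i := test_L2 (test_partial i (let: And3 t _ _ := phiP n in t)).
exists phi; split.
- by move=> n; case: (phiP n).
- apply: to0 => n; rewrite L2_dist2E; case: (phiP n) => _ -> _; rewrite andbT.
  exact/B0/(subspaceB sL).
- move=> i; apply: to0 => n; rewrite L2_dist2E; case: (phiP n) => _ _ ->; rewrite andbT.
  by apply/B0/(subspaceB sL) => //; case: (wu i).
Qed.

Lemma gradient_L2 u g i : H10_gradient Omega u g -> L2 Omega (g i).
Proof. by case=> _ /(_ i)[]. Qed.

Lemma gradient_weak u g i (phi : fT) : H10_gradient Omega u g ->
  test_function Omega phi -> B u (partial i phi) = - B (g i) phi.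
Proof. by case=> _ /(_ i)[_ h] _; exact: h. Qed.

(** [g i] is an L2 limit of functions [partial i phi], and these are themselves test functions. *)
Lemma gradient_test0 u g i (z : fT) : H10_gradient Omega u g -> L2 Omega z ->
  (forall phi, test_function Omega phi -> B z phi = 0) -> B z (g i) = 0.
Proof.
move=> Hu Lz z0; apply: (psd_lim0 sL fB) => //; first exact: gradient_L2 Hu.
move=> e e0; have [_ _ ap] := (H10_gradientP u g).1 Hu.
have [phi [tphi _ dphi]] := ap _ e0.
exists (partial i phi); split => //; first exact/test_L2/test_partial.
by apply: z0; exact: test_partial.
Qed.

(* The difference of two weak gradients is orthogonal to all test functions,
   hence to their L2 limits, among which are both gradients. *)
Lemma gradient_unique u v g h i : H10_gradient Omega u g ->
  H10_gradient Omega v h -> B (u - v) (u - v) = 0 ->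
  B (g i - h i) (g i - h i) = 0.
Proof.
move=> Hu Hv uv0.
have Lu : L2 Omega u by case: Hu.
have Lv : L2 Omega v by case: Hv.
have Lg := gradient_L2 i Hu; have Lh := gradient_L2 i Hv.
have Ld : L2O (g i - h i) by exact: (subspaceB sL).
have z0 (phi : fT) : test_function Omega phi -> B (g i - h i) phi = 0.
  move=> tphi; have Lp := test_L2 tphi.
  have Ldp := test_L2 (test_partial i tphi).
  rewrite (psdBl sL fB)//; apply/eqP; rewrite -oppr_eq0 opprB addrC.
  rewrite -(gradient_weak i Hu tphi) -[B (h i) phi]opprK -(gradient_weak i Hv tphi).
  rewrite -(psdBl sL fB)//; apply/eqP; apply: (psd_null sL fB) => //.
  exact: (subspaceB sL).
by rewrite (psdBr sL fB)// (gradient_test0 i Hu)// (gradient_test0 i Hv)// subr0.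
Qed.

Lemma gradient_lin k u v g h : H10_gradient Omega u g -> H10_gradient Omega v h ->
  H10_gradient Omega (k *: u + v) (fun i => k *: g i + h i).
Proof.
move=> Hu Hv; apply/H10_gradientP; split.
- by apply: sL.2; [case: Hu|case: Hv].
- move=> i; have Lg := gradient_L2 i Hu; have Lh := gradient_L2 i Hv.
  split; first exact: sL.2.
  move=> phi tphi; have Lp := test_L2 tphi.
  have Ldp := test_L2 (test_partial i tphi).
  have Lu : L2 Omega u by case: Hu.
  have Lv : L2 Omega v by case: Hv.
  have [_ lB _] := fB.
  have := lB k u v (partial i phi) Lu Lv Ldp; rewrite /form_b => ->.
  have := lB k (g i) (h i) phi Lg Lh Lp; rewrite /form_b => ->.
  rewrite -/(form_b Omega u (partial i phi)) -/(form_b Omega v (partial i phi)).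
  rewrite (gradient_weak i Hu tphi) (gradient_weak i Hv tphi).
  by rewrite mulrN -opprD.
- move=> e e0.
  (* The squared norm of [k p + q] is at most [2 k^2] times that of [p] plus twice that of [q];
     hence the denominator. *)
  have [Lu _ /(_ (e / (2 * k ^+ 2 + 2)))] := (H10_gradientP u g).1 Hu.
  have [Lv _ /(_ (e / (2 * k ^+ 2 + 2)))] := (H10_gradientP v h).1 Hv.
  have k2 : 0 < 2 * k ^+ 2 + 2 by rewrite ltr_wpDl// mulr_ge0// sqr_ge0.
  rewrite divr_gt0// => /(_ isT)[psi [tpsi bpsi dpsi]] /(_ isT)[phi [tphi bphi dphi]].
  have est (p q u' v' : fT) : L2 Omega p -> L2 Omega q -> L2 Omega u' -> L2 Omega v' ->
      B (p - u') (p - u') <= e / (2 * k ^+ 2 + 2) ->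
      B (q - v') (q - v') <= e / (2 * k ^+ 2 + 2) ->
      B (k *: p + q - (k *: u' + v')) (k *: p + q - (k *: u' + v')) <= e.
    move=> Lp Lq Lu' Lv' h1 h2.
    have -> : k *: p + q - (k *: u' + v') = k *: (p - u') + (q - v').
      by rewrite scalerBr opprD addrACA.
    have Lpu := subspaceB sL Lp Lu'; have Lqv := subspaceB sL Lq Lv'.
    apply: le_trans (psd_sqrD_le sL fB (subspaceZ k sL Lpu) Lqv) _.
    rewrite (psd_sqrZ sL fB)//.
    have -> : e = 2 * (k ^+ 2 * (e / (2 * k ^+ 2 + 2))) + 2 * (e / (2 * k ^+ 2 + 2)).
      by field; rewrite gt_eqF.
    by apply: lerD; rewrite ler_wpM2l// ler_wpM2l// sqr_ge0.
  exists (k *: phi + psi); split.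
  + exact: test_lin.
  + by apply: est => //; exact: test_L2.
  + move=> i.
    have -> : partial i (k *: phi + psi) = k *: (partial i phi : fT) + partial i psi.
      apply/funext => x; apply: partial_lin; apply: smooth_derivable.
        by case: tphi.
      by case: tpsi.
    apply: est => //; try by apply/test_L2/test_partial.
      exact: gradient_L2 Hu.
    exact: gradient_L2 Hv.
Qed.

Lemma test_gradient (phi : fT) : test_function Omega phi ->
   weak_gradient Omega phi (fun i => partial i phi) ->
   H10_gradient Omega phi (fun i => partial i phi).
Proof.
move=> tphi w; apply/H10_gradientP; split => //; first exact: test_L2.
move=> e e0; exists phi; split => // [|i]; rewrite subrr (psd0l sL fB) ?ltW//; exact: sL.1.
Qed.

Lemma gradient0 : H10_gradient Omega (0 : fT) (fun=> 0 : fT).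
Proof.
have -> : (fun=> 0 : fT) = (fun i => partial i (0 : fT)).
  by apply/funext => i; apply/funext => x; rewrite /partial derive_cst.
have t0 : test_function Omega (0 : fT).
  have s0 : tsupport (0 : fT) = set0.
    rewrite /tsupport (_ : [set _ | _] = set0) ?closure0//.
    by apply/seteqP; split => // x /=; rewrite eqxx.
  split; [exact: smooth0| |]; rewrite s0//; exact: compact0.
apply: test_gradient => // i; split; first exact/test_L2/test_partial.
move=> phi tphi; have Lp := test_L2 tphi.
have Ldp := test_L2 (test_partial i tphi).
have -> : partial i (0 : fT) = 0 by apply/funext => x; rewrite /partial derive_cst.
have := psd0l sL fB Lp; rewrite /form_b => ->.
have := psd0l sL fB Ldp; rewrite /form_b => ->.
by rewrite oppr0.
Qed.

Lemma H10_subspace : is_subspace (H10 Omega : set fT).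
Proof.
split; first by exists (fun=> 0 : fT); exact: gradient0.
move=> k u v [g Hu] [h Hv]; exists (fun i => k *: g i + h i : fT).
exact: gradient_lin.
Qed.

Lemma H10_L2 : H10 Omega `<=` L2 Omega.
Proof. by move=> u [g []]. Qed.

Lemma gradP u : H10 Omega u -> H10_gradient Omega u (grad Omega u).
Proof. by move=> [g Hg]; exact: (@getPex _ [set g | H10_gradient Omega u g] (ex_intro _ g Hg)). Qed.

(** [grad] is a mere choice among weak gradients. Two of them differ by a [B]-null function, which
    by Cauchy-Schwarz does not affect [B], so any gradient may be used to compute the energy
    form. *)
Lemma form_aE u v g h : H10_gradient Omega u g -> H10_gradient Omega v h ->
  form_a Omega u v = \sum_i B (g i) (h i).
Proof.
move=> Hu Hv.
have Hgu := gradP (ex_intro _ g Hu); have Hgv := gradP (ex_intro _ h Hv).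
transitivity (\sum_i B (grad Omega u i) (grad Omega v i)).
  rewrite /form_a; apply: (@Rintegral_big _ _ R (leb R d) Omega mO _ _
    (fun i x => grad Omega u i x * grad Omega v i x)) => i.
  by apply: (sqint_mul mO); [exact: gradient_L2 Hgu|exact: gradient_L2 Hgv].
apply: eq_bigr => i _.
have Lg := gradient_L2 i Hu; have Lh := gradient_L2 i Hv.
have Lgu := gradient_L2 i Hgu; have Lgv := gradient_L2 i Hgv.
have null w g' (H1 : H10_gradient Omega w (grad Omega w)) (H2 : H10_gradient Omega w g') :
    B (grad Omega w i - g' i : fT) (grad Omega w i - g' i : fT) = 0.
  apply: (gradient_unique i H1 H2); rewrite subrr; apply: (psd0l sL fB); exact: sL.1.
have e1 : B (grad Omega u i) (grad Omega v i) = B (g i) (grad Omega v i).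
  apply/eqP; rewrite -subr_eq0 -(psdBl sL fB)//; apply/eqP.
  by apply: (psd_null sL fB) => //; [exact: (subspaceB sL)|exact: null].
have e2 : B (g i) (grad Omega v i) = B (g i) (h i).
  apply/eqP; rewrite -subr_eq0 -(psdBr sL fB)//; apply/eqP.
  rewrite (psdC fB)//; last exact: (subspaceB sL).
  by apply: (psd_null sL fB) => //; [exact: (subspaceB sL)|exact: null].
by rewrite e1.
Qed.

Lemma form_a_psd : psd_form (H10 Omega : set fT) (form_a Omega).
Proof.
split.
- move=> u v /gradP Hu /gradP Hv; rewrite (form_aE Hu Hv) (form_aE Hv Hu).
  apply: eq_bigr => i _; apply: (psdC fB); [exact: gradient_L2 Hu|exact: gradient_L2 Hv].
- move=> k u v w /gradP Hu /gradP Hv /gradP Hw.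
  rewrite (form_aE (gradient_lin k Hu Hv) Hw) (form_aE Hu Hw) (form_aE Hv Hw).
  rewrite mulr_sumr -big_split/=; apply: eq_bigr => i _.
  have [_ lB _] := fB.
  by apply: lB; [exact: gradient_L2 Hu|exact: gradient_L2 Hv|exact: gradient_L2 Hw].
- move=> u /gradP Hu; rewrite (form_aE Hu Hu); apply: sumr_ge0 => i _.
  by apply: (psd_ge0 fB); exact: gradient_L2 Hu.
Qed.

Lemma gradientB u v g h : H10_gradient Omega u g -> H10_gradient Omega v h ->
  H10_gradient Omega (u - v) (fun i => g i - h i).
Proof.
move=> Hu Hv; have := gradient_lin (-1) Hv Hu.
have -> : -1 *: v + u = u - v by rewrite scaleN1r addrC.
by congr (H10_gradient _ _); apply/funext => i; rewrite scaleN1r addrC.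
Qed.

Lemma form_a_sub u v g h : H10_gradient Omega u g -> H10_gradient Omega v h ->
  form_a Omega (u - v) (u - v) = \sum_i B (g i - h i) (g i - h i).
Proof. by move=> Hu Hv; rewrite (form_aE (gradientB Hu Hv) (gradientB Hu Hv)). Qed.

Lemma L2_complete (f_ : nat -> fT) : (forall n, L2 Omega (f_ n)) ->
  (forall e : R, 0 < e -> exists N, forall n m, (N <= n)%N -> (N <= m)%N ->
    B (f_ n - f_ m) (f_ n - f_ m) <= e) ->
  exists2 f : fT, L2 Omega f & forall e : R, 0 < e -> exists N, forall n, (N <= n)%N ->
    B (f_ n - f) (f_ n - f) <= e.
Proof. exact: (sqint_complete mO). Qed.

(** The functions and their gradients converge separately in L2. The weak identity passes to the
    limit by Cauchy-Schwarz, and a test function close to one late term is close to the limit. *)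
Lemma H10_complete (w : nat -> fT) : (forall n, H10 Omega (w n)) ->
  (forall e : R, 0 < e -> exists N, forall n m, (N <= n)%N -> (N <= m)%N ->
    form_a Omega (w n - w m) (w n - w m) <= e /\ B (w n - w m) (w n - w m) <= e) ->
  exists2 w', H10 Omega w' & forall e : R, 0 < e -> exists N, forall n, (N <= n)%N ->
    form_a Omega (w n - w') (w n - w') <= e /\ B (w n - w') (w n - w') <= e.
Proof.
move=> Hw cauchy; pose g n := grad Omega (w n).
have Hg n : H10_gradient Omega (w n) (g n) by exact: gradP.
have Lw n : L2 Omega (w n) by exact: H10_L2.
have Lg n i : L2 Omega (g n i) by exact: gradient_L2 (Hg n).
have [|w' Lw' w'P] := L2_complete Lw.
  by move=> e /cauchy[N NP]; exists N => n m nN mN; case: (NP n m nN mN).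
have /choice[g' g'P] : forall i, exists f : fT, L2 Omega f /\
    forall e : R, 0 < e -> exists N, forall n, (N <= n)%N ->
    B (g n i - f) (g n i - f) <= e.
  move=> i; have [|f Lf fP] := L2_complete (Lg ^~ i); last by exists f.
  move=> e /cauchy[N NP]; exists N => n m nN mN; case: (NP n m nN mN) => + _.
  rewrite (form_a_sub (Hg n) (Hg m)); apply: le_trans.
  rewrite (bigD1 i)//= lerDl; apply: sumr_ge0 => j _.
  by apply: (psd_ge0 fB); exact: (subspaceB sL).
have Lg' i : L2 Omega (g' i) by case: (g'P i).
have close (e : R) : 0 < e -> exists N, forall n, (N <= n)%N ->
    B (w n - w') (w n - w') <= e /\ forall i, B (g n i - g' i) (g n i - g' i) <= e.
  move=> e0; have [N0 N0P] := w'P _ e0.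
  have /choice[N NP] : forall i, exists N, forall n, (N <= n)%N ->
      B (g n i - g' i) (g n i - g' i) <= e by move=> i; case: (g'P i) => _; exact.
  exists (maxn N0 (\max_i N i))%N => n; rewrite geq_max => /andP[n0 nN]; split.
    exact: N0P.
  by move=> i; apply: NP; apply: leq_trans nN; exact: (leq_bigmax i).
have Hw' : H10_gradient Omega w' g'.
  apply/H10_gradientP; split => //.
  - move=> i; split => // phi tphi.
    rewrite -/(form_b Omega w' (partial i phi)) -/(form_b Omega (g' i) phi).
    have Lp := test_L2 tphi; have Ldp := test_L2 (test_partial i tphi).
    apply/eqP; rewrite -subr_eq0 opprK -sqrf_eq0 eq_le sqr_ge0 andbT.
    apply: (@le0_of_le_eps _ _ (2 * (B (partial i phi) (partial i phi) + B phi phi))).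
    move=> e /close[N /(_ N (leqnn N))[h1 /(_ i) h2]].
    have -> : B w' (partial i phi) + B (g' i) phi =
        - (B (w N - w') (partial i phi) + B (g N i - g' i) phi).
      rewrite (psdBl sL fB)// (psdBl sL fB)// (gradient_weak i (Hg N))//.
      ring.
    rewrite sqrrN.
    have c1 := psd_cauchy_schwarz sL fB (subspaceB sL (Lw N) Lw') Ldp.
    have c2 := psd_cauchy_schwarz sL fB (subspaceB sL (Lg N i) (Lg' i)) Lp.
    have p1 : 0 <= B (partial i phi) (partial i phi) by exact: (psd_ge0 fB).
    have p2 : 0 <= B phi phi by exact: (psd_ge0 fB).
    have {}c1 := le_trans c1 (ler_wpM2r p1 h1).
    have {}c2 := le_trans c2 (ler_wpM2r p2 h2).
    have := sqr_ge0 (B (w N - w') (partial i phi) - B (g N i - g' i) phi).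
    move: c1 c2; set x : R := B _ _; set y : R := B _ _; set p : R := B _ _; set q : R := B _ _.
    rewrite sqrrB sqrrD; lra.
  - move=> e e0; have e4 : 0 < e / 4 by rewrite divr_gt0.
    have [N /(_ N (leqnn N))[h1 h2]] := close _ e4.
    have [_ _ ap] := (H10_gradientP _ _).1 (Hg N).
    have [phi [tphi bphi dphi]] := ap _ e4.
    have tri (p q r : fT) : L2 Omega p -> L2 Omega q -> L2 Omega r ->
        B (p - q) (p - q) <= e / 4 -> B (q - r) (q - r) <= e / 4 ->
        B (p - r) (p - r) <= e.
      move=> Lp Lq Lr k1 k2; have -> : p - r = (p - q) + (q - r) by rewrite addrA subrK.
      apply: le_trans (psd_sqrD_le sL fB (subspaceB sL Lp Lq) (subspaceB sL Lq Lr)) _.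
      move: k1 k2; lra.
    exists phi; split => //.
      by apply: (tri _ (w N)) => //; exact: test_L2.
    by move=> i; apply: (tri _ (g N i)) => //; exact/test_L2/test_partial.
exists w'; first by exists g'.
move=> e e0; have ed : 0 < e / d.+1%:R by rewrite divr_gt0.
have [N NP] := close _ ed; exists N => n /NP[h1 h2]; split.
  rewrite (form_a_sub (Hg n) Hw').
  apply: (@le_trans _ _ (\sum_(i < d) (e / d.+1%:R))); first exact: ler_sum.
  rewrite sumr_const card_ord -[leLHS]mulr_natl mulrCA; apply: (ler_piMr (ltW e0)).
  by rewrite ler_pdivrMr// mul1r ler_nat.
by apply: (le_trans h1); apply: (ler_piMr (ltW e0)); rewrite invf_le1// ler1n.
Qed.

Lemma H10_null u : H10 Omega u -> B u u = 0 -> form_a Omega u u = 0.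
Proof.
move=> /gradP Hu u0; rewrite (form_aE Hu Hu); apply: big1 => i _.
have := gradient_unique i Hu gradient0; rewrite !subr0; exact.
Qed.

(* With a vanishing gradient, testing against [x_i phi] gives
   [b(u, phi) = - b(u, x_i d_i phi)], and [d_i phi] tends to 0. *)
Lemma H10_gradient0 u (i : 'I_d) : H10 Omega u -> form_a Omega u u = 0 -> B u u = 0.
Proof.
move=> /gradP Hu a0; have Lu : L2 Omega u by case: Hu.
have Lg := gradient_L2 i Hu.
have g0 : B (grad Omega u i) (grad Omega u i) = 0.
  apply/eqP; rewrite eq_le (psd_ge0 fB)// andbT -a0 (form_aE Hu Hu) (bigD1 i)//= lerDl.
  by apply: sumr_ge0 => j _; apply: (psd_ge0 fB); exact: gradient_L2 Hu.
have [L L0 OL] := bounded_sub_box bO.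
apply/eqP; rewrite -sqrf_eq0 eq_le sqr_ge0 andbT.
apply: (@le0_of_le_eps _ _ (B u u * (2 + 4 * L ^+ 2))) => e e0.
have [_ _ ap] := (H10_gradientP _ _).1 Hu.
have [phi [tphi bphi /(_ i) dphi]] := ap _ e0.
have Lp := test_L2 tphi; have Ldp := test_L2 (test_partial i tphi).
pose psi : fT := fun x => x ord0 i * phi x.
have tpsi : test_function Omega psi by exact: test_coordM.
pose xdp : fT := fun x => x ord0 i * partial i phi x.
have Lx : L2 Omega xdp by apply/test_L2/test_coordM/test_partial.
have upsi : B u (partial i psi) = 0.
  by rewrite (gradient_weak i Hu tpsi) (psd_null sL fB)// ?oppr0//; exact: test_L2.
have psiE : partial i psi = xdp + phi.
  apply/funext => x; rewrite partial_coordM ?eqxx ?mul1r//.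
  by apply: smooth_differentiable; case: tphi.
(* [B u] vanishes on [partial i psi], which is [xdp + phi], so [B u u = B u z]. Both parts of [z]
   are small: [phi] is close to [u], and [xdp] is at most [L] times a nearly null derivative. *)
pose z : fT := (u - phi) - xdp.
have Lz : L2 Omega z by apply: (subspaceB sL) => //; exact: (subspaceB sL).
have uz : B u u = B u z.
  rewrite (psdBr sL fB)// ?(psdBr sL fB)//; last exact: (subspaceB sL).
  by move: upsi; rewrite psiE (psdDr sL fB)//; lra.
have xle : B xdp xdp <= L ^+ 2 * B (partial i phi) (partial i phi).
  rewrite /form_b -RintegralZl//; last exact: (sqint_mul mO Ldp Ldp).
  apply: le_Rintegral => //.
  - exact: (sqint_mul mO Lx Lx).
  - have := @integrableZl _ _ _ (leb R d) Omega mO (L ^+ 2) _ (sqint_mul mO Ldp Ldp).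
    by apply: eq_integrable.
  - move=> x Ox; have := OL _ Ox i; rewrite /xdp => xL.
    have : (x ord0 i) ^+ 2 <= L ^+ 2.
      by rewrite -[x ord0 i ^+ 2]real_normK ?num_real// lerXn2r ?nnegrE// ltW.
    move=> /(ler_wpM2r (sqr_ge0 (partial i phi x))); rewrite !expr2; lra.
have dle : B (partial i phi) (partial i phi) <= 2 * e.
  have := psd_sqrD_le sL fB (subspaceB sL Ldp Lg) Lg; rewrite subrK g0 mulr0 addr0 => h.
  by apply: (le_trans h); rewrite ler_wpM2l.
have zle : B z z <= (2 + 4 * L ^+ 2) * e.
  have h1 := psd_sqrB_le sL fB (subspaceB sL Lu Lp) Lx.
  rewrite (psd_sqrBC sL fB Lu Lp) in h1.
  have h2 := ler_wpM2l (sqr_ge0 L) dle.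
  apply: (le_trans h1); rewrite [leRHS]mulrDl; apply: lerD; first by rewrite ler_wpM2l.
  have -> : 4 * L ^+ 2 * e = 2 * (L ^+ 2 * (2 * e)) by ring.
  by rewrite ler_wpM2l// (le_trans xle).
rewrite {1}uz; apply: le_trans (psd_cauchy_schwarz sL fB Lu Lz) _.
by rewrite -mulrA ler_wpM2l// (psd_ge0 fB).
Qed.

End sobolev_space.

(** * Poincare inequalities *)

Section interval_poincare.
Variable R : realType.
Local Notation mu := (@lebesgue_measure R).
Local Notation ipI a b := (ip mu `[a, b]%classic).
Implicit Types (F G : measurableTypeR R -> R^o) (a b : R).

(** A primitive in the integral sense: for integrals over slices this follows from exchanging two
    integrals, with no differentiation under the integral sign. *)
Definition primitive_on a b F G := forall s t, a <= s -> s <= t -> t <= b ->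
  F t - F s = \int[mu]_(r in `[s, t]) G r.

Lemma itv_lty a b : (mu `[a, b]%classic < +oo)%E.
Proof. by rewrite lebesgue_measure_itv/=; case: ifP; rewrite ?ltry. Qed.

Lemma fine_itv a b : a < b -> fine (mu `[a, b]%classic) = b - a.
Proof. by move=> ab; rewrite lebesgue_measure_itv/= lte_fin ab. Qed.

(** Cauchy-Schwarz bounds the squared oscillation of [F] by [h g], where [h = b - a] and [g] is the
    integral of [G^2]. Integrating [F t - F s] over [s] compares [h F t] with the integral of [F];
    the two terms then come from splitting a square, at the cost of a factor 2. *)
Lemma interval_poincare a b F G : a < b ->
  sqint mu `[a, b]%classic F -> sqint mu `[a, b]%classic G -> primitive_on a b F G ->
  ipI a b F F <= 2 * (b - a) ^+ 2 * ipI a b G G +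
                 2 / (b - a) * (\int[mu]_(t in `[a, b]) F t) ^+ 2.
Proof.
move=> ab sF sG FG; pose h := b - a; have h0 : 0 < h by rewrite subr_gt0.
have mI : measurable (`[a, b]%classic : set (measurableTypeR R)) by exact: measurable_itv.
have sX := sqint_subspace mu mI; have fX := ip_psd mu mI.
have sb (H : measurableTypeR R -> R^o) K : measurable_fun `[a, b]%classic H ->
    (forall x, `|H x| <= K) -> sqint mu `[a, b]%classic H.
  move=> mH HK; apply: (@sqint_bounded _ _ _ _ _ mI H (K ^+ 2)); [exact: itv_lty|by []|].
  move=> x _; rewrite -real_normK ?num_real// lerXn2r ?nnegrE//.
  exact: le_trans (HK x).
have sc (c : R) : sqint mu `[a, b]%classic (cst c : _ -> R^o).
  by apply: (@sb _ `|c|) => //; exact: measurable_cst.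
have ipcc (c c' : R) : ipI a b (cst c) (cst c') = c * c' * h.
  rewrite -[LHS]/(\int[mu]_(x in `[a, b]) (cst (c * c') x)) Rintegral_cst//.
  by congr (_ * _); exact: fine_itv.
have ipc (c : R) : ipI a b (cst c) (cst c) = c ^+ 2 * h by rewrite ipcc expr2.
pose g := ipI a b G G; have g0 : 0 <= g by exact: (psd_ge0 fX sG).
have oscle s t : a <= s -> s <= t -> t <= b -> (F t - F s) ^+ 2 <= h * g.
  move=> as_ st tb; rewrite (FG s t)//.
  pose S : measurableTypeR R -> R^o := \1_(`[s, t]%classic).
  have mS : measurable_fun `[a, b]%classic S by apply: measurable_indic.
  have S1 x : `|S x| <= 1.
    by rewrite /S indicE ger0_norm ?ler0n// lern1 leq_b1.
  have -> : \int[mu]_(r in `[s, t]) G r = ipI a b S G.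
    have -> : `[s, t]%classic = `[a, b]%classic `&` `[s, t]%classic.
      apply/seteqP; split => x; last by case.
      rewrite /= !in_itv/= => /andP[sx xt].
      by rewrite (le_trans as_ sx) (le_trans xt tb) sx xt.
    rewrite Rintegral_mkcondr; apply: eq_Rintegral => x xI.
    by rewrite patchE /S indicE; case: ifP; rewrite ?mul1r ?mul0r.
  have sS : sqint mu `[a, b]%classic S by exact: sb S1.
  apply: le_trans (psd_cauchy_schwarz sX fX sS sG) _.
  rewrite ler_wpM2r//.
  have -> : h = ipI a b (cst 1) (cst 1) by rewrite ipc expr1n mul1r.
  apply: le_Rintegral => //.
  - exact: (sqint_mul mI sS sS).
  - exact: (sqint_mul mI (sc 1) (sc 1)).
  - move=> x _; rewrite /S indicE mulr1; case: (x \in _); by rewrite ?mulr1 ?mulr0.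
have osc s t : a <= s <= b -> a <= t <= b -> (F t - F s) ^+ 2 <= h * g.
  move=> /andP[as_ sb_] /andP[at_ tb]; have [st|/ltW ts] := leP s t; first exact: oscle.
  by rewrite -sqrrN opprB; exact: oscle.
pose A := \int[mu]_(t in `[a, b]) F t.
have AE : A = ipI a b (cst 1) F by apply: eq_Rintegral => x _; rewrite mul1r.
have ptw t : a <= t <= b -> F t ^+ 2 <= 2 * h * g + 2 * A ^+ 2 / h ^+ 2.
  move=> tab; pose D : measurableTypeR R -> R^o := cst (F t) - F.
  have sD : sqint mu `[a, b]%classic D by exact: (subspaceB sX).
  have e1 : h * F t - A = ipI a b (cst 1) D.
    by rewrite (psdBr sX fX)// -AE ipcc mul1r mulrC.
  have e2 : ipI a b D D <= h * g * h.
    (* The bound is written as the inner product of a constant function with itself, so that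
       monotonicity of the integral applies. *)
    have -> : h * g * h = ipI a b (cst (Num.sqrt (h * g))) (cst (Num.sqrt (h * g))).
      by rewrite ipc sqr_sqrtr// mulr_ge0// ltW.
    apply: le_Rintegral => //.
    - exact: (sqint_mul mI sD sD).
    - exact: (sqint_mul mI (sc _) (sc _)).
    - move=> x; rewrite /= in_itv/= => xab.
      rewrite -!expr2 sqr_sqrtr ?mulr_ge0 ?(ltW h0)//.
      exact: osc.
  have e3 : (h * F t - A) ^+ 2 <= h * (h * g * h).
    rewrite e1; apply: le_trans (psd_cauchy_schwarz sX fX (sc 1) sD) _.
    by rewrite ipc expr1n mul1r ler_wpM2l// ltW.
  have hh : 0 < h ^+ 2 by rewrite exprn_gt0.
  rewrite -(ler_pM2l hh).
  have -> : h ^+ 2 * (2 * h * g + 2 * A ^+ 2 / h ^+ 2) = 2 * (h * (h * g * h)) + 2 * A ^+ 2.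
    by field; rewrite gt_eqF.
  rewrite -exprMn; have := sqr_ge0 (h * F t - A - A).
  move: e3; rewrite !sqrrB; move: (h * F t) (h * (h * g * h)) => x y.
  by rewrite !expr2; lra.
apply: (@le_trans _ _ (ipI a b (cst (Num.sqrt (2 * h * g + 2 * A ^+ 2 / h ^+ 2)))
    (cst (Num.sqrt (2 * h * g + 2 * A ^+ 2 / h ^+ 2))))).
  apply: le_Rintegral => //.
  - exact: (sqint_mul mI sF sF).
  - exact: (sqint_mul mI (sc _) (sc _)).
  - move=> x; rewrite /= in_itv/= => xab; rewrite -!expr2 sqr_sqrtr.
      exact: ptw.
    by apply: le_trans (ptw _ xab); exact: sqr_ge0.
rewrite ipc sqr_sqrtr; last first.
  apply: le_trans (ptw a _); first exact: sqr_ge0.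
  by rewrite lexx ltW.
rewrite -/h -/A -/g le_eqVlt; apply/orP; left; apply/eqP.
by field; rewrite gt_eqF.
Qed.

Lemma Rintegral_grid (a h : R) (N : nat) (f : R -> R) : 0 <= h ->
  mu.-integrable `[a, a + N%:R * h]%classic (EFin \o f) ->
  \int[mu]_(t in `[a, a + N%:R * h]) f t =
  \sum_(k < N) \int[mu]_(t in `[a + k%:R * h, a + k.+1%:R * h]) f t.
Proof.
move=> h0; elim: N => [|N IH] fi.
  by rewrite big_ord0 mul0r addr0 set_itv1 Rintegral_set1.
have le1 : a + N%:R * h <= a + N.+1%:R * h by rewrite lerD2l ler_wpM2r// ler_nat.
have le0 : a <= a + N%:R * h by rewrite lerDl mulr_ge0.
have fi' : mu.-integrable `[a, a + N%:R * h]%classic (EFin \o f).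
  apply: integrableS fi => //; apply: subset_itvl; by rewrite bnd_simp.
have fi2 : mu.-integrable `[a + N%:R * h, a + N.+1%:R * h]%classic (EFin \o f).
  apply: integrableS fi => //; apply: subset_itvr; by rewrite bnd_simp.
have fi3 : mu.-integrable `]a + N%:R * h, a + N.+1%:R * h]%classic (EFin \o f).
  apply: integrableS fi2 => //; apply: subset_itvr; by rewrite bnd_simp.
rewrite big_ord_recr/= -IH// -(Rintegral_itv_obnd_cbnd fi3).
rewrite -(Rintegral_itvB (x := a + N%:R * h) fi); rewrite ?bnd_simp//.
by rewrite addrC subrK.
Qed.

(** The interval inequality summed over the cells: refining the grid makes the factor of the
    derivative small. Cell integrals carry an indicator so that they are functionals on the whole
    interval. *)
Lemma grid_poincare (a h : R) (N : nat) F G : 0 < h ->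
  let b := a + N%:R * h in
  sqint mu `[a, b]%classic F -> sqint mu `[a, b]%classic G -> primitive_on a b F G ->
  ipI a b F F <= 2 * h ^+ 2 * ipI a b G G + 2 / h *
    \sum_(k < N) (\int[mu]_(t in `[a, b])
       (\1_(`[a + k%:R * h, a + k.+1%:R * h]%classic) t * F t)) ^+ 2.
Proof.
move=> h0 b sF sG FG.
have mI c c' : measurable (`[c, c']%classic : set (measurableTypeR R)) by exact: measurable_itv.
rewrite /ip (Rintegral_grid (ltW h0)); last exact: (sqint_mul (mI _ _) sF sF).
rewrite (Rintegral_grid (ltW h0)); last exact: (sqint_mul (mI _ _) sG sG).
rewrite !mulr_sumr -big_split/=; apply: ler_sum => k _.
pose c := a + k%:R * h; pose c' := a + k.+1%:R * h; rewrite -/c -/c'.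
have cc' : c' - c = h by rewrite /c /c' -natr1; ring.
have ac : a <= c by rewrite lerDl mulr_ge0// ltW.
have cb : c' <= b by rewrite lerD2l ler_wpM2r ?(ltW h0)// ler_nat ltn_ord.
have sub : `[c, c']%classic `<=` `[a, b]%classic.
  by apply: subset_itv; rewrite bnd_simp.
have sS (H : measurableTypeR R -> R) : sqint mu `[a, b]%classic H -> sqint mu `[c, c']%classic H.
  case=> mH iH; split; first exact: measurable_funS mH.
  exact: integrableS iH.
have cltc : c < c' by rewrite -subr_gt0 cc'.
have := interval_poincare cltc (sS _ sF) (sS _ sG).
rewrite cc' => /(_ _)/le_trans; apply.
  move=> s t cs st tc'; apply: FG => //; first exact: le_trans cs.
  exact: le_trans cb.
rewrite lerD2l le_eqVlt; apply/orP; left; apply/eqP; congr (_ * _ ^+ 2).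
have -> : `[c, c']%classic = `[a, b]%classic `&` `[c, c']%classic.
  by apply/seteqP; split => [x Ix|x []//]; split => //; exact: sub.
rewrite Rintegral_mkcondr; apply: eq_Rintegral => x xI.
rewrite patchE indicE; have -> : (x \in `[a, b]%classic `&` `[c, c']%classic) = (x \in `[c, c']%classic).
  by rewrite in_setI xI.
by case: ifP; rewrite ?mul1r ?mul0r.
Qed.

End interval_poincare.

(** * The compactness inequality on a cube, by slicing *)

Section box_poincare.
Variable R : realType.
Local Notation mu := (@lebesgue_measure R).

(** Tailored to the induction on the dimension: the class is stable under fixing the first
    coordinate, and the fundamental theorem of calculus applies along that coordinate. *)
Definition C1 n (f : 'rV[R]_n -> R) := continuous f /\
  forall i, (forall x, derivable f x (delta_mx ord0 i)) /\ continuous (partial i f).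

Definition slice n (f : 'rV[R]_n.+1 -> R) (t : R) (y : 'rV[R]_n) : R :=
  f (rv_cons (t, y)).

Lemma continuous_slice n (f : 'rV[R]_n.+1 -> R) t : continuous f -> continuous (slice f t).
Proof.
move=> cf y; rewrite /slice.
apply: (@continuous_comp _ _ _ (fun y => rv_cons (t, y)) f); last exact: cf.
move=> A /nbhs_ballP[e /= e0 eA]; apply/nbhs_ballP; exists e => //= z [_ yz].
apply: eA; split => // i j.
rewrite (ord1 i); case: (unliftP ord0 j) => [k ->|->].
  by rewrite !rv_consES.
by rewrite !rv_consE0; exact: ballxx.
Qed.

Lemma continuous_slice0 n (f : 'rV[R]_n.+1 -> R) y : continuous f ->
  continuous (fun t : R => slice f t y).
Proof.
move=> cf t; rewrite /slice.
apply: (@continuous_comp R _ _ (fun t => rv_cons (t, y)) f); last exact: cf.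
move=> A /nbhs_ballP[e /= e0 eA]; apply/nbhs_ballP; exists e => //= z yz.
apply: eA; split => // i j.
rewrite (ord1 i); case: (unliftP ord0 j) => [k ->|->].
  by rewrite !rv_consES; exact: ballxx.
by rewrite !rv_consE0.
Qed.

Lemma rv_cons_shift n (t h : R) (y : 'rV[R]_n) (i : 'I_n) :
  rv_cons (t, h *: delta_mx ord0 i + y) =
  h *: delta_mx ord0 (lift ord0 i) + rv_cons (t, y).
Proof.
apply/rowP => j; case: (unliftP ord0 j) => [k ->|->].
  by rewrite rv_consES /= !mxE liftK /= (inj_eq lift_inj).
rewrite rv_consE0 !mxE unlift_none /=.
by rewrite mulr0 add0r.
Qed.

Lemma rv_cons_shift0 n (t h : R) (y : 'rV[R]_n) :
  rv_cons (h + t, y) = h *: delta_mx ord0 ord0 + rv_cons (t, y).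
Proof.
apply/rowP => j; case: (unliftP ord0 j) => [k ->|->].
  by rewrite rv_consES /= !mxE liftK /= mulr0 add0r.
by rewrite rv_consE0 !mxE unlift_none /= mulr1.
Qed.

Lemma slice_quotient n (f : 'rV[R]_n.+1 -> R) t y i :
  (fun h : R => h^-1 *: ((slice f t \o shift y) (h *: delta_mx ord0 i) - slice f t y)) =
  (fun h : R => h^-1 *: ((f \o shift (rv_cons (t, y))) (h *: delta_mx ord0 (lift ord0 i))
     - f (rv_cons (t, y)))).
Proof. by apply/funext => h; rewrite /slice /= rv_cons_shift. Qed.

Lemma partial_slice n (f : 'rV[R]_n.+1 -> R) t i :
  partial i (slice f t) = slice (partial (lift ord0 i) f) t.
Proof.
by apply/funext => y; rewrite /slice /partial /derive -slice_quotient.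
Qed.

Lemma C1_slice n (f : 'rV[R]_n.+1 -> R) t : C1 f -> C1 (slice f t).
Proof.
move=> [cf df]; split; first exact: continuous_slice.
move=> i; split; last first.
  by rewrite partial_slice; apply: continuous_slice; case: (df (lift ord0 i)).
move=> y; rewrite /derivable slice_quotient.
by have [+ _] := df (lift ord0 i); apply.
Qed.

Lemma slice_FTC n (f : 'rV[R]_n.+1 -> R) (y : 'rV[R]_n) s t : C1 f -> s <= t ->
  slice f t y - slice f s y = \int[mu]_(r in `[s, t]) slice (partial ord0 f) r y.
Proof.
move=> [cf df]; rewrite le_eqVlt => /predU1P[->|st].
  by rewrite subrr set_itv1 Rintegral_set1.
have [df0 cdf0] := df ord0.
pose F (r : R) := slice f r y; pose F' (r : R) := slice (partial ord0 f) r y.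
have q r : (fun h : R => h^-1 *: ((F \o shift r) (h *: 1) - F r)) =
    (fun h : R => h^-1 *: ((f \o shift (rv_cons (r, y))) (h *: delta_mx ord0 ord0)
     - f (rv_cons (r, y)))).
  by apply/funext => h; rewrite /F /slice /= -rv_cons_shift0 [h *: 1]mulr1.
have dF r : derivable F r 1 by rewrite /derivable q; exact: df0.
have F'E : derive1 F = F'.
  by apply/funext => r; rewrite derive1E /derive q.
have c1 : {within `[s, t], continuous F'}.
  by apply: continuous_subspaceT; exact: continuous_slice0.
have c2 : derivable_oo_LRcontinuous F s t.
  split; first by move=> r _; exact: dF.
    apply: cvg_at_right_filter; exact: continuous_slice0.
  apply: cvg_at_left_filter; exact: continuous_slice0.
have c3 : {in `]s, t[, derive1 F =1 F'} by move=> r _; rewrite F'E.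
by rewrite -/(F t) -/(F s) /Rintegral (continuous_FTC2 st c1 c2 c3).
Qed.

Definition box_bounded n L (h : 'rV[R]_n -> R) := measurable_fun setT h /\
  exists M, forall x, box n L x -> `|h x| <= M.

Lemma box_boundedM n L (h k : 'rV[R]_n -> R) : box_bounded L h -> box_bounded L k ->
  box_bounded L (fun x => h x * k x).
Proof.
move=> [mh [M hM]] [mk [K kK]]; split; first exact: measurable_funM.
by exists (M * K) => x Bx; rewrite normrM ler_pM// ?hM// kK.
Qed.

Lemma box_bounded_continuous n L (h : 'rV[R]_n -> R) : continuous h -> box_bounded L h.
Proof.
move=> ch; split; first exact: continuous_measurable_rV.
by have [M _ hM] := continuous_bounded_box L ch; exists M.
Qed.

Lemma box_bounded_sqint n L (h : 'rV[R]_n -> R) : box_bounded L h ->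
  sqint (leb R n) (box n L) h.
Proof.
move=> [mh [M hM]]; apply: (@sqint_bounded _ _ _ _ _ (measurable_box L) h (M ^+ 2)).
- exact: leb_box_fin.
- exact: measurable_funTS.
- move=> x Bx; rewrite -real_normK ?num_real// lerXn2r ?nnegrE ?hM//.
  exact: le_trans (hM _ Bx).
Qed.

Definition rv_head n (x : 'rV[R]_n.+1) : measurableTypeR R := x ord0 ord0.
Definition rv_tail n (x : 'rV[R]_n.+1) : 'rV[R]_n := \row_i x ord0 (lift ord0 i).

Lemma rv_head_cons n t (y : 'rV[R]_n) : rv_head (rv_cons (t, y)) = t.
Proof. by rewrite /rv_head rv_consE0. Qed.

Lemma rv_tail_cons n t (y : 'rV[R]_n) : rv_tail (rv_cons (t, y)) = y.
Proof. by apply/rowP => i; rewrite mxE rv_consES. Qed.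

Lemma measurable_rv_head n : measurable_fun setT (@rv_head n).
Proof. exact: measurable_rv_coord. Qed.

Lemma measurable_rv_tail n : measurable_fun setT (@rv_tail n).
Proof.
have -> : @rv_tail n = snd \o @rv_uncons R n by [].
by apply: measurableT_comp => //; exact: measurable_rv_uncons.
Qed.

Section slices.
Variables (n : nat) (L : R) (h : 'rV[R]_n.+1 -> R).
Hypothesis bh : box_bounded L h.

Let mb := @measurable_box R n L.
Let boo := leb_box_fin n L.
Let g (p : measurableTypeR R * 'rV[R]_n) := h (rv_cons p).

Let mg : measurable_fun setT g.
Proof. by apply: measurableT_comp; [case: bh|exact: measurable_rv_cons]. Qed.

Let gM : exists M, forall t y, `[- L, L]%classic t -> box n L y -> `|g (t, y)| <= M.
Proof.
case: bh => _ [M hM]; exists M => t y tL yL; apply: hM.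
by have : (`[- L, L]%classic `*` box n L) (t, y) by []; rewrite -preimage_rv_cons_box.
Qed.

Lemma slice_integrable : mu.-integrable `[- L, L]%classic
  (EFin \o (fun t => \int[leb R n]_(y in box n L) slice h t y)).
Proof.
have [M gM'] := gM.
exact: (@bounded_fubini_integrable _ _ _ _ R mu (leb R n) _ _ g M
  (measurable_itv _) mb (itv_lty _ _) boo mg gM').
Qed.

Lemma slice_Rintegral : \int[leb R n.+1]_(x in box n.+1 L) h x =
  \int[mu]_(t in `[- L, L]) \int[leb R n]_(y in box n L) slice h t y.
Proof. by case: bh => mh [M hM]; exact: (Rintegral_leb_step mh hM). Qed.

Lemma slice_swap s t : - L <= s -> t <= L ->
  \int[mu]_(r in `[s, t]) \int[leb R n]_(y in box n L) slice h r y =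
  \int[leb R n]_(y in box n L) \int[mu]_(r in `[s, t]) slice h r y.
Proof.
move=> Ls tL; have [M gM'] := gM.
apply: (@bounded_fubini_swap _ _ _ _ R mu (leb R n) _ _ g M
  (measurable_itv _) mb (itv_lty _ _) boo mg).
move=> r y rI; apply: gM'; move: rI; rewrite /= !in_itv/= => /andP[sr rt].
by rewrite (le_trans Ls sr) (le_trans rt tL).
Qed.

End slices.

Local Notation ipb n L := (ip (leb R n) (box n L)).

(** Applied to the slices of [f], the induction hypothesis leaves the functions [F i t], the
    pairings of [chi i] with the slice at [t]. They have the primitive property with density [G i],
    the pairing with the slice of [partial ord0 f], so the one-dimensional grid inequality bounds
    their squares by a small multiple of the integral of [G i ^ 2] and finitely many cell
    integrals. *)
Lemma box_poincare n (L eps : R) : 0 < L -> 0 < eps ->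
  exists (I : finType) (chi : I -> 'rV[R]_n -> R) (C : R),
    [/\ 0 <= C, forall i, box_bounded L (chi i) &
      forall f, C1 f -> ipb n L f f <=
        eps * \sum_j ipb n L (partial j f) (partial j f) +
        C * \sum_i ipb n L (chi i) f ^+ 2].
Proof.
move=> L0; elim: n eps => [|n IH] eps e0.
  (* In dimension 0 the measure is a Dirac mass, and the inner product of [f] with itself is the
     square of its pairing with 1. *)
  exists unit, (fun _ => cst 1), 1; split => //.
    by move=> _; apply: box_bounded_continuous; exact: cst_continuous.
  move=> f _; rewrite big_ord0 mulr0 add0r mul1r (big_pred1 tt); last by case.
  have bE : box 0 L = setT :> set 'rV[R]_0 by apply/seteqP; split => // x _ [].
  have mes (h : 'rV[R]_0 -> R) : measurable_fun setT h.
    have -> : h = cst (h 0) by apply/funext => x; rewrite (thinmx0 x).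
    exact: measurable_cst.
  have E (h : 'rV[R]_0 -> R) : \int[leb R 0]_(x in box 0 L) h x = h 0.
    rewrite bE /Rintegral /= integral_dirac//.
      by rewrite diracT mul1e.
    by apply/measurable_EFinP; exact: mes.
  by rewrite /ip !E mul1r expr2.
have [I [chi [C [C0 bchi ineq]]]] := IH _ e0.
pose X i := ipb n L (chi i) (chi i).
have mb := @measurable_box R n L; have mb1 := @measurable_box R n.+1 L.
have mP : measurable (`[- L, L]%classic : set (measurableTypeR R)) by exact: measurable_itv.
have sX := sqint_subspace (leb R n) mb; have fX := ip_psd (leb R n) mb.
have X0 i : 0 <= X i by apply: (psd_ge0 fX); exact: box_bounded_sqint.
pose S := C * \sum_i X i; have S0 : 0 <= S by rewrite mulr_ge0// sumr_ge0.
(* For cells of width [h = 2 L / N] one has [2 h^2 S = 8 L^2 S / N^2]; as [N >= 1], it suffices that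
   [N] exceeds [8 L^2 S / eps]. *)
pose N := (Num.truncn (S * 8 * L ^+ 2 / eps)).+1.
pose h := 2 * L / N%:R.
have h0 : 0 < h by rewrite divr_gt0// mulr_gt0.
have LN : L = - L + N%:R * h.
  by rewrite /h; field; rewrite pnatr_eq0.
have Sh : 2 * h ^+ 2 * S <= eps.
  have Ngt : S * 8 * L ^+ 2 / eps < N%:R by exact: truncnS_gt.
  have N0 : 0 < N%:R :> R by rewrite ltr0n.
  have N1 : 1 <= N%:R :> R by rewrite ler1n.
  have -> : 2 * h ^+ 2 * S = S * 8 * L ^+ 2 / N%:R ^+ 2 by rewrite /h; field; rewrite gt_eqF.
  rewrite ler_pdivrMr ?exprn_gt0//; move: Ngt; rewrite ltr_pdivrMr// => /ltW/le_trans; apply.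
  rewrite mulrC ler_wpM2l ?(ltW e0)// expr2 ler_peMr// ltW//.
pose J (k : 'I_N) := `[- L + k%:R * h, - L + k.+1%:R * h]%classic : set (measurableTypeR R).
(* The new functionals are tensor products: the indicator of a cell in the first coordinate times an
   old functional in the others. *)
pose chi' (ik : I * 'I_N) (x : 'rV[R]_n.+1) := \1_(J ik.2) (rv_head x) * chi ik.1 (rv_tail x).
have bchit i : box_bounded L (fun x : 'rV[R]_n.+1 => chi i (rv_tail x)).
  have [m [M bM]] := bchi i; split; first by apply: measurableT_comp => //; exact: measurable_rv_tail.
  by exists M => x Bx; apply: bM => j; rewrite mxE; exact: Bx.
have bJ k : box_bounded L (fun x : 'rV[R]_n.+1 => \1_(J k) (rv_head x) : R).
  split; last first.
    by exists 1 => x _; rewrite indicE ger0_norm ?ler0n// lern1 leq_b1.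
  apply: (measurableT_comp (f := (\1_(J k) : measurableTypeR R -> R))).
    by apply: measurable_indic; exact: measurable_itv.
  exact: measurable_rv_head.
exists (I * 'I_N)%type, chi', (C * (2 / h)); split.
- by rewrite mulr_ge0// divr_ge0// ltW.
- by move=> [i k]; apply: box_boundedM; [exact: bJ|exact: bchit].
move=> f Cf; have [cf df] := Cf.
have bf : box_bounded L f by exact: box_bounded_continuous.
have bdf j : box_bounded L (partial j f).
  by apply: box_bounded_continuous; case: (df j).
have bchif i := box_boundedM (bchit i) bf.
have bchidf i := box_boundedM (bchit i) (bdf ord0).
pose F i t := ipb n L (chi i) (slice f t).
pose G i t := ipb n L (chi i) (slice (partial ord0 f) t).
have FE i t : F i t = \int[leb R n]_(y in box n L) slice (fun x => chi i (rv_tail x) * f x) t y.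
  by apply: eq_Rintegral => y _; rewrite /slice rv_tail_cons.
have GE i t : G i t = \int[leb R n]_(y in box n L)
    slice (fun x => chi i (rv_tail x) * partial ord0 f x) t y.
  by apply: eq_Rintegral => y _; rewrite /slice rv_tail_cons.
have iF i : mu.-integrable `[- L, L]%classic (EFin \o F i).
  apply: eq_integrable (slice_integrable (bchif i)) => // t _.
  by rewrite /= FE.
have iG i : mu.-integrable `[- L, L]%classic (EFin \o G i).
  apply: eq_integrable (slice_integrable (bchidf i)) => // t _.
  by rewrite /= GE.
pose Q (k : 'rV[R]_n.+1 -> R) t := ipb n L (slice k t) (slice k t).
have iQ k : box_bounded L k -> mu.-integrable `[- L, L]%classic (EFin \o Q k).
  by move=> bk; exact: (slice_integrable (box_boundedM bk bk)).
have QE k : box_bounded L k -> \int[mu]_(t in `[- L, L]) Q k t = ipb n.+1 L k k.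
  by move=> bk; rewrite /ip (slice_Rintegral (box_boundedM bk bk)).
have cs k i t : continuous k -> ipb n L (chi i) (slice k t) ^+ 2 <= X i * Q k t.
  move=> ck; apply: (psd_cauchy_schwarz sX fX).
    exact: box_bounded_sqint.
  by apply/box_bounded_sqint/box_bounded_continuous; exact: continuous_slice.
have cdf0 : continuous (partial ord0 f) by case: (df ord0).
have iXQ i k : box_bounded L k -> mu.-integrable `[- L, L]%classic (EFin \o (fun t => X i * Q k t)).
  by move=> bk; have := @integrableZl _ _ _ mu _ mP (X i) _ (iQ k bk); apply: eq_integrable.
have sF i : sqint mu `[- L, L]%classic (F i).
  apply: (@sqint_le _ _ _ _ _ mP _ (fun t => X i * Q f t)).
  - by apply/measurable_EFinP; exact: measurable_int (iF i).
  - exact: iXQ.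
  - by move=> t _; exact: cs.
have sG i : sqint mu `[- L, L]%classic (G i).
  apply: (@sqint_le _ _ _ _ _ mP _ (fun t => X i * Q (partial ord0 f) t)).
  - by apply/measurable_EFinP; exact: measurable_int (iG i).
  - exact: iXQ.
  - by move=> t _; exact: cs.
have prim i : primitive_on (- L) L (F i) (G i).
  move=> s t Ls st tL; rewrite /F -(psdBr sX fX); last 3 first.
  - exact/box_bounded_sqint/box_bounded_continuous/continuous_slice.
  - exact/box_bounded_sqint/box_bounded_continuous/continuous_slice.
  - exact: box_bounded_sqint.
  under [RHS]eq_Rintegral => r _ do rewrite GE.
  rewrite (slice_swap (bchidf i) Ls tL); apply: eq_Rintegral => y yB.
  have -> : (slice f t - slice f s : 'rV[R]_n -> R^o) y = slice f t y - slice f s y by [].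
  rewrite (slice_FTC y Cf st).
  under [RHS]eq_Rintegral => r _ do rewrite /slice rv_tail_cons.
  have iy : mu.-integrable `[s, t]%classic (EFin \o (fun r => partial ord0 f (rv_cons (r, y)))).
    apply: (@continuous_compact_integrable R (fun r => slice (partial ord0 f) r y)).
      exact: (@segment_compact R s t).
    by apply: continuous_subspaceT; exact: continuous_slice0.
  by rewrite RintegralZl.
have gp i : \int[mu]_(t in `[- L, L]) (F i t * F i t) <=
    2 * h ^+ 2 * (X i * ipb n.+1 L (partial ord0 f) (partial ord0 f)) +
    2 / h * \sum_k ipb n.+1 L (chi' (i, k)) f ^+ 2.
  have := @grid_poincare R (- L) h N (F i) (G i) h0; rewrite -LN.
  move=> /(_ (sF i) (sG i) (prim i)) /le_trans; apply.
  apply: lerD.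
    apply: ler_wpM2l; first by rewrite mulr_ge0// sqr_ge0.
    rewrite -(QE _ (bdf ord0)) -RintegralZl//; last exact: iQ.
    apply: le_Rintegral => //.
    - exact: (sqint_mul mP (sG i) (sG i)).
    - exact: iXQ.
    - by move=> t _; rewrite -expr2; exact: cs.
  apply: ler_wpM2l; first by rewrite divr_ge0// ltW.
  apply: ler_sum => k _.
  rewrite le_eqVlt; apply/orP; left; apply/eqP; congr (_ ^+ 2).
  have bb : box_bounded L (fun x => chi' (i, k) x * f x).
    by apply: box_boundedM => //; apply: box_boundedM; [exact: bJ|exact: bchit].
  rewrite [RHS](slice_Rintegral bb); apply: eq_Rintegral => t tP.
  rewrite /F /ip -RintegralZl//; last first.
    apply: (sqint_mul mb); first exact: box_bounded_sqint.
    exact/box_bounded_sqint/box_bounded_continuous/continuous_slice.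
  by apply: eq_Rintegral => y _; rewrite /slice /chi' /= rv_head_cons rv_tail_cons mulrA.
have iQs : mu.-integrable `[- L, L]%classic
    (EFin \o (fun t => \sum_(j < n) Q (partial (lift ord0 j) f) t)).
  by apply: (@integrable_big _ _ R mu _ mP _ _ (fun j : 'I_n => Q (partial (lift ord0 j) f))) => j; exact: iQ.
have iFs : mu.-integrable `[- L, L]%classic
    (EFin \o (fun t => \sum_i (F i t * F i t))).
  by apply: (@integrable_big _ _ R mu _ mP _ _ (fun i t => F i t * F i t)) => i; exact: (sqint_mul mP (sF i) (sF i)).
rewrite -(QE _ bf).
apply: (@le_trans _ _ (\int[mu]_(t in `[- L, L])
   (eps * \sum_(j < n) Q (partial (lift ord0 j) f) t + C * \sum_i (F i t * F i t)))).
  apply: le_Rintegral => //.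
  - exact: iQ.
  - exact: (integrable_lin mP eps C iQs iFs).
  - move=> t _; apply: (le_trans (ineq _ (C1_slice t Cf))).
    apply: lerD; (apply: ler_wpM2l; first by [exact: ltW|]); apply: ler_sum.
      by move=> j _; rewrite partial_slice; exact: lexx.
    by move=> i _; rewrite expr2; exact: lexx.
have iZ c (k : R -> R) : mu.-integrable `[- L, L]%classic (EFin \o k) ->
    mu.-integrable `[- L, L]%classic (EFin \o (fun t => c * k t)).
  by move=> ik; have := @integrableZl _ _ _ mu _ mP c _ ik; apply: eq_integrable.
rewrite (RintegralD mP (iZ eps _ iQs) (iZ C _ iFs)).
rewrite (RintegralZl eps mP iQs) (RintegralZl C mP iFs).
rewrite (@Rintegral_big _ _ R mu _ mP _ _ (fun j : 'I_n => Q (partial (lift ord0 j) f))) => [|j]; last exact: iQ.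
rewrite (@Rintegral_big _ _ R mu _ mP _ _ (fun i t => F i t * F i t)) => [|i]; last exact: (sqint_mul mP (sF i) (sF i)).
(* The [eps] share of the derivative along the first coordinate pays for the grid inequality; the
   shares of the other derivatives pay for the induction hypothesis. *)
rewrite big_ord_recl mulrDr [eps * _ + eps * _]addrC -[leRHS]addrA; apply: lerD.
  by apply: ler_wpM2l; [exact: ltW|apply: ler_sum => j _; rewrite QE].
pose P0 := ipb n.+1 L (partial ord0 f) (partial ord0 f).
have P00 : 0 <= P0 by apply: (psd_ge0 (ip_psd _ mb1)); exact: box_bounded_sqint.
apply: (@le_trans _ _ (C * \sum_i (2 * h ^+ 2 * (X i * P0) +
    2 / h * \sum_k ipb n.+1 L (chi' (i, k)) f ^+ 2))).
  by rewrite ler_wpM2l//; apply: ler_sum => i _; exact: gp.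
rewrite big_split/= mulrDr -!mulr_sumr -mulr_suml pair_bigA/=.
apply: lerD; last first.
  rewrite mulrA le_eqVlt; apply/orP; left; apply/eqP; congr (_ * _); apply: eq_bigr => -[i k].
rewrite -/P0; have -> : C * (2 * h ^+ 2 * ((\sum_i X i) * P0)) = 2 * h ^+ 2 * S * P0.
  by rewrite /S; ring.
by rewrite ler_wpM2r.
Qed.

End box_poincare.

(** * The spectral gap *)

Lemma normr_le1D (R : realFieldType) (x M : R) : x ^+ 2 <= M -> `|x| <= 1 + M.
Proof.
rewrite -real_normK ?num_real// => h; have := sqr_ge0 (`|x| - 1).
by rewrite sqrrB1; have := normr_ge0 x; lra.
Qed.

Section spectral_gap.
Context {R : realType} {d : nat} (Omega : set 'rV[R]_d).
Hypotheses (oO : open Omega) (bO : bounded_set Omega).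

Local Notation fT := ('rV[R]_d -> R^o).
Local Notation L2O := (L2 Omega : set fT).
Local Notation H := (H10 Omega : set fT).
Local Notation A := (form_a Omega).
Local Notation B := (form_b Omega).

Let mO : measurable Omega. Proof. exact: open_measurable_rV. Qed.
Let sL := L2_subspace oO.
Let fB := form_b_psd oO.
Let sH := H10_subspace oO bO.
Let fA := form_a_psd oO bO.
Let HL : H `<=` L2O. Proof. exact: H10_L2. Qed.
Let fBH : psd_form H B. Proof. exact: subspace_psd HL fB. Qed.

Lemma ip_box_support L (f g : fT) : Omega `<=` box d L ->
  (forall x, ~ Omega x -> g x = 0) ->
  ip (leb R d) (box d L) f g = B f g.
Proof.
move=> OL g0; rewrite /form_b.
have -> : Omega = box d L `&` Omega by apply/seteqP; split => [x Ox|x []//]; split => //; exact: OL.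
rewrite Rintegral_mkcondr; apply: eq_Rintegral => x _.
by rewrite patchE; case: ifPn => // /negP; rewrite inE => /g0 ->; rewrite mulr0.
Qed.

Lemma test_C1 (phi : fT) : test_function Omega phi -> C1 phi.
Proof.
case=> sphi _ _; split; first exact: smooth_continuous.
move=> i; split; last exact/smooth_continuous/smooth_partial.
by move=> x; exact: smooth_derivable.
Qed.

(* A quantitative form of the compactness of the embedding of [H10] in [L2]. *)
Lemma H10_compact (eps : R) : 0 < eps ->
  exists (I : finType) (chi : I -> fT) (C : R),
    [/\ 0 <= C, forall i, L2 Omega (chi i) &
      forall v, H v -> B v v <= eps * A v v + C * \sum_i B (chi i) v ^+ 2].
Proof.
move=> eps0; have [L L0 OL] := bounded_sub_box bO.
(* Going from a test function to its limit costs a factor 2 on the left and another on the right;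
   hence [eps / 4] here and [4 * C] below. *)
have [|I [chi [C [C0 bchi ineq]]]] := @box_poincare R d L (eps / 4) L0.
  by rewrite divr_gt0.
have Lchi i : L2 Omega (chi i).
  have [mchi [M chiM]] := bchi i.
  apply: (@L2_bounded _ _ _ oO bO _ M); first exact: measurable_funTS.
  by move=> x /OL; exact: chiM.
exists I, chi, (4 * C); split => //; first by rewrite mulr_ge0.
move=> v Hv; have Lv := HL Hv; have Hg := gradP Hv; set g := grad Omega v in Hg.
have Lg i := gradient_L2 i Hg.
rewrite -subr_le0 (form_aE oO bO Hg Hg).
apply: (@le0_of_le_eps _ _ (2 + eps * d%:R + 4 * C * \sum_i B (chi i) (chi i))) => e e0.
have [_ _ ap] := (H10_gradientP oO bO v g).1 Hg.
have [phi [tphi bphi dphi]] := ap _ e0.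
have Lp := test_L2 oO bO tphi; have Ldp i := test_L2 oO bO (test_partial i tphi).
have out (psi : fT) : test_function Omega psi -> forall x, ~ Omega x -> psi x = 0.
  by move=> [_ _ sub] x nx; apply: out_tsupport => /sub.
have h0 := ineq phi (test_C1 tphi).
rewrite (ip_box_support _ OL (out _ tphi)) in h0.
have E1 : \sum_j ip (leb R d) (box d L) (partial j phi) (partial j phi) =
    \sum_j B (partial j phi) (partial j phi).
  by apply: eq_bigr => j _; apply: (ip_box_support _ OL); exact: out (test_partial j tphi).
have E2 : \sum_i ip (leb R d) (box d L) (chi i) phi ^+ 2 = \sum_i B (chi i) phi ^+ 2.
  by apply: eq_bigr => i _; rewrite (ip_box_support _ OL (out _ tphi)).
rewrite E1 E2 in h0.
have near (p q : fT) : L2 Omega p -> L2 Omega q -> B (p - q) (p - q) <= e ->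
    B p p <= 2 * B q q + 2 * e.
  move=> Lpp Lq pq; have := psd_sqrD_le sL fB (subspaceB sL Lpp Lq) Lq.
  by rewrite subrK => /le_trans; apply; rewrite addrC lerD2l ler_wpM2l.
have h1 : B v v <= 2 * B phi phi + 2 * e.
  by apply: near => //; rewrite (psd_sqrBC sL fB).
have h2 : \sum_j B (partial j phi) (partial j phi) <= 2 * (\sum_j B (g j) (g j)) + d%:R * (2 * e).
  rewrite mulr_sumr.
  have -> : d%:R * (2 * e) = \sum_(j < d) (2 * e) by rewrite sumr_const card_ord -[RHS]mulr_natl.
  rewrite -big_split/=; apply: ler_sum => j _; exact: near.
have h3 : \sum_i B (chi i) phi ^+ 2 <= 2 * (\sum_i B (chi i) v ^+ 2) + 2 * e * \sum_i B (chi i) (chi i).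
  rewrite !mulr_sumr -big_split/=; apply: ler_sum => i _.
  have cs := psd_cauchy_schwarz sL fB (Lchi i) (subspaceB sL Lp Lv).
  have X0 : 0 <= B (chi i) (chi i) by exact: (psd_ge0 fB).
  have {}cs := le_trans cs (ler_wpM2l X0 bphi).
  move: cs; rewrite (psdBr sL fB)// => cs.
  have := sqr_ge0 (B (chi i) phi - 2 * B (chi i) v).
  move: cs; rewrite !sqrrB.
  move: (B (chi i) phi) (B (chi i) v) (B (chi i) (chi i)) => x y z.
  by rewrite !expr2; lra.
have h4 := ler_wpM2l (ltW (divr_gt0 eps0 (ltr0n R 4))) h2.
have h5 := ler_wpM2l C0 h3.
move: h0 h1 h4 h5; clear.
set a := B v v; set b := B phi phi; set S1 : R := \sum_j B (partial j phi) (partial j phi).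
set S2 : R := \sum_j B (g j) (g j); set S3 : R := \sum_i B (chi i) phi ^+ 2.
set S4 : R := \sum_i B (chi i) v ^+ 2; set S5 : R := \sum_i B (chi i) (chi i).
move: a b S1 S2 S3 S4 S5 => a b S1 S2 S3 S4 S5; lra.
Qed.

Lemma ae_eq_form_b (u v f : fT) : L2 Omega u -> L2 Omega v -> L2 Omega f ->
  ae_eq_on Omega u v -> B u f = B v f.
Proof.
move=> [mu _] [mv _] [mf _] uv; rewrite /form_b /Rintegral; congr fine.
apply: ae_eq_integral => //.
- by apply/measurable_EFinP; exact: measurable_funM.
- by apply/measurable_EFinP; exact: measurable_funM.
- by apply: filterS uv => x h Ox /=; rewrite h.
Qed.

Variable lam : nat -> R.
Hypothesis elam : eigenvalue_sequence Omega lam.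
Hypothesis gap : lam 0%N < lam 1%N.

(** Every index other than 0 has an eigenvalue of at least [lam 1], so only [e 0] can occur in the
    expansion. That expansion holds almost everywhere, so colinearity is stated through pairings;
    [c] is nonzero because [w] is normalised. *)
Lemma eigenfunctions_below_colinear : exists2 e0 : fT, H e0 & forall (m : R) (w : fT),
    m < lam 1%N -> eigenpair Omega H m w ->
  exists2 c : R, c != 0 & forall f, L2 Omega f -> B w f = c * B e0 f.
Proof.
have [hlam _ [e [ep _ span]]] := elam.
exists (e 0%N) => [|m' w' lm' epw']; first by case: (ep 0%N).
have [He0 be0 _] := ep 0%N; have [Hw bw _] := epw'.
have [N [c]] := span _ _ epw'.
have lam1 n : (0 < n)%N -> (lam n == m') = false.
  by move=> n0; apply/negbTE; rewrite gt_eqF// (lt_le_trans lm')// hlam.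
pose k := if (0 < N)%N && (lam 0%N == m') then c 0%N else 0.
have -> : (fun x => \sum_(0 <= n < N | lam n == m') c n * e n x) = k *: (e 0%N : fT).
  apply/funext => x; rewrite -[RHS]/(k * e 0%N x) /k {k}; case: N => [|N].
    by rewrite big_geq//= mul0r.
  rewrite big_mkcond big_ltn//= big_nat_cond big1 ?addr0; last first.
    by move=> i /andP[/andP[i0 _] _]; rewrite lam1.
  by case: ifP => // _; rewrite mul0r.
move=> aew; have Lke : L2 Omega (k *: (e 0%N : fT)) by apply: (subspaceZ _ sL); exact: HL.
have E f : L2 Omega f -> B w' f = k * B (e 0%N) f.
  by move=> Lf; rewrite (ae_eq_form_b (HL Hw) Lke Lf aew) (psdZl sL fB)//; exact: HL.
exists k => //; apply/eqP => k0.
by have := E _ (HL Hw); rewrite bw k0 mul0r => /eqP; rewrite oner_eq0.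
Qed.

Variable u1 : fT.
Hypothesis eu1 : eigenpair Omega H (lam 0%N) u1.

(** A violating [w] would give a minimiser on the orthogonal of [u1] with value below [lam 1]. It
    would be an eigenfunction both orthogonal to and colinear with [u1]. *)
Lemma rayleigh_orthogonal w : H w -> B w u1 = 0 -> lam 1%N * B w w <= A w w.
Proof.
move=> Hw wu; rewrite leNgt; apply/negP => aw.
have [Hu bu au] := eu1.
pose X : set fT := [set v | H v /\ B v u1 = 0].
have XH : X `<=` H by move=> v [].
have sX : is_subspace X.
  split; first by split; [exact: sH.1|rewrite (psd0l sH fBH)].
  move=> k p q [Hp pu] [Hq qu]; split; first exact: sH.2.
  by have [_ -> //] := fBH; rewrite pu qu mulr0 addr0.
have aw0 : 0 <= A w w by exact: (psd_ge0 fA).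
have bw0 : 0 <= B w w by exact: (psd_ge0 fBH).
have bw : 0 < B w w.
  rewrite lt_def bw0 andbT; apply/eqP => b0; move: aw; rewrite b0 mulr0 ltNge.
  by rewrite aw0.
have l1 : 0 < lam 1%N by rewrite -(pmulr_lgt0 _ bw) (le_lt_trans aw0).
pose v0 := (Num.sqrt (B w w))^-1 *: w.
have Xw : X w by [].
have sq2 : (Num.sqrt (B w w))^-1 ^+ 2 = (B w w)^-1 by rewrite exprVn sqr_sqrtr.
have Xv0 : X v0 by exact: (subspaceZ _ sX).
have bv0 : B v0 v0 = 1 by rewrite (psd_sqrZ sH fBH)// sq2 mulVf// gt_eqF.
have av0 : A v0 v0 < lam 1%N by rewrite (psd_sqrZ sH fA)// sq2 mulrC ltr_pdivrMr.
(* The competitor [v0] has energy below [lam 1], so [eps = 1 / lam 1] meets the smallness condition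
   of [attained_min]. *)
have [|I [chi [C [C0 Lchi ineq]]]] := @H10_compact (lam 1%N)^-1.
  by rewrite invr_gt0.
have [|||||||||w' [m [Xw' bw' aw' mA mle]]] := @attained_min R fT X A B I
    (fun i v => B (chi i) v) (lam 1%N)^-1 C (1 + \sum_i B (chi i) (chi i)) v0 sX
    (subspace_psd XH fA) (subspace_psd XH fBH).
- by move=> j p q [Hp _] [Hq _]; rewrite (psdBr sL fB)//; exact: HL.
- by rewrite invr_ge0 ltW.
- exact: C0.
- by move=> v [Hv _]; exact: ineq.
- move=> j v [Hv _] bv; have Lv := HL Hv.
  have := psd_cauchy_schwarz sL fB (Lchi j) Lv; rewrite bv mulr1 => cs.
  have h : B (chi j) (chi j) <= \sum_i B (chi i) (chi i).
    rewrite (bigD1 j)//= lerDl; apply: sumr_ge0 => i _; exact: (psd_ge0 fB).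
  exact: normr_le1D (le_trans cs h).
- move=> s Xs _ cauchy; have [|s' Hs' s'P] := H10_complete oO bO (fun n => XH _ (Xs n)).
    exact: cauchy.
  exists s' => //; split => //.
  rewrite (psdC fBH)//; apply: (psd_lim0 sH fBH) => // e e0.
  have [N /(_ N (leqnn N))[_ h]] := s'P _ e0.
  by exists (s N); have [Hs us] := Xs N; rewrite (psdC fBH).
- exact: Xv0.
- exact: bv0.
- by rewrite mulrC ltr_pdivrMr// mul1r.
have Hw' := XH _ Xw'.
have w'u : B w' u1 = 0 by case: Xw'.
(* Minimality gives the equation for test vectors in [X] only. It extends to [H] by removing the
   component along [u1], on which both [A w'] and [B w'] vanish. *)
have ep : eigenpair Omega H m w'.
  split => // v Hv; have Xv : X (v - B v u1 *: u1).
    split; first by apply: (subspaceB sH) => //; exact: (subspaceZ _ sH).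
    by rewrite (psdBl sH fBH) ?(psdZl sH fBH) ?bu ?mulr1 ?subrr//; exact: (subspaceZ _ sH).
  have := aw' _ Xv; have HZ := subspaceZ (B v u1) sH Hu.
  rewrite (psdBr sH fA)// (psdBr sH fBH)// (psdZr sH fA)// (psdZr sH fBH)//.
  by rewrite (psdC fA Hw' Hu) au// (psdC fBH Hu Hw') w'u !mulr0 !subr0.
have ml : m < lam 1%N by exact: le_lt_trans av0.
(* Both [w'] and [u1] pair like nonzero multiples of [e0], which is incompatible with
   [B w' u1 = 0]. *)
have [e0 He0 span] := eigenfunctions_below_colinear.
have [c c0 cP] := span _ _ ml ep.
have [c' c'0 c'P] := span _ _ gap eu1.
have e1 : B e0 e0 != 0.
  apply/eqP => b0; have := c'P _ (HL Hu).
  rewrite bu (psd_null sL fB (HL He0) (HL Hu) b0) mulr0 => /eqP.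
  by rewrite oner_eq0.
have := cP _ (HL Hu).
rewrite w'u (psdC fB (HL He0) (HL Hu)) (c'P _ (HL He0)) => /esym/eqP.
by rewrite !mulf_eq0 (negbTE c0) (negbTE c'0) (negbTE e1).
Qed.

(** The index [i] witnesses [d > 0]; an eigenvalue 0 would make the gradient of [u1] null, hence
    [u1] itself. *)
Lemma eigenvalue0_gt0 (i : 'I_d) : 0 < lam 0%N.
Proof.
have [Hu bu au] := eu1; have auu : A u1 u1 = lam 0%N by rewrite au// bu mulr1.
rewrite lt_def -auu (psd_ge0 fA)// andbT; apply/eqP => a0.
have := H10_gradient0 oO bO i Hu a0; rewrite bu => /eqP.
by rewrite oner_eq0.
Qed.

End spectral_gap.

(** * Error estimate for one Newton step *)

(** The scalar core of the Newton step: [aw], [bw], [ar], [br] are the two forms at [w] and [r],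
    [c = b(w, r)], and [tau] is the computed multiplier minus [lk]. The three equations in [p] are
    the Newton equation tested with [bu] and with [r], and the normalisation. *)
Lemma newton_numeric (R : realFieldType) (s p l1 l2 lb lk tau aw bw ar br c : R) :
  0 < l1 -> l1 < l2 -> l1 <= lb -> lb <= lk -> lk <= l1 + (l2 - l1) / 4 ->
  1 = s ^+ 2 + bw -> lk = s ^+ 2 * lb + aw ->
  p * (lb - lk) = tau * s -> ar - lk * br = tau * c -> p * s + c = 1 ->
  c ^+ 2 <= bw * br -> l2 * br <= ar -> l2 * bw <= aw -> 0 <= bw -> 0 <= br ->
  0 < p * s /\ ar <= p ^+ 2 * (l2 / (l2 - l1) ^+ 2 * aw ^+ 2).
Proof.
move=> l10 l12 l1b lbk lkle es ek ept er epc cs gr gw bw0 br0.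
pose g := l2 - l1; have g0 : 0 < g by rewrite subr_gt0.
have l20 : 0 < l2 by rewrite (lt_trans l10).
have s2E : s ^+ 2 = 1 - bw by lra.
(* The two decompositions give [(l2 - lb) bw <= aw - lb bw = lk - lb], at most a quarter of the gap,
   while [l2 - lb] is at least three quarters of it. *)
have bw3 : bw <= 1 / 3.
  have h1 : g * 3 / 4 * bw <= (l2 - lb) * bw by rewrite ler_wpM2r// /g; lra.
  have h2 : (l2 - lb) * bw <= g / 4.
    by rewrite /g; move: ek; rewrite s2E; lra.
  have : g * 3 / 4 * bw <= g * 3 / 4 * (1 / 3) by apply: (le_trans h1); lra.
  by rewrite ler_pM2l//; lra.
have s23 : 2 / 3 <= s ^+ 2 by lra.
have D0 : 0 < l2 - lk by rewrite /g in g0; lra.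
pose D := l2 - lk; have Dg : 3 / 4 * g <= D by rewrite /D /g; lra.
have ar0 : 0 <= ar by apply: le_trans gr; rewrite mulr_ge0// ltW.
have lklb : 0 <= lk - lb <= aw.
  rewrite subr_ge0 lbk/=.
  have : 0 <= lb * bw by rewrite mulr_ge0//; lra.
  by move: ek; rewrite s2E; lra.
have lklb4 : lk - lb <= g / 4 by rewrite /g; lra.
case/andP: lklb => lklb0 lklbaw.
have k1 : ar * D <= l2 * (tau * c).
  have lk0 : 0 <= lk by lra.
  by have := ler_wpM2l lk0 gr; rewrite -er /D; lra.
(* Squaring [k1] and using [c^2 <= bw br] with [l2 br <= ar] leaves one factor [ar] to cancel. *)
have k2 : ar * D ^+ 2 <= tau ^+ 2 * bw * l2.
  have [->|arn] := eqVneq ar 0.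
    rewrite mul0r; apply: mulr_ge0; last exact: ltW.
    by apply: mulr_ge0 => //; exact: sqr_ge0.
  have arp : 0 < ar by rewrite lt_def arn.
  rewrite -(ler_pM2l arp).
  have -> : ar * (ar * D ^+ 2) = (ar * D) ^+ 2 by ring.
  have h1 : (ar * D) ^+ 2 <= (l2 * (tau * c)) ^+ 2.
    have q1 : 0 <= ar * D by rewrite mulr_ge0// ltW.
    by rewrite lerXn2r// nnegrE// (le_trans q1).
  apply: (le_trans h1).
  have -> : (l2 * (tau * c)) ^+ 2 = l2 * tau ^+ 2 * (l2 * c ^+ 2) by ring.
  have -> : ar * (tau ^+ 2 * bw * l2) = l2 * tau ^+ 2 * (bw * ar) by ring.
  apply: ler_wpM2l; first by rewrite mulr_ge0 ?sqr_ge0// ltW.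
  apply: (@le_trans _ _ (l2 * (bw * br))); first by rewrite ler_wpM2l// ltW.
  by rewrite mulrCA ler_wpM2l.
(* Multiplying by [s^2] turns [tau s] into [p (lb - lk)]; this trades the unknown multiplier for the
   eigenvalue error, itself quadratic in [w]. *)
have k3 : ar * (D ^+ 2 * s ^+ 2) <= p ^+ 2 * (lk - lb) ^+ 2 * bw * l2.
  have -> : p ^+ 2 * (lk - lb) ^+ 2 = tau ^+ 2 * s ^+ 2.
    by rewrite -!exprMn -ept; ring.
  have := ler_wpM2r (sqr_ge0 s) k2.
  have -> : ar * D ^+ 2 * s ^+ 2 = ar * (D ^+ 2 * s ^+ 2) by ring.
  by have -> : tau ^+ 2 * bw * l2 * s ^+ 2 = tau ^+ 2 * s ^+ 2 * bw * l2 by ring.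
have Dsq : 9 / 16 * g ^+ 2 <= D ^+ 2.
  have -> : 9 / 16 * g ^+ 2 = (3 / 4 * g) ^+ 2 by field.
  by rewrite lerXn2r// nnegrE; [rewrite mulr_ge0// ltW | exact: ltW].
have gg : 0 < g ^+ 2 by rewrite exprn_gt0.
have Ds : 3 / 8 * g ^+ 2 <= D ^+ 2 * s ^+ 2.
  have -> : 3 / 8 * g ^+ 2 = (9 / 16 * g ^+ 2) * (2 / 3) by field.
  by apply: ler_pM => //; rewrite mulr_ge0// ltW.
have k4 : ar * (3 / 8 * g ^+ 2) <= p ^+ 2 * (lk - lb) ^+ 2 * bw * l2.
  by apply: le_trans k3; rewrite ler_wpM2l.
have pp : 0 <= p ^+ 2 by exact: sqr_ge0.
have awl : (lk - lb) ^+ 2 <= aw ^+ 2.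
  by rewrite lerXn2r// nnegrE// (le_trans lklb0).
have gl : (lk - lb) ^+ 2 <= g ^+ 2 / 16.
  have -> : g ^+ 2 / 16 = (g / 4) ^+ 2 by field.
  by rewrite lerXn2r// nnegrE divr_ge0// ltW.
split.
  (* Here 1/54 is 1/3 * 1/16 * 1/3 divided by 3/8: two bounds on [bw], one on [(lk - lb)^2], and the
     factor from [Ds]. *)
  have c2 : c ^+ 2 <= p ^+ 2 / 54.
    have h1 : l2 * c ^+ 2 <= bw * ar.
      apply: (@le_trans _ _ (l2 * (bw * br))); first by rewrite ler_wpM2l// ltW.
      by rewrite mulrCA ler_wpM2l.
    have h2 : bw * (ar * (3 / 8 * g ^+ 2)) <= (1 / 3) * (p ^+ 2 * (g ^+ 2 / 16) * (1 / 3) * l2).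
      apply: ler_pM => //; first by rewrite !mulr_ge0// ltW.
      apply: (le_trans k4); rewrite ler_wpM2r ?(ltW l20)//.
      apply: ler_pM => //; first by rewrite mulr_ge0// sqr_ge0.
      by rewrite ler_wpM2l.
    have h3 : (l2 * c ^+ 2) * (3 / 8 * g ^+ 2) <= bw * ar * (3 / 8 * g ^+ 2).
      by rewrite ler_wpM2r// mulr_ge0// ltW.
    have : (l2 * (3 / 8 * g ^+ 2)) * c ^+ 2 <= (l2 * (3 / 8 * g ^+ 2)) * (p ^+ 2 / 54).
      have -> : l2 * (3 / 8 * g ^+ 2) * (p ^+ 2 / 54) = 1 / 3 * (p ^+ 2 * (g ^+ 2 / 16) * (1 / 3) * l2) by field.
      apply: le_trans h2; rewrite mulrA.
      by have -> : l2 * (3 / 8 * g ^+ 2) * c ^+ 2 = l2 * c ^+ 2 * (3 / 8 * g ^+ 2) by ring.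
    by rewrite ler_pM2l// mulr_gt0// mulr_gt0.
  (* If [p s <= 0], then [c = 1 - p s] makes [c^2] at least [1 + (p s)^2 >= 1 + 2/3 p^2], which
     contradicts [c2]. *)
  rewrite ltNge; apply/negP => ps0.
  have cE : c = 1 - p * s by lra.
  have h1 : (p * s) ^+ 2 + 1 <= c ^+ 2 by rewrite cE sqrrB expr1n; lra.
  have h2 : p ^+ 2 * (2 / 3) <= (p * s) ^+ 2 by rewrite exprMn ler_wpM2l.
  move: h1 h2 c2 pp; move: (c ^+ 2) ((p * s) ^+ 2) (p ^+ 2) => x y z; lra.
have g2 : 0 < 3 / 8 * g ^+ 2 by rewrite mulr_gt0.
rewrite -/g -(ler_pM2r g2); apply: (le_trans k4).
have -> : p ^+ 2 * (l2 / g ^+ 2 * aw ^+ 2) * (3 / 8 * g ^+ 2) = p ^+ 2 * aw ^+ 2 * (3 / 8) * l2.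
  by field; rewrite gt_eqF.
(* The numbers fit without a further constant because [bw <= 1/3 <= 3/8]. *)
rewrite ler_wpM2r ?(ltW l20)//; apply: ler_pM => //.
- by rewrite mulr_ge0// sqr_ge0.
- by rewrite ler_wpM2l.
- by apply: (le_trans bw3); lra.
Qed.

(** [q = p / N] is the component of the normalised iterate along [bu], and [E] is the squared energy
    error of [uk]. As [p] and [s] have the same sign, the sign of [s] decides whether the iterate
    approaches [bu] or its opposite. *)
Lemma normalized_error (R : realFieldType) (N s p l1 lb K aw ar br : R) :
  0 < l1 -> l1 <= lb -> 0 <= K -> 0 < N -> N ^+ 2 = p ^+ 2 + br -> 0 < p * s ->
  ar <= p ^+ 2 * (K * aw ^+ 2) -> lb * br <= ar -> 0 <= aw -> 0 <= br ->
  (1 - p / N) ^+ 2 * lb + N^-1 ^+ 2 * ar <=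
  (4 / l1 + 2 * K) * ((1 - s) ^+ 2 * lb + aw) ^+ 2.
Proof.
move=> l10 l1b K0 N0 N2 ps0 arle lbr aw0 br0.
have lb0 : 0 < lb by exact: lt_le_trans l1b.
pose E := (1 - s) ^+ 2 * lb + aw; rewrite -/E.
have E1 : aw <= E by rewrite lerDr mulr_ge0 ?sqr_ge0// ltW.
have aE : aw ^+ 2 <= E ^+ 2 by rewrite lerXn2r// nnegrE// (le_trans aw0).
have KE : 0 <= K * E ^+ 2 by rewrite mulr_ge0// sqr_ge0.
pose q := p / N; have q2 : q ^+ 2 <= 1.
  by rewrite /q expr_div_n ler_pdivrMr ?exprn_gt0// mul1r N2 lerDl.
have NN : 0 < N^-1 ^+ 2 by rewrite exprn_gt0// invr_gt0.
have q2E : N^-1 ^+ 2 * p ^+ 2 = q ^+ 2 by rewrite /q exprMn mulrC.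
have arN : N^-1 ^+ 2 * ar <= K * E ^+ 2.
  apply: (@le_trans _ _ (q ^+ 2 * (K * aw ^+ 2))).
    by rewrite -q2E -[leRHS]mulrA; apply: ler_wpM2l => //; exact: ltW.
  apply: (@le_trans _ _ (K * aw ^+ 2)); last by rewrite ler_wpM2l.
  by rewrite ler_piMl// mulr_ge0// sqr_ge0.
have qn : `|q| <= 1 by rewrite -[leRHS]normr1 -ler_sqr ?nnegrE// !real_normK ?num_real// expr1n.
move: qn; rewrite ler_norml => /andP[qm q1].
have l14 : 0 <= 4 / l1 * E ^+ 2 by rewrite mulr_ge0 ?sqr_ge0// divr_ge0// ltW.
have [s0|s0] := ltP 0 s.
  have p0 : 0 < p by rewrite -(pmulr_lgt0 _ s0).
  have q0 : 0 < q by rewrite divr_gt0.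
  (* For [0 < q <= 1], [(1 - q)^2 <= 1 - q^2], which is the squared [b] norm of the component
     orthogonal to [bu]; hence the factor 2 in front of [K]. *)
  have h1 : (1 - q) ^+ 2 * lb <= N^-1 ^+ 2 * ar.
    have h : (1 - q) ^+ 2 <= N^-1 ^+ 2 * br.
      have -> : N^-1 ^+ 2 * br = 1 - q ^+ 2.
        have -> : br = N ^+ 2 - p ^+ 2 by rewrite N2; ring.
        by rewrite mulrBr q2E -exprMn mulVf ?gt_eqF// expr1n.
      rewrite expr2 [q ^+ 2]expr2; nra.
    apply: (le_trans (ler_wpM2r (ltW lb0) h)).
    by rewrite -mulrA; apply: ler_wpM2l; [exact: ltW|rewrite mulrC].
  by rewrite -/q [leRHS]mulrDl -[2 * K * _]mulrA; move: l14 h1 arN KE; clearbody q E; lra.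
have sn : s < 0 by rewrite lt_neqAle s0 andbT; apply: contraTneq ps0 => ->; rewrite mulr0 ltxx.
have h1 : (1 - q) ^+ 2 * lb <= 4 * lb.
  by rewrite ler_wpM2r ?(ltW lb0)//; rewrite expr2; nra.
have lE : lb <= E.
  have : 1 <= (1 - s) ^+ 2 by rewrite expr2; nra.
  move=> /(ler_wpM2r (ltW lb0)); rewrite mul1r => h.
  by apply: (le_trans h); rewrite lerDl.
have h2 : 4 * lb <= 4 / l1 * E ^+ 2.
  rewrite mulrAC ler_pdivlMr// -!mulrA ler_wpM2l// expr2.
  by apply: ler_pM => //; [exact: ltW|exact: ltW|exact: le_trans lE].
by rewrite -/q [leRHS]mulrDl -[2 * K * _]mulrA; move: h1 h2 arN KE; clearbody q E; lra.
Qed.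

Section newton_estimate.
Context {R : realType} {V : lmodType R} (H W : set V) (a b : V -> V -> R).
Hypotheses (sH : is_subspace H) (fa : psd_form H a) (fb : psd_form H b).
Variables (l1 l2 : R) (u1 : V).
Hypotheses (l10 : 0 < l1) (l12 : l1 < l2).
Hypotheses (Hu1 : H u1) (bu1 : b u1 u1 = 1).
Hypothesis eig1 : forall v, H v -> a u1 v = l1 * b u1 v.
Hypothesis gap : forall w, H w -> b w u1 = 0 -> l2 * b w w <= a w w.

Lemma rayleigh_ge v : H v -> l1 * b v v <= a v v.
Proof.
move=> Hv; pose k := b v u1; pose w := v - k *: u1.
have HZ : H (k *: u1) by exact: (subspaceZ _ sH).
have Hw : H w by exact: (subspaceB sH).
have wu : b w u1 = 0 by rewrite (psdBl sH fb)// (psdZl sH fb)// bu1 mulr1 subrr.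
have uw : a u1 w = 0 by rewrite eig1// (psdC fb)// wu mulr0.
have vE : v = k *: u1 + 1 *: w by rewrite scale1r /w addrC subrK.
have g := gap Hw wu; have bw := psd_ge0 fb Hw.
have h : l1 * b w w <= l2 * b w w by rewrite ler_wpM2r// ltW.
rewrite vE !(psd_sqr sH)// uw bu1 (psdC fb Hu1 Hw) wu eig1// bu1; lra.
Qed.

Hypotheses (sW : is_subspace W) (WH : W `<=` H).
Variables (uk bu hu : V) (lk lb lh : R).
Hypotheses (Wuk : W uk) (buk : b uk uk = 1) (lkE : lk = a uk uk).
Hypothesis close : a (uk - u1) (uk - u1) <= (l2 - l1) / 4.
Hypotheses (Wbu : W bu) (bbu : b bu bu = 1).
Hypothesis eigb : forall v, W v -> a bu v = lb * b bu v.
Hypothesis minb : forall v, W v -> lb * b v v <= a v v.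
Hypothesis Whu : W hu.
Hypothesis newton : forall v, W v ->
  a hu v - lk * b hu v - lh * b uk v = - (lk * b uk v).
Hypothesis hu_uk : b hu uk = 1.

Let Huk := WH Wuk.
Let Hbu := WH Wbu.
Let Hhu := WH Whu.

Lemma discrete_bounds : [/\ l1 <= lb, lb <= lk & lk <= l1 + (l2 - l1) / 4].
Proof.
split.
- by have := rayleigh_ge Hbu; rewrite eigb// bbu !mulr1.
- by have := minb Wuk; rewrite buk mulr1 lkE.
have bd := psd_ge0 fb (subspaceB sH Huk Hu1).
have : 0 <= l1 * b (uk - u1) (uk - u1) by rewrite mulr_ge0// ltW.
move: close; rewrite !(psd_sqrB sH)// buk bu1 -lkE (psdC fa Huk Hu1) eig1// eig1// bu1.
by rewrite (psdC fb Hu1 Huk); lra.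
Qed.

(** Min-max by hand: the plane spanned by [bu] and [v] contains [z], which is orthogonal to [u1], so
    [gap] applies to [z]. The [bu] part of [z] has quotient [lb < l2], so the [v] part must make up
    for it. The coefficient [y] is nonzero, as otherwise [gap] at [bu] would give [lb >= l2]. *)
Lemma discrete_gap v : W v -> b v bu = 0 -> l2 * b v v <= a v v.
Proof.
have [h1 h2 h3] := discrete_bounds.
move=> Wv vbu; have Hv := WH Wv.
have lbl2 : lb < l2 by move: l12; lra.
pose x := b v u1; pose y := b bu u1.
have y0 : y != 0.
  apply/eqP => y0; have := gap Hbu y0.
  by rewrite eigb// bbu !mulr1 leNgt lbl2.
pose z := x *: bu + (- y) *: v.
have HZx := subspaceZ x sH Hbu; have HZy := subspaceZ (- y) sH Hv.
have Hz : H z by exact: (subspaceD sH).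
have zu : b z u1 = 0.
  by rewrite (psdDl fb)// !(psdZl sH fb)// -/x -/y; ring.
have := gap Hz zu.
rewrite !(psd_sqr sH)// bbu eigb// eigb// bbu (psdC fb Hbu Hv) vbu => g.
have y2 : 0 < y ^+ 2 by rewrite lt_def sqrf_eq0 y0 sqr_ge0.
rewrite -(ler_pM2l y2).
have : 0 <= x ^+ 2 * (l2 - lb) by rewrite mulr_ge0 ?sqr_ge0// subr_ge0 ltW.
by move: g; rewrite sqrrN; lra.
Qed.

Let nrm := Num.sqrt (b hu hu).
Let uk1 := nrm^-1 *: hu.

Lemma newton_estimate :
  [/\ b uk1 uk1 = 1,
      a (bu - uk1) (bu - uk1) <=
        (4 / l1 + 2 * (l2 / (l2 - l1) ^+ 2)) * a (bu - uk) (bu - uk) ^+ 2 &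
      `|lb - a uk1 uk1| <= a (bu - uk1) (bu - uk1)].
Proof.
have [h1 h2 h3] := discrete_bounds.
pose s := b bu uk; pose w := uk - s *: bu.
pose p := b bu hu; pose r := hu - p *: bu.
have Ww : W w by apply: (subspaceB sW) => //; exact: (subspaceZ _ sW).
have Wr : W r by apply: (subspaceB sW) => //; exact: (subspaceZ _ sW).
have Hw := WH Ww; have Hr := WH Wr.
have wb : b w bu = 0.
  by rewrite (psdBl sH fb) ?(psdZl sH fb)// ?bbu ?mulr1 ?(psdC fb Huk) ?subrr//; exact: (subspaceZ _ sH).
have rb : b r bu = 0.
  by rewrite (psdBl sH fb) ?(psdZl sH fb)// ?bbu ?mulr1 ?(psdC fb Hhu) ?subrr//; exact: (subspaceZ _ sH).
have ukE : uk = s *: bu + 1 *: w by rewrite scale1r /w addrC subrK.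
have huE : hu = p *: bu + 1 *: r by rewrite scale1r /r addrC subrK.
have bbw : b bu w = 0 by rewrite (psdC fb).
have bbr : b bu r = 0 by rewrite (psdC fb).
have abw : a bu w = 0 by rewrite eigb// bbw mulr0.
have abr : a bu r = 0 by rewrite eigb// bbr mulr0.
have abb : a bu bu = lb by rewrite eigb// bbu mulr1.
have e1 : 1 = s ^+ 2 + b w w.
  by rewrite -{1}buk {1 2}ukE (psd_sqr sH fb)// bbu bbw; ring.
have e2 : lk = s ^+ 2 * lb + a w w.
  by rewrite lkE {1 2}ukE (psd_sqr sH fa)// abb abw; ring.
have bhu : b hu hu = p ^+ 2 + b r r.
  by rewrite {1 2}huE (psd_sqr sH fb)// bbu bbr; ring.
have HZ : H (p *: bu) by exact: (subspaceZ _ sH).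
have HZs : H (s *: bu) by exact: (subspaceZ _ sH).
have ahur : a hu r = a r r.
  by rewrite -{1}(subrK (p *: bu) hu) -/r (psdDl fa)// (psdZl sH fa)// abr mulr0 addr0.
have bhur : b hu r = b r r.
  by rewrite -{1}(subrK (p *: bu) hu) -/r (psdDl fb)// (psdZl sH fb)// bbr mulr0 addr0.
have bukr : b uk r = b w r.
  by rewrite -{1}(subrK (s *: bu) uk) -/w (psdDl fb)// (psdZl sH fb)// bbr mulr0 addr0.
have ahub : a hu bu = lb * p by rewrite (psdC fa)// eigb.
have ept : p * (lb - lk) = (lh - lk) * s.
  have := newton Wbu; rewrite ahub (psdC fb Hhu Hbu) (psdC fb Huk Hbu) -/p -/s; lra.
have er : a r r - lk * b r r = (lh - lk) * b w r.
  have := newton Wr; rewrite ahur bhur bukr; lra.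
have epc : p * s + b w r = 1.
  have bruk : b r uk = b w r by rewrite (psdC fb).
  have : b hu uk = b r uk + p * s.
    by rewrite -{1}(subrK (p *: bu) hu) -/r (psdDl fb)// (psdZl sH fb).
  by rewrite hu_uk bruk; lra.
have [ps0 arle] := newton_numeric l10 l12 h1 h2 h3 e1 e2 ept er epc
  (psd_cauchy_schwarz sH fb Hw Hr) (discrete_gap Wr rb) (discrete_gap Ww wb)
  (psd_ge0 fb Hw) (psd_ge0 fb Hr).
have lb0 : 0 < lb by exact: lt_le_trans h1.
have bhu0 : 0 < b hu hu.
  rewrite bhu ltr_pwDl ?(psd_ge0 fb Hr)// lt_def sqr_ge0 andbT sqrf_eq0.
  by apply: contraTneq ps0 => ->; rewrite mul0r ltxx.
have N0 : 0 < nrm by rewrite sqrtr_gt0.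
have N2 : nrm ^+ 2 = p ^+ 2 + b r r by rewrite sqr_sqrtr ?bhu// -bhu ltW.
have Wuk1 : W uk1 by exact: (subspaceZ _ sW).
have Huk1 := WH Wuk1.
have buk1 : b uk1 uk1 = 1.
  by rewrite (psd_sqrZ sH fb)// exprVn N2 -bhu mulVf// gt_eqF.
have aE : a (bu - uk1) (bu - uk1) = (1 - p / nrm) ^+ 2 * lb + nrm^-1 ^+ 2 * a r r.
  have -> : bu - uk1 = (1 - p / nrm) *: bu + (- nrm^-1) *: r.
    rewrite /uk1 {1}huE scale1r scalerDr scalerA scalerBl scale1r scaleNr.
    by rewrite opprD addrA [nrm^-1 * p]mulrC.
  by rewrite (psd_sqr sH fa)// abb abr sqrrN; ring.
have EE : a (bu - uk) (bu - uk) = (1 - s) ^+ 2 * lb + a w w.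
  have -> : bu - uk = (1 - s) *: bu + (-1) *: w.
    by rewrite {1}ukE scale1r scalerBl scale1r scaleN1r opprD addrA.
  by rewrite (psd_sqr sH fa)// abb abw sqrrN expr1n; ring.
split => //.
- rewrite aE EE; apply: (normalized_error l10 h1 _ N0 N2 ps0 arle).
  + by rewrite divr_ge0 ?sqr_ge0// ltW// (lt_trans l10).
  + apply: le_trans (discrete_gap Wr rb); rewrite ler_wpM2r ?(psd_ge0 fb)//.
    by move: l12; lra.
  + exact: (psd_ge0 fa).
  + exact: (psd_ge0 fb).
(* For unit vectors, [a(uk1, uk1) - lb = a(e, e) - lb b(e, e)] with [e = bu - uk1]: the eigenvalue
   error is bounded by the squared energy error. *)
- have := minb Wuk1; rewrite buk1 mulr1 => m.
  rewrite distrC ger0_norm ?subr_ge0//.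
  have : 0 <= lb * b (bu - uk1) (bu - uk1).
    by rewrite mulr_ge0 ?(ltW lb0)// (psd_ge0 fb)//; exact: (subspaceB sH).
  rewrite !(psd_sqrB sH)// bbu buk1 abb eigb//; lra.
Qed.

End newton_estimate.

(** * Finite elements *)

Section P1_elements.
Context {R : realType} {d : nat} (Omega : set 'rV[R]_d).
Hypotheses (oO : open Omega) (bO : bounded_set Omega).
Variable M : seq (d.+1.-tuple 'rV[R]_d).
Hypothesis mesh : simplicial_mesh Omega M.

Local Notation fT := ('rV[R]_d -> R^o).
Local Notation W := (P1_space Omega M : set fT).
Local Notation H := (H10 Omega : set fT).
Local Notation A := (form_a Omega).
Local Notation B := (form_b Omega).

Lemma P1_H10 : W `<=` H. Proof. by move=> v []. Qed.

Lemma P1_subspace : is_subspace W.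
Proof.
have sH := H10_subspace oO bO; split.
  split; first exact: sH.1.
  - by move=> x; exact: cvg_cst.
  - move=> K _; exists 0, 0 => x _.
    by rewrite big1 ?addr0// => i _; rewrite mxE mul0r.
move=> k u v [Hu cu au] [Hv cv av]; split; first exact: sH.2.
  move=> x; apply: cvgD; last exact: cv.
  by apply: cvgMr; exact: cu.
move=> K KM; have [p [c pc]] := au _ KM; have [q [e qe]] := av _ KM.
exists (k *: p + q), (k * c + e) => x Kx.
rewrite -[LHS]/(k * u x + v x) (pc _ Kx) (qe _ Kx).
rewrite mulrDr addrACA; congr (_ + _).
by rewrite mulr_sumr -big_split; apply: eq_bigr => i _; rewrite !mxE mulrDl mulrA.
Qed.

Definition vertices : seq 'rV[R]_d := flatten [seq tval K | K <- M].

(** The value of an affine function at a point of a simplex is the barycentric combination of its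
    vertex values, and the simplices cover the closure of [Omega]. Nothing is claimed outside
    [Omega], where elements of [H10] are arbitrary. *)
Lemma P1_vertices (v : fT) : W v -> (forall p, p \in vertices -> v p = 0) ->
  forall x, Omega x -> v x = 0.
Proof.
move=> [_ _ av] v0 x Ox; have [_ _ cover] := mesh.
have : closure Omega x by exact: subset_closure.
rewrite cover => -[K /= KM [w [w0 w1 xE]]].
have [p [c pc]] := av _ KM.
pose s := tval K; have vert (i : 'I_(size s)) : \sum_(j < d) p ord0 j * s`_i ord0 j + c = 0.
  rewrite -pc; last first.
    exists (fun k => (k == i)%:R); split.
    - by move=> k; rewrite ler0n.
    - by rewrite (bigD1 i)//= eqxx big1 ?addr0// => k /negbTE ->.
    - rewrite (bigD1 i)//= eqxx scale1r big1 ?addr0// => k /negbTE ->.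
      by rewrite scale0r.
  apply: v0; apply/flattenP; exists s; first exact: map_f.
  exact: mem_nth.
rewrite pc; last by exists w.
have -> : c = \sum_i w i * c by rewrite -mulr_suml w1 mul1r.
have -> : \sum_(j < d) p ord0 j * x ord0 j = \sum_i w i * \sum_(j < d) p ord0 j * s`_i ord0 j.
  under [RHS]eq_bigr do rewrite mulr_sumr.
  rewrite exchange_big/=; apply: eq_bigr => k _.
  rewrite xE summxE mulr_sumr; apply: eq_bigr => i _.
  by rewrite mxE mulrCA.
by rewrite -big_split big1// => i _ /=; rewrite -mulrDr vert mulr0.
Qed.

(** A minimiser of the Rayleigh quotient is a discrete eigenfunction; this turns the minimality
    among eigenvalues in [first_eigenpair] into an inequality on the whole space. *)
Lemma discrete_min (v0 : fT) : W v0 -> B v0 v0 = 1 ->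
  exists (w : fT) (m : R), [/\ W w, B w w = 1,
    forall v, W v -> A w v = m * B w v,
    forall v, W v -> m * B v v <= A v v & m <= A v0 v0].
Proof.
have sW := P1_subspace; have HL : H `<=` (L2 Omega : set fT) by exact: H10_L2.
have fA := subspace_psd P1_H10 (form_a_psd oO bO).
have fB := subspace_psd P1_H10 (subspace_psd HL (form_b_psd oO)).
apply: (finite_dim_min sW fA fB (l := fun (j : 'I_(size vertices)) v => v vertices`_j)) => //.
- move=> v Wv v0'; have vO := P1_vertices Wv _.
  rewrite /form_b /Rintegral integral0_eq// => x Ox.
  rewrite vO ?mul0r// => p /(nthP 0)[i ip <-].
  exact: (v0' (Ordinal ip)).
- by move=> v Wv; apply: H10_null => //; exact: P1_H10.
Qed.

End P1_elements.

(** * From squared norms to the explicit constants of the theorem *)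

Lemma sqrt_eq1 (R : rcfType) (x : R) : Num.sqrt x = 1 -> x = 1.
Proof.
move=> h; have x0 : 0 <= x.
  by rewrite leNgt; apply/negP => /ltW /ler0_sqrtr; rewrite h => /eqP; rewrite oner_eq0.
by rewrite -[LHS]sqr_sqrtr// h expr1n.
Qed.

(** [1 + K] dominates both [K] and its square root, so one constant serves the eigenfunction and the
    eigenvalue bounds. *)
Lemma le_sqr_bound (R : realDomainType) (K m n : R) : 0 <= K -> 0 <= n ->
  n ^+ 2 <= K * (m ^+ 2) ^+ 2 -> n <= (1 + K) * m ^+ 2.
Proof.
move=> K0 n0 h; have m0 : 0 <= m ^+ 2 by exact: sqr_ge0.
have c0 : 0 <= (1 + K) * m ^+ 2 by rewrite mulr_ge0// addr_ge0.
rewrite -ler_sqr ?nnegrE// exprMn; apply: (le_trans h).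
by rewrite ler_wpM2r ?sqr_ge0// expr2; nra.
Qed.

Theorem theorem3p2 (R : realType) :
  exists delta0 C5 C6 : R -> R -> R,
    (forall x y : R, [/\ 0 < delta0 x y, 0 < C5 x y & 0 < C6 x y]) /\
    forall (d : nat) (Omega : set 'rV[R]_d) (lam : nat -> R)
      (u1 : 'rV[R]_d -> R),
    d = 2%N \/ d = 3%N ->
    bounded_domain Omega ->
    eigenvalue_sequence Omega lam ->
    lam 0%N < lam 1%N ->
    eigenpair Omega (H10 Omega) (lam 0%N) u1 ->
    forall (gamma : R) (Mk Mk1 : seq (d.+1.-tuple 'rV[R]_d)),
    simplicial_mesh Omega Mk -> shape_regular gamma Mk ->
    simplicial_mesh Omega Mk1 -> shape_regular gamma Mk1 ->
    P1_space Omega Mk `<=` P1_space Omega Mk1 ->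
    forall (uk : 'rV[R]_d -> R) (lambdak alpha sigma : R),
    P1_space Omega Mk uk ->
    norm_b Omega uk = 1 ->
    lambdak = form_a Omega uk uk / form_b Omega uk uk ->
    norm_a Omega (uk - u1) <= delta0 (lam 1%N - lam 0%N)^-1 (lam 0%N) ->
    0 < alpha ->
    0 < sigma ->
    (forall v, H10 Omega v -> form_b Omega uk v = 0 ->
      form_a Omega v v - lambdak * form_b Omega v v
        >= alpha * norm_a Omega v ^+ 2) ->
    (forall nu : R,
      ((sigma * `|nu|)%:E <=
        ereal_sup [set (- nu * form_b Omega uk v / norm_a Omega v)%:E
          | v in [set v | H10 Omega v /\ ~ ae_eq_on Omega v (cst 0%R)]])%E) ->
    forall (lambdak1 : R) (uk1 : 'rV[R]_d -> R) (blambda : R)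
      (bu : 'rV[R]_d -> R),
    newton_step Omega (P1_space Omega Mk1) lambdak uk lambdak1 uk1 ->
    first_eigenpair Omega (P1_space Omega Mk1) blambda bu ->
    norm_a Omega (bu - uk1)
      <= C5 (lam 1%N - lam 0%N)^-1 (lam 0%N) * norm_a Omega (bu - uk) ^+ 2 /\
    `|blambda - lambdak1|
      <= C6 (lam 1%N - lam 0%N)^-1 (lam 0%N) * norm_a Omega (bu - uk) ^+ 4.
Proof.
(* For [x = 1 / (lambda_2 - lambda_1)] and [y = lambda_1] the inner sum is [lambda_2]. The absolute
   values keep [K] nonnegative at all real arguments. *)
pose K (x y : R) := 4 / `|y| + 2 * ((`|y| + `|x|^-1) * x ^+ 2).
have K0 x y : 0 <= K x y.
  apply: addr_ge0; first by rewrite divr_ge0.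
  by rewrite mulr_ge0// mulr_ge0 ?sqr_ge0// addr_ge0// invr_ge0.
have C0 x y : 0 < 1 + K x y by apply: ltr_wpDr.
(* The square of this [delta0] is at most [(lambda_2 - lambda_1) / 4], because [(1 + x)^2 >= x]; the
   added 1 keeps it defined and positive for every [x]. *)
exists (fun x _ => (1 + `|x|)^-1 / 2), (fun x y => 1 + K x y), (fun x y => 1 + K x y).
split=> [x y|].
  split; [by rewrite divr_gt0// invr_gt0 ltr_pwDl| |]; exact: C0.
move=> d Omega lam u1 d23 [oO _ _ bO] elam gap eu1 gamma Mk Mk1 _ _ mesh1 _ sub.
move=> uk lk alpha sigma Wk bk lkE close _ _ _ _ lk1 uk1 lb bu newton first.
set x := (lam 1%N - lam 0%N)^-1; set y := lam 0%N.
pose fT := 'rV[R]_d -> R^o.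
pose H : set fT := H10 Omega; pose W : set fT := P1_space Omega Mk1.
have sH : is_subspace H := H10_subspace oO bO.
have fA : psd_form H (form_a Omega) := form_a_psd oO bO.
have fB : psd_form H (form_b Omega).
  by apply: subspace_psd (form_b_psd oO); exact: H10_L2.
have sW : is_subspace W := P1_subspace oO bO Mk1.
have WH : W `<=` H := @P1_H10 _ _ _ _.
have d0 : (0 < d)%N by case: d23 => ->.
have y0 : 0 < y := eigenvalue0_gt0 oO bO eu1 (Ordinal d0).
have [Hu1 bu1 eig1] := eu1.
have ray (w : fT) : H w -> form_b Omega w u1 = 0 ->
    lam 1%N * form_b Omega w w <= form_a Omega w w.
  exact: (rayleigh_orthogonal oO bO elam gap eu1).
have g0 : 0 < lam 1%N - y by rewrite subr_gt0.
have x0 : 0 < x by rewrite invr_gt0.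
have buk : form_b Omega uk uk = 1 by exact: sqrt_eq1.
have {}lkE : lk = form_a Omega uk uk by rewrite lkE buk divr1.
have Wuk : W uk by exact: sub.
have Hd : H (uk - u1 : fT) by apply: (subspaceB sH) => //; exact: WH.
have sq (v : fT) : H v -> norm_a Omega v ^+ 2 = form_a Omega v v.
  by move=> Hv; apply: sqr_sqrtr; exact: (psd_ge0 fA Hv).
have {}close : form_a Omega (uk - u1 : fT) (uk - u1 : fT) <= (lam 1%N - y) / 4.
  rewrite -[leLHS](sq _ Hd).
  have nn : 0 <= norm_a Omega (uk - u1 : fT) by exact: sqrtr_ge0.
  apply: (@le_trans _ _ (((1 + `|x|)^-1 / 2) ^+ 2)).
    by rewrite lerXn2r// nnegrE (le_trans nn).
  rewrite gtr0_norm// -[lam 1%N - y]invrK -/x expr_div_n -natrX ler_pM2r ?invr_gt0//.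
  rewrite exprVn lef_pV2 ?posrE ?exprn_gt0 ?addr_gt0//.
  by rewrite expr2; nra.
have [[Wbu bbu eigb] lbmin] := first.
have minb (v : fT) : W v -> lb * form_b Omega v v <= form_a Omega v v.
  move=> Wv; have [w [m [Ww bw aw mmin _]]] := discrete_min oO bO mesh1 Wbu bbu.
  apply: le_trans (mmin _ Wv); rewrite ler_wpM2r//; last by apply: (lbmin _ w).
  by apply: (psd_ge0 fB); exact: WH.
have [lh [hu [[Whu newt huk] uk1E lk1E]]] := newton.
have [buk1 est1 est2] := newton_estimate sH fA fB y0 gap Hu1 bu1 eig1 ray sW WH Wuk buk lkE
  close Wbu bbu eigb minb Whu newt (etrans huk buk).
have E : (Num.sqrt (form_b Omega hu hu))^-1 *: (hu : fT) = uk1.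
  by rewrite uk1E; apply/funext => z; rewrite mulrC.
rewrite E in buk1 est1 est2.
have Wuk1 : W uk1 by rewrite -E; exact: (subspaceZ _ sW).
have Hd1 : H (bu - uk1 : fT) by apply: (subspaceB sH); exact: WH.
have Hd2 : H (bu - uk : fT) by apply: (subspaceB sH); exact: WH.
have KE : 4 / y + 2 * (lam 1%N / (lam 1%N - y) ^+ 2) = K x y.
  rewrite /K !gtr0_norm// /x invrK exprVn; congr (_ + 2 * (_ / _)).
  by rewrite addrC subrK.
rewrite KE -(sq _ Hd1) -(sq _ Hd2) in est1.
split; first by exact: (le_sqr_bound (K0 x y) (sqrtr_ge0 _) est1).
rewrite lk1E buk1 divr1; apply: (le_trans est2); rewrite -[leLHS](sq _ Hd1).
apply: (le_trans est1).
have -> : norm_a Omega (bu - uk) ^+ 4 = (norm_a Omega (bu - uk : fT) ^+ 2) ^+ 2.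
  by rewrite -exprM.
by apply: ler_wpM2r; [exact: sqr_ge0|rewrite lerDr].
Qed.
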